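(* Consider the random field Ising model with bimodal field in dimension $d=2$. For every $0\le\beta<\beta_c(2)$ there exists $H_1(\beta)>0$, where $H_1(\beta)=\infty$ if $\beta\in[0,\beta_P(2)]$ and $H_1(\beta)\in(0,\infty)$ if $\beta\in(\beta_P(2),\beta_c(2))$, such that for each $H\in[0,H_1(\beta))$ there are constants $C_1(\beta,H),C_7(\beta,H)\in(0,\infty)$ depending only on $\beta,H$, where $C_1(\beta,H)$ is a rate for which the weak mixing bound $$\sup_{\eta,\eta'\in\{-1,+1\}^{\partial_{ex}\Lambda}}TV\left(P^{\vec h}_{\Lambda,\eta,\beta,H}(\sigma_\Delta\in\cdot),P^{\vec h}_{\Lambda,\eta',\beta,H}(\sigma_\Delta\in\cdot)\right)\le\sum_{x\in\partial_{ex}\Delta,\,y\in\partial_{ex}\Lambda}e^{-C_1(\beta,H)|x-y|}$$ holds for all finite $\Delta\subseteq\Lambda\subseteq\mathbb{Z}^2$ and all $\vec h\in\{-1,+1\}^\Lambda$, such that $$0\le\langle\sigma_x\sigma_y\rangle^{\vec h}_{\mathbb{Z}^2,\beta,H}-\langle\sigma_x\rangle^{\vec h}_{\mathbb{Z}^2,\beta,H}\langle\sigma_y\rangle^{\vec h}_{\mathbb{Z}^2,\beta,H}\le C_7(\beta,H)\,e^{-C_1(\beta,H)|x-y|/2}\qquad\text{for all }x,y\in\mathbb{Z}^2$$ for every realization $\vec h\in\{-1,+1\}^{\mathbb{Z}^2}$.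
   Context: For a finite $\Lambda\subseteq\mathbb{Z}^d$, $\partial_{ex}\Lambda$ is the set of vertices of $\mathbb{Z}^d\setminus\Lambda$ having a nearest neighbor in $\Lambda$. For $\beta\ge0$, $H\ge 0$, $\eta\in\{-1,+1\}^{\partial_{ex}\Lambda}$ and $\vec h\in\mathbb{R}^\Lambda$, $P^{\vec h}_{\Lambda,\eta,\beta,H}$ is the probability measure on $\{-1,+1\}^\Lambda$ given by $$P^{\vec h}_{\Lambda,\eta,\beta,H}(\sigma)\propto\exp\Big[\beta\sum_{\{u,v\}}\sigma_u\sigma_v+\beta\sum_{\{u,v\}:u\in\Lambda,v\in\partial_{ex}\Lambda}\sigma_u\eta_v+H\sum_{u\in\Lambda}h_u\sigma_u\Big],$$ where the first sum is over (unordered) nearest neighbor pairs in $\Lambda$ and the second over nearest neighbor pairs; for $\vec h\in\mathbb{R}^{\mathbb{Z}^d}$ the restriction of $\vec h$ to $\Lambda$ is used. In the random field Ising model (RFIM), $\vec h$ is a realization of i.i.d. random variables $H_u$ of mean $0$ and variance $1$; the bimodal field has $\mathrm{Prob}(H_u=+1)=\mathrm{Prob}(H_u=-1)=1/2$. $\sigma_\Delta$ is the restriction of $\sigma$ to $\Delta$, $TV$ is total variation distance, $|\cdot|$ is the Euclidean norm. For the $(\beta,H)$ considered, $P^{\vec h}_{\mathbb{Z}^d,\beta,H}$ (here $d=2$) denotes the infinite volume limit of $P^{\vec h}_{\Lambda,\eta,\beta,H}$ as $\Lambda\to\mathbb{Z}^d$, which exists, is unique and does not depend on $\eta$ (by the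 FKG lattice property and weak mixing); $\langle\cdot\rangle^{\vec h}_{\mathbb{Z}^d,\beta,H}$ is its expectation. $\beta_c(d)$ is the critical inverse temperature of the (homogeneous, nearest neighbor) Ising model on $\mathbb{Z}^d$ with $H=0$. $\beta_P(d)$ is defined by $1-e^{-2\beta_P(d)}=p_c^b(d)$, where $p_c^b(d)$ is the critical probability of independent Bernoulli bond percolation on $\mathbb{Z}^d$. *)

(* Defs.v *)
From HB Require Import structures.
From mathcomp Require Import all_boot all_order all_algebra finmap.
From mathcomp Require Import all_classical all_reals all_analysis.
From mathcomp.analysis Require Import showcase.summability.

Set Implicit Arguments.
Unset Strict Implicit.
Unset Printing Implicit Defensive.

Import Order.TTheory GRing.Theory Num.Theory.
Import numFieldNormedType.Exports.

Local Open Scope classical_set_scope.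
Local Open Scope ring_scope.

Notation Zd d := 'rV[int]_d.

Section Lattice.
Variable d : nat.
Implicit Types (x y u v : Zd d) (L : {fset Zd d}).

Definition unitv (i : 'I_d) : Zd d := delta_mx 0 i.

Definition adj x y : bool :=
  [exists i : 'I_d, (y == x + unitv i) || (x == y + unitv i)].

Definition nbrs x : seq (Zd d) :=
  [seq x + unitv i | i : 'I_d] ++ [seq x - unitv i | i : 'I_d].

Lemma mem_nbrs x y : (y \in nbrs x) = adj x y.
Proof.
rewrite mem_cat; apply/orP/existsP => [[|]|[i /orP[/eqP ->|/eqP ->]]].
- by case/mapP=> i _ ->; exists i; rewrite eqxx.
- by case/mapP=> i _ ->; exists i; rewrite subrK eqxx orbT.
- by left; apply/mapP; exists i; rewrite ?mem_enum.
- by right; apply/mapP; exists i; rewrite ?mem_enum// addrK.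
Qed.

Definition exbd L : {fset Zd d} :=
  [fset v in flatten [seq nbrs u | u <- L] | v \notin L]%fset.

Lemma in_exbd L v :
  (v \in exbd L) = (v \notin L) && [exists u : L, adj (val u) v].
Proof.
rewrite !inE andbC; congr (_ && _); apply/flattenP/existsP.
- move=> [s /mapP[u uL ->]]; rewrite mem_nbrs => uv.
  by exists [` uL]%fset.
- move=> [u uv]; exists (nbrs (val u)); last by rewrite mem_nbrs.
  by apply/mapP; exists (val u) => //; exact: valP.
Qed.

Definition eucl_dist (R : realType) x y : R :=
  Num.sqrt (\sum_(i < d) ((x 0 i - y 0 i)%:~R ^+ 2)).

End Lattice.

(* A spin is a boolean: [true] stands for +1 and [false] for -1. *)
Definition spin (R : realType) (b : bool) : R := if b then 1 else -1.

Notation spins L := {ffun L -> bool}.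

Section FiniteVolume.
Variables (R : realType) (d : nat).
Implicit Types (L D : {fset Zd d}) (beta H : R).

(* The factor 1/2 compensates for each unordered nearest neighbor pair of L
   being enumerated twice. *)
Definition log_weight L (eta : spins (exbd L)) beta H (h : L -> R)
    (s : spins L) : R :=
  beta * (2^-1 * \sum_(u : L) \sum_(v : L | adj (val u) (val v))
                    spin R (s u) * spin R (s v))
  + beta * (\sum_(u : L) \sum_(v : exbd L | adj (val u) (val v))
              spin R (s u) * spin R (eta v))
  + H * (\sum_(u : L) h u * spin R (s u)).

Definition gibbs L (eta : spins (exbd L)) beta H (h : L -> R)
    (s : spins L) : R :=
  expR (log_weight eta beta H h s) / \sum_(t : spins L) expR (log_weight eta beta H h t).

(* Off L the value is +1 by convention; [spin_at] is meant for x in L. *)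
Definition spin_at L (s : spins L) (x : Zd d) : bool :=
  oapp (fun u : L => s u) true (insub x).

Definition restr L D (s : spins L) : spins D :=
  [ffun v : D => spin_at s (val v)].

(* P^h_{L,eta,beta,H} (sigma_D \in A), for D included in L. *)
Definition gibbs_law L D (eta : spins (exbd L)) beta H (h : L -> R)
    (A : {set spins D}) : R :=
  \sum_(s : spins L | restr D s \in A) gibbs eta beta H h s.

End FiniteVolume.

Definition TV (R : realType) (S : finType) (P Q : {set S} -> R) : R :=
  \big[Num.max/0]_(A : {set S}) `|P A - Q A|.

(* One-coordinate cylinders; they generate the product sigma-algebra. *)
Definition cylinders (I : Type) : set_system (I -> bool) :=
  [set A | exists i b, A = [set w | w i = b]].

Definition config (I : Type) := g_sigma_algebraType (@cylinders I).

Section InfiniteVolume.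
Variables (R : realType) (d : nat).

(* Convergence along the net of all finite L ordered by inclusion, of the law
   of every finite-dimensional marginal.  The boundary condition may be chosen
   arbitrarily for each L, so the limit is independent of it. *)
Definition is_infinite_volume_limit (beta H : R) (h : Zd d -> R)
    (mu : probability (config (Zd d)) R) : Prop :=
  forall (eta : forall L : {fset Zd d}, spins (exbd L))
         (D : {fset Zd d}) (A : {set spins D}),
    gibbs_law (eta L) beta H (h \o val) A @[L --> totally] -->
    fine (mu [set w | [ffun v : D => w (val v)] \in A]).

Definition expect (mu : probability (config (Zd d)) R)
    (f : config (Zd d) -> R) : R := fine 'E_mu[f].

End InfiniteVolume.

Section IsingCritical.
Variables (R : realType) (d : nat).

Definition plus_bc (L : {fset Zd d}) : spins (exbd L) := [ffun=> true].

(* <sigma_0>^+_{L,beta} in the homogeneous model without field *)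
Definition plus_magnetization (beta : R) (L : {fset Zd d}) : R :=
  \sum_(s : spins L)
    spin R (spin_at s 0) * gibbs (plus_bc L) beta 0 (fun=> 0) s.

Definition spontaneous_magnetization (beta : R) : R :=
  lim (plus_magnetization beta L @[L --> totally]).

(* The infimum of the b with positive spontaneous magnetization; infinite if
   there are none (d = 1). *)
Definition beta_c : \bar R :=
  ereal_inf [set b%:E | b in
    [set b : R | 0 <= b /\ 0 < spontaneous_magnetization b]].

End IsingCritical.

Section Percolation.
Variables (R : realType) (d : nat).

(* (x, i) is the nearest neighbor bond {x, x + e_i}; every bond of Z^d is of
   this form for a unique (x, i). *)
Definition bond : choiceType := (Zd d * 'I_d)%type.

Definition open_step (w : bond -> bool) : rel (Zd d) := fun x y =>
  [exists i : 'I_d, ((y == x + unitv i) && w (x, i))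
                 || ((x == y + unitv i) && w (y, i))].

Definition open_cluster (w : bond -> bool) (x : Zd d) : set (Zd d) :=
  [set y | exists p : seq (Zd d), path (open_step w) x p /\ last x p = y].

Definition bernoulli_percolation (p : R) (P : probability (config bond) R) :=
  forall (F : {fset bond}) (a : bond -> bool),
    P [set w | forall e, e \in F -> w e = a e] =
    (\prod_(e <- F) (if a e then p else 1 - p))%:E.

(* The law P is determined by p; the event is that the origin lies in an
   infinite open cluster. *)
Definition percolates (p : R) : Prop :=
  exists P : probability (config bond) R, bernoulli_percolation p P /\
    (0 < P [set w | infinite_set (open_cluster w 0)])%E.

Definition p_c : R := inf [set p : R | 0 <= p <= 1 /\ percolates p].

(* The solution of 1 - exp (-2 beta) = p_c, infinite when p_c = 1 (d = 1). *)
Definition beta_P : \bar R :=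
  if p_c < 1 then (- ln (1 - p_c) / 2)%:E else +oo%E.

Lemma beta_PE : p_c < 1 ->
  exists2 b : R, beta_P = b%:E & 1 - expR (- 2 * b) = p_c.
Proof.
rewrite /beta_P => pc1; rewrite pc1; exists (- ln (1 - p_c) / 2) => //.
rewrite mulNr mulrCA mulfV ?pnatr_eq0// mulr1 opprK lnK ?subKr//.
by rewrite posrE subr_gt0.
Qed.

End Percolation.

(* Main.v *)
(* Let dd_L(v) be half the difference of the mean spins at v under plus and
   minus boundary conditions on L.  By the inequality of Ding, Song and Sun, an
   external field can only decrease the influence of the boundary on a spin.
   Changing the boundary spins of S one at a time therefore yields, for every
   field, dd_L(v) <= sum_x wt(v, x) dd_L(x) over the boundary of S + v, where
   the weights are those of the model without field, and their sum is
   beta phi(S).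

   If beta < beta_c, then beta phi(S) <= 1/2 for some finite S containing 0:
   otherwise, exploring from the boundary the cluster of vertices at which two
   copies of the plus model are both plus gives m' >= c (1 - m) for its
   magnetization m, hence spontaneous magnetization below beta_c.  Iterating,
   dd decays exponentially in the distance to the boundary, uniformly in the
   field, for every H.

   A local event becomes monotone after adding a multiple of the number of plus
   spins, so FKG bounds its boundary influence by the sum of the dd.  Applying
   this on Lambda to a function living on the exterior boundary of Delta gives
   weak mixing with prefactor 1: the prefactor is absorbed in the rate when the
   two boundaries are far apart, and otherwise two nearby pairs of boundary
   points already make the right-hand side exceed 1.

   The limit measure is the law of the configuration read off from one uniform
   variable.  Finally, conditionally on the spin at y, the mean spin at x takes
   two values, which by FKG differ by at most 2 dd_{L - y}(x). *)

Require Import Defs.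
From HB Require Import structures.
From mathcomp Require Import all_boot all_order all_algebra finmap.
From mathcomp Require Import all_classical all_reals all_analysis.
From mathcomp.analysis Require Import showcase.summability.
From mathcomp Require Import ring lra zify.

Set Implicit Arguments.
Unset Strict Implicit.
Unset Printing Implicit Defensive.

Import Order.TTheory GRing.Theory Num.Theory.
Import numFieldNormedType.Exports.

Local Open Scope classical_set_scope.
Local Open Scope ring_scope.

(** * Finite Ising models *)

(** The obstacle is uniformity in the field: a contraction for dd can be iterated only if its
    weights ignore the field. The comparison with zero field is proved for an arbitrary field k next
    to the boundary field h, because the two mix at each vertex. In terms of the odds of one spin
    both act by multiplication, so all reduces to an inequality between fractional linear functions.

    Taken with k = h, the same inequality says that doubling a field at most doubles the
    magnetization. Halving the field repeatedly then bounds the magnetization by its linear part;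
    this is where the zero field correlations in wt, hence in phi, come from.

    In the sharpness argument c is a lower bound for phi: if the exploration stops with the origin
    in the unexplored set S, the covariance that is left is at least phi(S) times the weight of that
    outcome, and if it reaches the origin nothing has to be shown.

    Since the decay holds for every H, the threshold H_1 is a matter of choice, infinite or finite
    as prescribed. *)

Section Ising.
Variables (R : realType) (V : finType).
Implicit Types (J : V -> V -> R) (h : V -> R) (s t : spins V) (S : {set V}).
Implicit Types (f g : spins V -> R).

Definition energy J h s : R :=
  2^-1 * (\sum_u \sum_v J u v * (spin R (s u) * spin R (s v)))
  + \sum_u h u * spin R (s u).

Definition weight J h s : R := expR (energy J h s).

Definition Zsum J h : R := \sum_s weight J h s.

Definition Ex J h f : R := (\sum_s weight J h s * f s) / Zsum J h.

Lemma weight_gt0 J h s : 0 < weight J h s. Proof. exact: expR_gt0. Qed.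

Lemma Zsum_gt0 J h : 0 < Zsum J h.
Proof.
rewrite /Zsum (bigD1 [ffun=> true])//= ltr_pwDl ?weight_gt0//.
by apply: sumr_ge0 => s _; exact/ltW/weight_gt0.
Qed.

Lemma Zsum_neq0 J h : Zsum J h != 0. Proof. by rewrite gt_eqF ?Zsum_gt0. Qed.

Lemma ExE J h f : Zsum J h * Ex J h f = \sum_s weight J h s * f s.
Proof. by rewrite /Ex mulrC divfK ?Zsum_neq0. Qed.

Lemma Ex_cst J h c : Ex J h (fun=> c) = c.
Proof. by rewrite /Ex -mulr_suml mulrAC divff ?mul1r ?Zsum_neq0. Qed.

Lemma ExD J h f g : Ex J h (fun s => f s + g s) = Ex J h f + Ex J h g.
Proof.
by rewrite /Ex -mulrDl -big_split/=; congr (_ / _); apply: eq_bigr => s _; rewrite mulrDr.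
Qed.

Lemma ExZ J h c f : Ex J h (fun s => c * f s) = c * Ex J h f.
Proof.
by rewrite /Ex mulrA mulr_sumr; congr (_ / _); apply: eq_bigr => s _; rewrite mulrCA.
Qed.

Lemma Ex_mulC J h f g : Ex J h (fun s => f s * g s) = Ex J h (fun s => g s * f s).
Proof. by congr Ex; apply/funext => s; rewrite mulrC. Qed.

Lemma ExN J h f : Ex J h (fun s => - f s) = - Ex J h f.
Proof.
by rewrite -mulN1r -ExZ; congr Ex; apply/funext => s; rewrite mulN1r.
Qed.

Lemma ExB J h f g : Ex J h (fun s => f s - g s) = Ex J h f - Ex J h g.
Proof. by rewrite ExD ExN. Qed.

Lemma Ex_sum (I : Type) (r : seq I) (P : pred I) J h (F : I -> spins V -> R) :
  Ex J h (fun s => \sum_(i <- r | P i) F i s) = \sum_(i <- r | P i) Ex J h (F i).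
Proof.
elim: r => [|i r IH].
  by rewrite big_nil -[RHS](Ex_cst J h 0); congr Ex; apply/funext => s; rewrite big_nil.
rewrite big_cons -IH; case: ifPn => Pi; [rewrite -ExD|]; congr Ex; apply/funext => s.
  by rewrite big_cons Pi.
by rewrite big_cons (negPf Pi).
Qed.

Lemma ler_Ex J h f g : (forall s, f s <= g s) -> Ex J h f <= Ex J h g.
Proof.
move=> fg; apply: ler_wpM2r; first by rewrite invr_ge0 ltW ?Zsum_gt0.
by apply: ler_sum => s _; rewrite ler_wpM2l// ltW ?weight_gt0.
Qed.

Lemma Ex_ge0 J h f : (forall s, 0 <= f s) -> 0 <= Ex J h f.
Proof. by move=> f0; rewrite -(Ex_cst J h 0); exact: ler_Ex. Qed.

Lemma Ex_gt0 J h f : (forall s, 0 < f s) -> 0 < Ex J h f.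
Proof.
move=> f0; rewrite /Ex divr_gt0 ?Zsum_gt0// (bigD1 [ffun=> true])//=.
rewrite ltr_pwDl ?mulr_gt0 ?weight_gt0//.
by apply: sumr_ge0 => s _; rewrite mulr_ge0// ltW ?weight_gt0.
Qed.

Lemma Ex_tilt J h J' h' (X : spins V -> R) f :
  (forall s, energy J' h' s = energy J h s + X s) ->
  Ex J' h' f = Ex J h (fun s => expR (X s) * f s) / Ex J h (fun s => expR (X s)).
Proof.
move=> EX; have WE s : weight J' h' s = weight J h s * expR (X s).
  by rewrite /weight EX expRD.
rewrite {2 3}/Ex invf_div mulrA divfK ?Zsum_neq0// /Ex /Zsum.
congr (_ / _); last by apply: eq_bigr => s _; rewrite WE.
by apply: eq_bigr => s _; rewrite WE mulrA.
Qed.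

Definition mix S t s : spins V := [ffun u => if u \in S then s u else t u].

(** Vertices outside S stay in the model, decoupled and, with [bfield], without field, so that
    conditioning never changes the type V. *)
Definition inner J S u v : R := if (u \in S) && (v \in S) then J u v else 0.

Definition bfield J h S t u : R :=
  if u \in S then h u + \sum_(v | v \notin S) J u v * spin R (t v) else 0.

Definition outer_energy J h S t : R :=
  2^-1 * (\sum_(u | u \notin S) \sum_(v | v \notin S)
            J u v * (spin R (t u) * spin R (t v)))
  + \sum_(u | u \notin S) h u * spin R (t u).

Lemma mix_in S t s u : u \in S -> mix S t s u = s u.
Proof. by rewrite ffunE => ->. Qed.

Lemma mix_out S t s u : u \notin S -> mix S t s u = t u.
Proof. by rewrite ffunE => /negPf ->. Qed.

Lemma mix_id S s : mix S s s = s.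
Proof. by apply/ffunP => u; rewrite ffunE if_same. Qed.

Lemma mix_mix S t s t' s' : mix S (mix S t s) (mix S t' s') = mix S t s'.
Proof. by apply/ffunP => u; rewrite !ffunE; case: (u \in S). Qed.

Lemma energy_mix J h S t s : (forall u v, J u v = J v u) ->
  energy J h (mix S t s)
  = energy (inner J S) (bfield J h S t) s + outer_energy J h S t.
Proof.
move=> symJ; pose a u v := J u v * (spin R (s u) * spin R (s v)).
pose b u v := J u v * (spin R (s u) * spin R (t v)).
pose c u v := J u v * (spin R (t u) * spin R (t v)).
have -> : energy J h (mix S t s) =
    2^-1 * (\sum_(u in S) (\sum_(v in S) a u v + \sum_(v | v \notin S) b u v)
     + \sum_(u | u \notin S) (\sum_(v in S) b v u + \sum_(v | v \notin S) c u v))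
    + (\sum_(u in S) h u * spin R (s u) + \sum_(u | u \notin S) h u * spin R (t u)).
  rewrite /energy; congr (_ * _ + _); last first.
    rewrite (bigID (mem S))/=; congr (_ + _); apply: eq_bigr => u uS.
      by rewrite mix_in.
    by rewrite mix_out.
  rewrite (bigID (mem S))/=; congr (_ + _); apply: eq_bigr => u uS;
  rewrite (bigID (mem S))/=; congr (_ + _); apply: eq_bigr => v vS.
  - by rewrite /a !mix_in.
  - by rewrite /b mix_in// mix_out.
  - by rewrite /b mix_out// mix_in// symJ [X in _ * X]mulrC.
  - by rewrite /c !mix_out.
have -> : energy (inner J S) (bfield J h S t) s =
   2^-1 * (\sum_(u in S) \sum_(v in S) a u v) +
   (\sum_(u in S) h u * spin R (s u) + \sum_(u in S) \sum_(v | v \notin S) b u v).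
  rewrite /energy; congr (_ * _ + _).
    rewrite [RHS]big_mkcond/=; apply: eq_bigr => u _; rewrite /inner.
    case: ifPn => uS; last by rewrite big1// => v _; rewrite mul0r.
    by rewrite [RHS]big_mkcond/=; apply: eq_bigr => v _; case: ifP; rewrite ?mul0r.
  rewrite -big_split [RHS]big_mkcond/=; apply: eq_bigr => u _; rewrite /bfield.
  case: ifPn => uS; last by rewrite mul0r.
  rewrite mulrDl mulr_suml; congr (_ + _); apply: eq_bigr => v _.
  by rewrite /b -mulrA [X in _ * X]mulrC.
rewrite !big_split/= (exchange_big _ _ _ _ _ (fun u v => b v u))/=.
by rewrite /outer_energy -/(c _ _); field.
Qed.

Lemma bfield_mix J h S t s : bfield J h S (mix S t s) = bfield J h S t.
Proof.
apply/funext => u; rewrite /bfield; case: ifP => // _; congr (_ + _).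
by apply: eq_bigr => v vS; rewrite mix_out.
Qed.

Lemma outer_energy_mix J h S t s : outer_energy J h S (mix S t s) = outer_energy J h S t.
Proof.
rewrite /outer_energy; congr (_ * _ + _); last first.
  by apply: eq_bigr => u uS; rewrite mix_out.
by apply: eq_bigr => u uS; apply: eq_bigr => v vS; rewrite !mix_out.
Qed.

Lemma weight_inner_mix J h S t t' s :
  weight (inner J S) (bfield J h S t) (mix S t' s) = weight (inner J S) (bfield J h S t) s.
Proof.
rewrite /weight; suff -> : energy (inner J S) (bfield J h S t) (mix S t' s)
  = energy (inner J S) (bfield J h S t) s by [].
rewrite /energy; congr (_ * _ + _).
  apply: eq_bigr => u _; apply: eq_bigr => v _; rewrite /inner.
  by case: ifPn => [/andP[uS vS]|_]; rewrite ?mul0r// !mix_in.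
by apply: eq_bigr => u _; rewrite /bfield; case: ifPn => uS; rewrite ?mul0r ?mix_in.
Qed.

Lemma sum_mix (S : {set V}) (F : spins V -> spins V -> R) :
  \sum_t \sum_s F t s = \sum_t \sum_s F (mix S t s) (mix S s t).
Proof.
rewrite !pair_big/= (reindex (fun p => (mix S p.1 p.2, mix S p.2 p.1)))//=.
exists (fun p => (mix S p.1 p.2, mix S p.2 p.1)) => -[t s] _ /=;
by rewrite !mix_mix !mix_id.
Qed.

(* Exchanging the spins inside S of the two configurations t and s is an
   involution that turns one side into the other. *)
Lemma Ex_markov J h S f : (forall u v, J u v = J v u) ->
  Ex J h f = Ex J h (fun t => Ex (inner J S) (bfield J h S t) (fun s => f (mix S t s))).
Proof.
move=> symJ; rewrite [LHS]/Ex [RHS]/Ex; congr (_ / _).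
pose c t := expR (outer_energy J h S t).
pose W t s := weight (inner J S) (bfield J h S t) s.
have WE t : weight J h t = c t * W t t.
  by rewrite -{1}(mix_id S t) /weight energy_mix// expRD mulrC.
pose F t s := c t * W t t * (W t s * f (mix S t s) / Zsum (inner J S) (bfield J h S t)).
transitivity (\sum_t \sum_s F t s); last first.
  apply: eq_bigr => t _; rewrite /Ex mulr_suml mulr_sumr.
  by apply: eq_bigr => s _; rewrite WE.
rewrite (sum_mix S); apply: eq_bigr => t _.
transitivity (\sum_s c t * W t s * (W t t * f t / Zsum (inner J S) (bfield J h S t))).
  rewrite -mulr_suml -mulr_sumr -/(Zsum _ _) WE.
  by field; exact: Zsum_neq0.
apply: eq_bigr => s _.
rewrite /F /W /c bfield_mix outer_energy_mix !weight_inner_mix mix_mix mix_id.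
by [].
Qed.

Definition supported f S := forall s t, {in S, s =1 t} -> f s = f t.

Definition le_conf s t := forall u, s u ==> t u.

Definition increasing f := forall s t, le_conf s t -> f s <= f t.

Lemma ler_spin (b c : bool) : b ==> c -> spin R b <= spin R c.
Proof. by case: b c => [] []//= _; rewrite ?lerN10// lerN10 || lra. Qed.

Lemma le_conf_mix S t t' s s' : le_conf t t' -> le_conf s s' ->
  le_conf (mix S t s) (mix S t' s').
Proof. by move=> tt' ss' u; rewrite !ffunE; case: ifP. Qed.

Lemma increasing_field (d : V -> R) : (forall u, 0 <= d u) ->
  increasing (fun s => \sum_u d u * spin R (s u)).
Proof.
by move=> d0 s t st; apply: ler_sum => u _; rewrite ler_wpM2l//; exact: ler_spin.
Qed.

Lemma Ex_field J h h' f :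
  Ex J h' f = Ex J h (fun s => expR (\sum_u (h' u - h u) * spin R (s u)) * f s)
            / Ex J h (fun s => expR (\sum_u (h' u - h u) * spin R (s u))).
Proof.
apply: Ex_tilt => s; rewrite /energy -addrA -big_split; congr (_ + _).
by apply: eq_bigr => u _ /=; ring.
Qed.

Lemma cov_two_valued J h (p : pred (spins V)) (a b a' b' : R) :
  Ex J h (fun s => (if p s then a else b) * (if p s then a' else b'))
  - Ex J h (fun s => if p s then a else b) * Ex J h (fun s => if p s then a' else b')
  = (a - b) * (a' - b') * (Ex J h (fun s => (p s)%:R) * (1 - Ex J h (fun s => (p s)%:R))).
Proof.
have aff (x y : R) : Ex J h (fun s => if p s then x else y)
    = y + (x - y) * Ex J h (fun s => (p s)%:R).
  rewrite -ExZ -{2}(Ex_cst J h y) -ExD; congr Ex; apply/funext => s.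
  by case: (p s); rewrite ?mulr1 ?mulr0 ?addr0 ?subrKC.
have -> : Ex J h (fun s => (if p s then a else b) * (if p s then a' else b'))
    = Ex J h (fun s => if p s then a * a' else b * b').
  by congr Ex; apply/funext => s; case: (p s).
by rewrite !aff; ring.
Qed.

Lemma prob01 J h (p : pred (spins V)) : 0 <= Ex J h (fun s => (p s)%:R) <= 1.
Proof.
rewrite Ex_ge0//= -[leRHS](Ex_cst J h 1); apply: ler_Ex => s.
by rewrite lern1 leq_b1.
Qed.

Definition others (z : V) : {set V} := (~: [set z])%SET.

(** Conditional expectation given the spin b at z: as z is the only vertex outside [others z], a
    constant configuration is a sufficient boundary condition. *)
Definition cond J h z f (b : bool) : R :=
  Ex (inner J (others z)) (bfield J h (others z) [ffun=> b])
     (fun s => f (mix (others z) [ffun=> b] s)).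

Lemma in_others z u : (u \in others z) = (u != z).
Proof. by rewrite !inE. Qed.

Lemma bfield_others J h z b u :
  bfield J h (others z) [ffun=> b] u = if u == z then 0 else h u + spin R b * J u z.
Proof.
rewrite /bfield in_others; case: eqP => //= _; congr (_ + _).
rewrite (big_pred1 z) => [|v]; last by rewrite in_others negbK.
by rewrite ffunE mulrC.
Qed.

Lemma Ex_cond J h z f : (forall u v, J u v = J v u) ->
  Ex J h f = Ex J h (fun t => if t z then cond J h z f true else cond J h z f false).
Proof.
move=> sJ; rewrite (Ex_markov h (others z) f sJ); congr Ex; apply/funext => t.
have bE : bfield J h (others z) t = bfield J h (others z) [ffun=> t z].
  apply/funext => u; rewrite /bfield; case: ifP => // _; congr (_ + _).
  by apply: eq_bigr => v; rewrite in_others negbK => /eqP ->; rewrite ffunE.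
have mE s : mix (others z) t s = mix (others z) [ffun=> t z] s.
  apply/ffunP => u; rewrite !ffunE in_others.
  by case: eqP => //= ->.
have -> : (if t z then cond J h z f true else cond J h z f false) = cond J h z f (t z).
  by case: (t z).
rewrite /cond bE; congr Ex; apply/funext => s.
by rewrite mE.
Qed.

Lemma inner_sym J S : (forall u v, J u v = J v u) -> forall u v, inner J S u v = inner J S v u.
Proof. by move=> sJ u v; rewrite /inner sJ andbC. Qed.

Lemma inner_ge0 J S : (forall u v, 0 <= J u v) -> forall u v, 0 <= inner J S u v.
Proof. by move=> J0 u v; rewrite /inner; case: ifP. Qed.

Lemma supported_mix f S z b : supported f S ->
  supported (fun s => f (mix (others z) [ffun=> b] s)) (S :\ z)%SET.
Proof.
move=> fS s t st; apply: fS => u uS; rewrite !ffunE in_others.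
by case: eqVneq => //= uz; apply: st; rewrite !inE uz.
Qed.

Lemma increasing_mix f S t : increasing f -> increasing (fun s => f (mix S t s)).
Proof. by move=> fi s s' ss'; apply/fi/le_conf_mix => // u; exact: implybb. Qed.

(* Induction on the set S of relevant vertices, conditioning on one spin: the
   conditional expectations given that spin increase with it because the two
   conditional measures are tilts of one another by an increasing weight. *)
Theorem fkg J h f g S : (forall u v, J u v = J v u) -> (forall u v, 0 <= J u v) ->
  (forall u v, u \notin S -> J u v = 0) ->
  supported f S -> supported g S -> increasing f -> increasing g ->
  Ex J h f * Ex J h g <= Ex J h (fun s => f s * g s).
Proof.
move: {2}#|S| (leqnn #|S|) => n; elim: n => [|n IH] in J h f g S * => Sn sJ J0 JS fS gS fi gi.
  have cst k : supported k S -> k = fun=> k [ffun=> true].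
    move=> kS; apply/funext => s; apply: kS => u uS.
    by move: Sn; rewrite leqn0 cards_eq0 => /eqP S0; rewrite S0 inE in uS.
  by rewrite (cst _ fS) (cst _ gS) !Ex_cst.
have [z zS|S0] := pickP (mem S); last first.
  apply: (IH J h f g S) => //; rewrite (_ : #|S| = 0%N)//.
  exact: eq_card0.
have {}zS : z \in S by [].
set T := others z.
have cardT : (#|(S :\ z)%SET| <= n)%N by rewrite (cardsD1 z S) zS in Sn.
have JT u v : u \notin (S :\ z)%SET -> inner J T u v = 0.
  rewrite !inE negb_and negbK /inner !in_others => /orP[/eqP ->|/JS ->]; rewrite ?eqxx//.
  by rewrite if_same.
have IHc b k k' (kS : supported k S) (kS' : supported k' S) (ki : increasing k)
    (ki' : increasing k') :
    cond J h z k b * cond J h z k' b <= cond J h z (fun s => k s * k' s) b.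
  apply: (IH _ _ _ _ (S :\ z)%SET) => //.
  - exact: inner_sym.
  - exact: inner_ge0.
  - exact: supported_mix.
  - exact: supported_mix.
  - exact: increasing_mix.
  - exact: increasing_mix.
have mono k (kS : supported k S) (ki : increasing k) :
    cond J h z k false <= cond J h z k true.
  apply: (@le_trans _ _ (Ex (inner J T) (bfield J h T [ffun=> false])
     (fun s => k (mix T [ffun=> true] s)))).
    apply: ler_Ex => s; apply: ki; apply: le_conf_mix => u; rewrite ?ffunE//.
    exact: implybb.
  rewrite [leRHS](Ex_field _ (bfield J h T [ffun=> false])).
  set X := fun s => expR _.
  rewrite ler_pdivlMr; last by apply: Ex_gt0 => s; exact: expR_gt0.
  rewrite (Ex_mulC _ _ X).
  have dE u : bfield J h T [ffun=> true] u - bfield J h T [ffun=> false] u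
      = if u == z then 0 else 2 * J u z.
    rewrite !bfield_others; case: eqP => _; first by rewrite subrr.
    by rewrite /spin; ring.
  apply: (IH _ _ _ _ (S :\ z)%SET) => //.
  - exact: inner_sym.
  - exact: inner_ge0.
  - exact: supported_mix.
  - move=> s t st; rewrite /X; congr expR; apply: eq_bigr => u _.
    rewrite dE; case: ifPn => [|uz]; first by rewrite !mul0r.
    (* Vertices outside S are not coupled to z, so the tilt involves only S minus z. *)
    have [uS|uS] := boolP (u \in S); last by rewrite JS// mulr0 !mul0r.
    by rewrite st// !inE uz.
  - exact: increasing_mix.
  - move=> s t st; rewrite /X ler_expR; apply: increasing_field => // u.
    by rewrite dE; case: ifP => // _; rewrite mulr_ge0.
rewrite (Ex_cond h z f sJ) (Ex_cond h z g sJ) (Ex_cond h z (fun s => f s * g s) sJ).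
(* Law of total covariance: the two conditional means both increase with the spin at z, and the
   conditional covariances are nonnegative by induction. *)
apply: (@le_trans _ _ (Ex J h (fun t =>
    (if t z then cond J h z f true else cond J h z f false) *
    (if t z then cond J h z g true else cond J h z g false)))).
  rewrite -subr_ge0 (cov_two_valued J h (fun t => t z)).
  have /andP[p0 p1] := prob01 J h (fun t => t z).
  by do 2!apply: mulr_ge0; rewrite ?subr_ge0//; exact: mono.
by apply: ler_Ex => t; case: (t z); exact: IHc.
Qed.

(** Raising the field multiplies the weight by an increasing function, so this is FKG for f and that
    factor. *)
Lemma ler_Ex_field J h h' f : (forall u v, J u v = J v u) -> (forall u v, 0 <= J u v) ->
  increasing f -> (forall u, h u <= h' u) -> Ex J h f <= Ex J h' f.
Proof.
move=> sJ J0 fi hh'; rewrite (Ex_field _ h h').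
rewrite ler_pdivlMr; last by apply: Ex_gt0 => s; exact: expR_gt0.
rewrite Ex_mulC.
apply: (@fkg _ _ _ _ [set: V]%SET) => //; first by move=> u v; rewrite inE.
- by move=> s t st; congr f; apply/ffunP => u; rewrite st ?inE.
- by move=> s t st; congr expR; apply: eq_bigr => u _; rewrite st ?inE.
- move=> s t st; rewrite ler_expR; apply: increasing_field => // u.
  by rewrite subr_ge0.
Qed.

End Ising.

(** * The boundary influence inequality *)

Section BoundaryInfluence.
Variable R : realType.

(** The witness p' turns the first inequality into an equality; the second then amounts to (1 + q)
    q' (q' - q) (p - 1)^2 >= 0. *)
Lemma influence_rescale (q q' p : R) : 1 <= q -> q <= q' -> 1 <= p ->
  exists p' : R, [/\ 0 < p', (1 + q) / (1 + p' * q) <= (1 + q') / (1 + p * q') &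
    (1 + q) / (1 + q / p') <= (1 + q') / (1 + q' / p)].
Proof.
move=> q1 qq' p1.
have q0 : 0 < q by lra.
have q'0 : 0 < q' by lra.
have p0 : 0 < p by lra.
have [n nE] : exists n, n = q - q' + p * q' * (1 + q) by eexists.
have n0 : 0 < n.
  have : 0 <= (p - 1) * (q' * (1 + q)) by apply: mulr_ge0; [lra|apply: mulr_ge0; lra].
  by have := mulr_gt0 q0 q'0; rewrite nE; nra.
have [qn q'n pn nn] : [/\ 1 + q != 0, 1 + q' != 0, p != 0 & n != 0].
  by split; apply: lt0r_neq0; lra.
have qq : q != 0 by apply: lt0r_neq0.
have d1 : 0 < n + q ^+ 2 * (1 + q') by rewrite addr_gt0// mulr_gt0 ?exprn_gt0//; lra.
have d2 : 0 < 1 + p * q' by have := mulr_gt0 p0 q'0; lra.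
have d3 : 0 < p + q' by lra.
exists (n / (q * (1 + q'))); split.
- by rewrite divr_gt0// mulr_gt0//; lra.
- have -> : 1 + n / (q * (1 + q')) * q = (1 + q) * (1 + p * q') / (1 + q').
    by rewrite nE; field; rewrite ?qn ?q'n ?pn ?nn ?qq ?(lt0r_neq0 d2) ?(lt0r_neq0 d3).
  rewrite le_eqVlt; apply/orP; left; apply/eqP; field.
  by rewrite ?qn ?q'n ?pn ?nn ?qq ?(lt0r_neq0 d2) ?(lt0r_neq0 d3).
have -> : (1 + q) / (1 + q / (n / (q * (1 + q')))) = (1 + q) * n / (n + q ^+ 2 * (1 + q')).
  rewrite invf_div mulrA; field; rewrite ?qn ?q'n ?pn ?nn ?qq ?(lt0r_neq0 d2) ?(lt0r_neq0 d3).
  by rewrite /= lt0r_neq0//; move: d1; lra.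
have -> : (1 + q') / (1 + q' / p) = (1 + q') * p / (p + q').
  by field; rewrite ?qn ?q'n ?pn ?nn ?qq ?(lt0r_neq0 d2) ?(lt0r_neq0 d3).
rewrite ler_pdivrMr//.
rewrite mulrAC ler_pdivlMr//.
rewrite -subr_ge0.
have -> : (1 + q') * p * (n + q ^+ 2 * (1 + q')) - (1 + q) * n * (p + q')
   = (1 + q) * q' * (q' - q) * (p - 1) ^+ 2 by rewrite nE; ring.
by rewrite !mulr_ge0 ?sqr_ge0//; lra.
Qed.

(* The left-hand side is, up to constants, the zero field influence minus the
   influence in the field p, when the boundary acts on one vertex with strength
   ln x / 2.  After multiplication by 1 + a x, both fractions with numerators
   b1 and b2 increase along with x for a suitable change of p, whereas
   (1 + a x) / (1 + a0 x) decreases. *)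
Lemma influence_strength (E b1 b2 b0 a a0 x p : R) :
  0 <= E -> 0 <= b1 -> 0 <= b2 -> 0 <= b0 -> 1 <= a -> a <= a0 -> 1 <= x -> 0 < p ->
  (forall p', 0 < p' -> b0 / (1 + a0) <= E + b1 / (1 + p' * a) + b2 / (1 + a / p')) ->
  b0 / (1 + a0 * x) <= E + b1 / (1 + p * (a * x)) + b2 / (1 + a * x / p).
Proof.
move=> E0 b10 b20 b00 a1 aa0 x1.
(* Replacing p by its inverse exchanges the roles of b1 and b2. *)
wlog p1 : p b1 b2 b10 b20 / 1 <= p.
  move=> H p0 hyp; have [p1|p1] := leP 1 p; first exact: H.
  have := H p^-1 b2 b1 b20 b10; rewrite invf_ge1// invrK => /(_ (ltW p1)).
  rewrite invr_gt0 => /(_ p0); rewrite addrAC mulrC [p^-1 * _]mulrC [a * x * p]mulrC.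
  rewrite [b0 * _]mulrC; apply => p' p'0.
  rewrite addrAC mulrC; have := hyp p'^-1; rewrite invr_gt0 invrK mulrC => /(_ p'0).
  by rewrite [a / p']mulrC [p' * a]mulrC.
move=> p0 hyp.
have ax : a <= a * x by rewrite ler_peMr//; lra.
have [p' [p'0 r1 r2]] := influence_rescale a1 ax p1.
have qx : 0 < 1 + a * x by lra.
rewrite -(ler_pM2l qx).
have -> : (1 + a * x) * (E + b1 / (1 + p * (a * x)) + b2 / (1 + a * x / p))
  = (1 + a * x) * E + b1 * ((1 + a * x) / (1 + p * (a * x)))
    + b2 * ((1 + a * x) / (1 + a * x / p)) by ring.
have h1 := ler_wpM2l b10 r1; have h2 := ler_wpM2l b20 r2.
have qa : 0 <= 1 + a by lra.
have := ler_wpM2l qa (hyp _ p'0).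
have -> : (1 + a) * (E + b1 / (1 + p' * a) + b2 / (1 + a / p'))
  = (1 + a) * E + b1 * ((1 + a) / (1 + p' * a)) + b2 * ((1 + a) / (1 + a / p')) by ring.
have h3 : (1 + a) * E <= (1 + a * x) * E by apply: ler_wpM2r; lra.
suff : (1 + a * x) * (b0 / (1 + a0 * x)) <= (1 + a) * (b0 / (1 + a0)) by lra.
rewrite !mulrA ler_pdivrMr; last by have : a0 <= a0 * x; [rewrite ler_peMr//; lra|lra].
rewrite mulrAC ler_pdivlMr; last lra.
rewrite -subr_ge0.
have -> : (1 + a) * b0 * (1 + a0 * x) - (1 + a * x) * b0 * (1 + a0)
  = b0 * ((a0 - a) * (x - 1)) by ring.
by rewrite !mulr_ge0//; lra.
Qed.

Variable V : finType.
Implicit Types (J : V -> V -> R) (h k : V -> R) (S : {set V}).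

Definition mag J h u : R := Ex J h (fun s => spin R (s u)).

Definition flip (s : spins V) : spins V := [ffun u => ~~ s u].

Lemma flipK : involutive flip.
Proof. by move=> s; apply/ffunP => u; rewrite !ffunE negbK. Qed.

Lemma spinN b : spin R (~~ b) = - spin R b.
Proof. by case: b; rewrite /= ?opprK. Qed.

Lemma weight_flip J h s : weight J (fun u => - h u) (flip s) = weight J h s.
Proof.
rewrite /weight; suff -> : energy J (fun u => - h u) (flip s) = energy J h s by [].
rewrite /energy; congr (_ * _ + _).
  by apply: eq_bigr => u _; apply: eq_bigr => v _; rewrite !ffunE !spinN mulrNN.
by apply: eq_bigr => u _; rewrite ffunE spinN mulrNN.
Qed.

Lemma Ex_flip J h f : Ex J (fun u => - h u) f = Ex J h (fun s => f (flip s)).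
Proof.
rewrite /Ex; congr (_ / _); rewrite ?/Zsum (reindex_inj (inv_inj flipK))/=;
by apply: eq_bigr => s _; rewrite weight_flip.
Qed.

Lemma magN J h u : mag J (fun v => - h v) u = - mag J h u.
Proof.
by rewrite /mag Ex_flip -ExN; congr Ex; apply/funext => s; rewrite ffunE spinN.
Qed.

Lemma mag0 J u : mag J (fun=> 0) u = 0.
Proof.
have := magN J (fun=> 0) u; rewrite (_ : (fun _ : V => - 0) = fun=> 0).
  by move=> H; lra.
by apply/funext => v; rewrite oppr0.
Qed.

Definition plus_prob J h z : R := Ex J h (fun s => (s z)%:R).

Lemma plus_prob_gt0 J h z : 0 < plus_prob J h z < 1.
Proof.
rewrite /plus_prob /Ex; apply/andP; split.
  rewrite divr_gt0 ?Zsum_gt0// (bigD1 [ffun=> true])//= ffunE mulr1.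
  rewrite ltr_pwDl ?weight_gt0//; apply: sumr_ge0 => s _.
  by rewrite mulr_ge0// ltW// weight_gt0.
rewrite ltr_pdivrMr ?Zsum_gt0// mul1r /Zsum.
rewrite (bigD1 [ffun=> false])//= ffunE mulr0 add0r [ltRHS](bigD1 [ffun=> false])//=.
rewrite ltr_pwDl ?weight_gt0//; apply: ler_sum => s _.
by rewrite ler_piMr ?lern1 ?leq_b1// ltW// weight_gt0.
Qed.

(** The field at z acts on the odds by multiplication and does not affect the conditional means
    given the spin at z, so a mean spin is a fractional linear function of exp (2 h z). *)
Definition odds J h z : R := plus_prob J h z / (1 - plus_prob J h z).

Lemma odds_gt0 J h z : 0 < odds J h z.
Proof. by have /andP[p0 p1] := plus_prob_gt0 J h z; rewrite divr_gt0// subr_gt0. Qed.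

Lemma Ex_two_valued J h z (a b : R) :
  Ex J h (fun t => if t z then a else b) = b + (a - b) * plus_prob J h z.
Proof.
rewrite -ExZ -{2}(Ex_cst J h b) -ExD; congr Ex; apply/funext => s.
by case: (s z); rewrite ?mulr1 ?mulr0 ?addr0 ?subrKC.
Qed.

Lemma Ex_odds J h z (a b : R) :
  Ex J h (fun t => if t z then a else b) = a - (a - b) / (1 + odds J h z).
Proof.
rewrite Ex_two_valued.
have /andP[p0 p1] := plus_prob_gt0 J h z.
by rewrite /odds; field; apply/andP; split; apply: lt0r_neq0; lra.
Qed.

Lemma odds_shift J h h' z : (forall u, u != z -> h' u = h u) ->
  odds J h' z = expR (2 * (h' z - h z)) * odds J h z.
Proof.
move=> hh'; pose d := h' z - h z.
have XE s : \sum_u (h' u - h u) * spin R (s u) = d * spin R (s z).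
  by rewrite (bigD1 z)//= big1 ?addr0// => u uz; rewrite hh'// subrr mul0r.
have -> : expR (2 * (h' z - h z)) = expR d / expR (- d).
  by rewrite -expRB; congr expR; rewrite /d; ring.
have [e1 e2] := (expR_gt0 d, expR_gt0 (- d)).
have /andP[p0 p1] := plus_prob_gt0 J h z.
have P'E : plus_prob J h' z = expR d * plus_prob J h z
    / (expR (- d) + (expR d - expR (- d)) * plus_prob J h z).
  rewrite /plus_prob (Ex_field _ h h'); congr (_ / _).
    rewrite -ExZ; congr Ex; apply/funext => s; rewrite XE.
    by case: (s z); rewrite ?mulr1// !mulr0.
  rewrite -/(plus_prob J h z) -Ex_two_valued; congr Ex; apply/funext => s.
  by rewrite XE; case: (s z); rewrite ?mulr1// mulrN1.
have dpos : 0 < expR (- d) + (expR d - expR (- d)) * plus_prob J h z.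
  have -> : expR (- d) + (expR d - expR (- d)) * plus_prob J h z
    = expR (- d) * (1 - plus_prob J h z) + expR d * plus_prob J h z by ring.
  by rewrite addr_gt0// mulr_gt0// subr_gt0.
have : 1 - plus_prob J h' z = expR (- d) * (1 - plus_prob J h z)
    / (expR (- d) + (expR d - expR (- d)) * plus_prob J h z).
  by rewrite P'E; field; exact: lt0r_neq0.
rewrite /odds => ->; rewrite P'E; field.
by rewrite !lt0r_neq0// subr_gt0.
Qed.

Lemma odds_le J h h' z : (forall u v, J u v = J v u) -> (forall u v, 0 <= J u v) ->
  (forall u, h u <= h' u) -> odds J h z <= odds J h' z.
Proof.
move=> sJ J0 hh'.
have /andP[p0 p1] := plus_prob_gt0 J h z; have /andP[p0' p1'] := plus_prob_gt0 J h' z.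
have pp' : plus_prob J h z <= plus_prob J h' z.
  apply: ler_Ex_field => // s t st; have := st z.
  by case: (s z) => //= ->.
rewrite /odds ler_pdivrMr ?subr_gt0// mulrAC ler_pdivlMr ?subr_gt0//; nra.
Qed.

Lemma cond_shift J h h' z f b : (forall u, u != z -> h' u = h u) ->
  cond J h' z f b = cond J h z f b.
Proof.
move=> hh'; rewrite /cond.
suff -> : bfield J h' (others z) [ffun=> b] = bfield J h (others z) [ffun=> b] by [].
apply/funext => u; rewrite !bfield_others.
by case: eqVneq => // uz; rewrite hh'.
Qed.

(** Fixing the spin at z removes z and turns its couplings into a boundary field, as if z were glued
    to the boundary. *)
Lemma cond_mag J h z u b :
  cond J h z (fun s => spin R (s u)) b =
  if u == z then spin R b else
  mag (inner J (others z)) (fun v => if v == z then 0 else h v + spin R b * J v z) u.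
Proof.
rewrite /cond; case: eqVneq => [->|uz].
  rewrite -[RHS](Ex_cst (inner J (others z)) (bfield J h (others z) [ffun=> b])).
  by congr Ex; apply/funext => s; rewrite mix_out ?in_others ?eqxx// ffunE.
rewrite /mag (_ : bfield _ _ _ _ = fun v => if v == z then 0 else h v + spin R b * J v z).
  by congr Ex; apply/funext => s; rewrite mix_in// in_others.
by apply/funext => v; rewrite bfield_others.
Qed.

Lemma mag_cond J h z u : (forall u v, J u v = J v u) ->
  mag J h u = cond J h z (fun s => spin R (s u)) true
    - (cond J h z (fun s => spin R (s u)) true - cond J h z (fun s => spin R (s u)) false)
      / (1 + odds J h z).
Proof. by move=> sJ; rewrite /mag (Ex_cond h z _ sJ) Ex_odds. Qed.

Lemma le_cond_mag J h z u : (forall u v, J u v = J v u) -> (forall u v, 0 <= J u v) ->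
  cond J h z (fun s => spin R (s u)) false <= cond J h z (fun s => spin R (s u)) true.
Proof.
move=> sJ J0; rewrite !cond_mag; case: eqVneq => _ /=; first lra.
apply: ler_Ex_field.
- exact: inner_sym.
- exact: inner_ge0.
- by move=> s t st; exact: ler_spin.
- by move=> v; case: eqP => // _; rewrite mul1r mulN1r; have := J0 v z; lra.
Qed.

(* The influence of a nonnegative boundary field h on a spin is largest in the
   absence of an external field k (Ding, Song and Sun).  By induction, h z is
   varied for one vertex z: at h z = 0 there are fewer boundary vertices, while
   h z = +oo glues z to the boundary, and influence_strength interpolates. *)
Theorem boundary_influence J h k u S :
  (forall u v, J u v = J v u) -> (forall u v, 0 <= J u v) -> (forall u, 0 <= h u) ->
  (forall u v, u \notin S -> J u v = 0) -> (forall u, u \notin S -> h u = 0) ->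
  mag J (fun v => k v + h v) u - mag J (fun v => k v - h v) u <= 2 * mag J h u.
Proof.
move: {2}#|S| (leqnn #|S|) => n.
elim: n => [|n IHn] in J h k u S * => Sn sJ J0 h0 JS hS.
  have -> : h = fun=> 0.
    apply/funext => v; apply: hS; move: Sn; rewrite leqn0 cards_eq0 => /eqP ->.
    by rewrite inE.
  rewrite mag0 mulr0 (_ : (fun v => k v + 0) = (fun v => k v - 0)) ?subrr//.
  by apply/funext => v; rewrite addr0 subr0.
(* The inner induction is on the number of vertices on which the boundary acts. *)
move: {2}#|[set v | h v != 0]%SET| (leqnn #|[set v | h v != 0]%SET|) => m.
elim: m => [|m IHm] in h k u h0 hS * => hm.
  have -> : h = fun=> 0.
    apply/funext => v; move: hm; rewrite leqn0 cards_eq0 => /eqP /setP /(_ v).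
    by rewrite !inE => /negbFE /eqP.
  rewrite mag0 mulr0 (_ : (fun v => k v + 0) = (fun v => k v - 0)) ?subrr//.
  by apply/funext => v; rewrite addr0 subr0.
have [z|hz] := pickP (fun v => h v != 0); last first.
  apply: IHm => //; rewrite (_ : #|_| = 0%N)//; apply: eq_card0 => v.
  by rewrite inE hz.
move=> hz.
have zS : z \in S by apply: contraNT hz => /hS ->.
pose H t v := if v == z then t else h v.
pose K t v := if v == z then t else k v.
have HE : H (h z) = h by apply/funext => v; rewrite /H; case: eqP => // ->.
have KE : K (k z) = k by apply/funext => v; rewrite /K; case: eqP => // ->.
have H00 v : 0 <= H 0 v by rewrite /H; case: ifP.
have IH0 k' u' : mag J (fun v => k' v + H 0 v) u' - mag J (fun v => k' v - H 0 v) u'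
    <= 2 * mag J (H 0) u'.
  apply: IHm => //.
    by move=> v vS; rewrite /H hS// if_same.
  move: hm; rewrite (cardsD1 z) inE hz ltnS; apply: leq_trans.
  apply/subset_leq_card/fintype.subsetP => v; rewrite !inE /H.
  by case: (eqVneq v z); rewrite ?eqxx.
pose op := odds J (fun v => K 0 v + H 0 v) z.
pose om := odds J (fun v => K 0 v - H 0 v) z.
pose o0 := odds J (H 0) z.
pose yp u' := cond J (fun v => K 0 v + H 0 v) z (fun s => spin R (s u')).
pose ym u' := cond J (fun v => K 0 v - H 0 v) z (fun s => spin R (s u')).
pose y0 u' := cond J (H 0) z (fun s => spin R (s u')).
have [op0 om0 o00] : [/\ 0 < op, 0 < om & 0 < o0] by split; exact: odds_gt0.
(* The minus odds are inverted, so that both fractions decrease in the boundary strength t. *)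
have magE c t u' : mag J (fun v => K c v + H t v) u' - mag J (fun v => K c v - H t v) u'
    = yp u' true - ym u' false - (yp u' true - yp u' false) / (1 + expR (2 * (c + t)) * op)
      - (ym u' true - ym u' false) / (1 + expR (2 * (t - c)) / om).
  rewrite !(mag_cond _ z u' sJ).
  rewrite !(@cond_shift J (fun v => K 0 v + H 0 v) (fun v => K c v + H t v)); last 2 first.
  - by move=> v /negPf vz; rewrite /K /H vz.
  - by move=> v /negPf vz; rewrite /K /H vz.
  rewrite !(@cond_shift J (fun v => K 0 v - H 0 v) (fun v => K c v - H t v)); last 2 first.
  - by move=> v /negPf vz; rewrite /K /H vz.
  - by move=> v /negPf vz; rewrite /K /H vz.
  rewrite -/(yp u' _) -/(yp u' _) -/(ym u' _) -/(ym u' _).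
  rewrite (@odds_shift J (fun v => K 0 v + H 0 v) (fun v => K c v + H t v) z); last first.
    by move=> v /negPf vz; rewrite /K /H vz.
  rewrite (@odds_shift J (fun v => K 0 v - H 0 v) (fun v => K c v - H t v) z); last first.
    by move=> v /negPf vz; rewrite /K /H vz.
  rewrite -/op -/om /K /H eqxx addr0 !subr0.
  have -> : expR (2 * (c - t)) = (expR (2 * (t - c)))^-1.
    by rewrite -expRN; congr expR; ring.
  have := expR_gt0 (2 * (t - c)); set X := expR _ => X0.
  have -> : (ym u' true - ym u' false) / (1 + X^-1 * om)
     = (ym u' true - ym u' false) - (ym u' true - ym u' false) / (1 + X / om).
    have X1 : 0 < X + om by rewrite addr_gt0.
    by field; rewrite ?(lt0r_neq0 X0) ?(lt0r_neq0 om0) ?(lt0r_neq0 X1) ?[om + X]addrC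
       ?(lt0r_neq0 X1).
  by ring.
have mag0E t u' : mag J (H t) u' = y0 u' true
    - (y0 u' true - y0 u' false) / (1 + expR (2 * t) * o0).
  rewrite (mag_cond _ z u' sJ) !(@cond_shift J (H 0) (H t)); last 2 first.
  - by move=> v /negPf vz; rewrite /H vz.
  - by move=> v /negPf vz; rewrite /H vz.
  rewrite (@odds_shift J (H 0) (H t) z); last by move=> v /negPf vz; rewrite /H vz.
  by rewrite /H eqxx subr0.
(* With op = r a and om = r / a the external field only moves the geometric mean, through [p], while
   the boundary field at z only multiplies a. *)
pose a := Num.sqrt (op / om); pose r := Num.sqrt (op * om).
have aE : r * a = op.
  rewrite /r /a -sqrtrM; last exact: mulr_ge0 (ltW op0) (ltW om0).
  by rewrite mulrACA divff ?lt0r_neq0// mulr1 -expr2 sqrtr_sqr gtr0_norm.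
have a0 : 0 < a by rewrite sqrtr_gt0 divr_gt0.
have r0 : 0 < r by rewrite sqrtr_gt0 mulr_gt0.
have arE : a / r = om^-1.
  have -> : om = r / a.
    apply: (@mulIf _ op); first exact: lt0r_neq0.
    rewrite -{2}aE [om * op]mulrC -[LHS]sqr_sqrtr; last exact: mulr_ge0 (ltW op0) (ltW om0).
    by rewrite -/r; field; rewrite lt0r_neq0.
  by rewrite invf_div.
pose p c := expR (2 * c) * r.
have p0 c : 0 < p c by rewrite mulr_gt0 ?expR_gt0.
have E1 c t : expR (2 * (c + t)) * op = p c * (a * expR (2 * t)).
  by rewrite mulrDr expRD /p -aE; ring.
have E2 c t : expR (2 * (t - c)) / om = a * expR (2 * t) / p c.
  by rewrite mulrBr expRB /p -arE; field; rewrite !lt0r_neq0 ?expR_gt0.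
have surj q : 0 < q -> exists c, p c = q.
  move=> q0; exists (ln (q / r) / 2); rewrite /p [2 * _]mulrC divfK//.
  by rewrite lnK ?posrE ?divr_gt0// divfK ?lt0r_neq0.
have a1 : 1 <= a.
  rewrite -sqrtr1 ler_wsqrtr// ler_pdivlMr// mul1r.
  by apply: odds_le => // v; have := H00 v; lra.
(* The induction hypothesis at z itself, in the field for which p = 1, involves only a and o0. *)
have aa0 : a <= o0.
  have [c pc] := surj 1 ltr01.
  have := IH0 (K c) z; rewrite magE mag0E E1 E2 pc.
  rewrite /yp /ym /y0 !cond_mag eqxx /= mulr0 expR0 mulr1 mul1r divr1.
  have [ai1 oi1] : 0 < 1 + a /\ 0 < 1 + o0 by lra.
  rewrite mul1r => H1; rewrite leNgt; apply/negP => oa.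
  have : 2 / (1 + a) < 2 / (1 + o0) by rewrite ltr_pM2l// ltf_pV2 ?posrE// ltrD2l.
  move: H1; rewrite opprK (_ : 1 + 1 = 2 :> R)//; lra.
have x1 : 1 <= expR (2 * h z).
  by rewrite -expR0 ler_expR mulr_ge0.
suff : mag J (fun v => K (k z) v + H (h z) v) u - mag J (fun v => K (k z) v - H (h z) v) u
    <= 2 * mag J (H (h z)) u by rewrite HE KE.
rewrite magE mag0E E1 E2.
(* The inequality at h z = +oo: the couplings to z are added to h, and S has one vertex fewer. *)
have E0 : 0 <= 2 * y0 u true - (yp u true - ym u false).
  rewrite /y0 /yp /ym !cond_mag; case: eqVneq => [_|uz] /=; first lra.
  pose h' v := if v == z then 0 else h v + J v z.
  pose k' v := if v == z then 0 else k v.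
  have fE (F G : V -> R) : (forall v, v != z -> F v = G v) ->
      mag (inner J (others z)) (fun v => if v == z then 0 else F v) u
      = mag (inner J (others z)) (fun v => if v == z then 0 else G v) u.
    by move=> FG; congr mag; apply/funext => v; case: eqVneq => // /FG.
  have e1 : mag (inner J (others z)) h' u =
      mag (inner J (others z)) (fun v => if v == z then 0 else H 0 v + 1 * J v z) u.
    by apply: fE => v /negPf vz; rewrite /H vz mul1r.
  have e2 : mag (inner J (others z)) (fun v => k' v + h' v) u =
      mag (inner J (others z)) (fun v => if v == z then 0 else K 0 v + H 0 v + 1 * J v z) u.
    congr mag; apply/funext => v; rewrite /k' /h' /K /H.
    by case: eqVneq => _; rewrite ?addr0// mul1r addrA.
  have e3 : mag (inner J (others z)) (fun v => k' v - h' v) u =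
      mag (inner J (others z)) (fun v => if v == z then 0 else K 0 v - H 0 v + -1 * J v z) u.
    congr mag; apply/funext => v; rewrite /k' /h' /K /H.
    by case: eqVneq => _; rewrite ?subr0// mulN1r opprD addrA.
  rewrite -e1 -e2 -e3 subr_ge0; apply: (IHn _ _ _ _ (S :\ z)%SET).
  - by move: Sn; rewrite (cardsD1 z) zS.
  - exact: inner_sym.
  - exact: inner_ge0.
  - by move=> v; rewrite /h'; case: ifP => // _; rewrite addr_ge0.
  - move=> v w; rewrite !inE negb_and negbK /inner !in_others => /orP[/eqP ->|/JS ->].
      by rewrite eqxx.
    by rewrite if_same.
  - move=> v; rewrite !inE negb_and negbK /h' => /orP[->//|vS].
    by rewrite hS// JS// addr0 if_same.
have := @influence_strength (2 * y0 u true - (yp u true - ym u false))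
  (yp u true - yp u false) (ym u true - ym u false) (2 * (y0 u true - y0 u false))
  a o0 (expR (2 * h z)) (p (k z)) E0.
have yle F : 0 <= cond J F z (fun s => spin R (s u)) true
   - cond J F z (fun s => spin R (s u)) false by rewrite subr_ge0 le_cond_mag.
move=> /(_ (yle _) (yle _) (mulr_ge0 (ler0n _ 2) (yle _)) a1 aa0 x1 (p0 _)).
rewrite (mulrC o0) => interp.
(* The inequality at h z = 0, needed for all p' at once; since [p] is onto the positive reals, each
   p' is realized by some external field at z. *)
suff IHp p' : 0 < p' ->
    2 * (y0 u true - y0 u false) / (1 + o0) <= 2 * y0 u true - (yp u true - ym u false) +
    (yp u true - yp u false) / (1 + p' * a) + (ym u true - ym u false) / (1 + a / p').
  by have := interp IHp; lra.
move=> /surj[c <-].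
have := IH0 (K c) u; rewrite magE mag0E E1 E2 mulr0 expR0 mulr1 mul1r; lra.
Qed.

Corollary boundary_influenceT J h k u :
  (forall u v, J u v = J v u) -> (forall u v, 0 <= J u v) -> (forall u, 0 <= h u) ->
  mag J (fun v => k v + h v) u - mag J (fun v => k v - h v) u <= 2 * mag J h u.
Proof.
move=> sJ J0 h0; apply: (@boundary_influence _ _ _ _ [set: V]%SET) => // [v w|v];
by rewrite inE.
Qed.

End BoundaryInfluence.

(** * Griffiths' inequalities *)

Section Griffiths.
Variables (R : realType) (V : finType).
Implicit Types (s t : spins V) (A B : seq V).

(** Repetitions in A are allowed, so that products of monomials are concatenations. *)
Definition mon A s : R := \prod_(u <- A) spin R (s u).

Lemma mon_nil s : mon [::] s = 1. Proof. by rewrite /mon big_nil. Qed.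

Lemma mon2 u v s : mon [:: u; v] s = spin R (s u) * spin R (s v).
Proof. by rewrite /mon big_cons big_seq1. Qed.

Lemma mon_cat A B s : mon (A ++ B) s = mon A s * mon B s.
Proof. exact: big_cat. Qed.

Lemma mon_sign A s : mon A s = 1 \/ mon A s = -1.
Proof.
rewrite /mon; elim: A => [|u A IH]; first by left; rewrite big_nil.
rewrite big_cons; case: IH => ->; case: (s u) => /=; rewrite ?mulr1 ?mulrNN ?mulr1 ?mul1r;
by [left|right].
Qed.

(** The sum factors over the vertices into 1 + (-1)^m, where m is the multiplicity in A. *)
Lemma sum_mon_ge0 A : 0 <= \sum_s mon A s.
Proof.
have monE s : mon A s = \prod_u spin R (s u) ^+ count_mem u A.
  rewrite /mon; elim: A => [|v A IH]; first by rewrite big_nil big1.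
  rewrite big_cons IH; transitivity (\prod_u (spin R (s u) ^+ (v == u) *
      spin R (s u) ^+ count_mem u A)); last first.
    by apply: eq_bigr => u _; rewrite -exprD.
  rewrite big_split/=; congr (_ * _); rewrite (bigD1 v)//= eqxx expr1.
  by rewrite big1 ?mulr1// => u; rewrite eq_sym => /negPf ->.
under eq_bigr do rewrite monE.
rewrite -(bigA_distr_bigA (fun u (b : bool) => spin R b ^+ count_mem u A)).
apply: prodr_ge0 => u _; rewrite big_bool /= expr1n.
by rewrite -signr_odd; case: (odd _); rewrite ?expr1 ?expr0; lra.
Qed.

Definition twist s t : spins V := [ffun u => s u == t u].

Lemma twistK s : involutive (twist s).
Proof. by move=> t; apply/ffunP => u; rewrite !ffunE; case: (s u); case: (t u). Qed.

Lemma mon_twist A s t : mon A (twist s t) = mon A s * mon A t.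
Proof.
rewrite /mon -big_split/=; apply: eq_bigr => u _; rewrite ffunE.
by case: (s u); case: (t u); rewrite /= ?mulr1 ?mul1r ?mulrNN ?mulr1.
Qed.

Variables (I : finType) (c : I -> R) (l : I -> seq V).

Definition chm (x : R) : R := (expR x + expR (- x)) / 2.
Definition shm (x : R) : R := (expR x - expR (- x)) / 2.

Lemma chm_ge0 x : 0 <= chm x.
Proof. by rewrite /chm; have := expR_gt0 x; have := expR_gt0 (- x); lra. Qed.

Lemma shm_ge0 x : 0 <= x -> 0 <= shm x.
Proof.
move=> x0; have : expR (- x) <= expR x by rewrite ler_expR; lra.
by rewrite /shm; lra.
Qed.

(** A monomial squares to 1, hence its exponential is affine in it; products over bonds then expand
    into monomials with nonnegative coefficients. *)
Lemma expR_mon x A s : expR (x * mon A s) = chm x + shm x * mon A s.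
Proof.
by rewrite /chm /shm; case: (mon_sign A s) => ->; rewrite ?mulr1 ?mulrN1; lra.
Qed.

Definition hamiltonian (d : I -> R) s : R := \sum_i d i * mon (l i) s.

Lemma expR_hamiltonian d s :
  expR (hamiltonian d s) = \prod_i (chm (d i) + shm (d i) * mon (l i) s).
Proof. by rewrite expR_sum; apply: eq_bigr => i _; rewrite expR_mon. Qed.

Lemma gks1 d A : (forall i, 0 <= d i) -> 0 <= \sum_s mon A s * expR (hamiltonian d s).
Proof.
move=> d0; under eq_bigr do rewrite expR_hamiltonian.
elim: (index_enum I) A => [|i r IH] A.
  by under eq_bigr do rewrite big_nil mulr1; exact: sum_mon_ge0.
have -> : \sum_s mon A s * \prod_(j <- i :: r) (chm (d j) + shm (d j) * mon (l j) s)
  = chm (d i) * (\sum_s mon A s * \prod_(j <- r) (chm (d j) + shm (d j) * mon (l j) s))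
  + shm (d i) * (\sum_s mon (l i ++ A) s *
      \prod_(j <- r) (chm (d j) + shm (d j) * mon (l j) s)).
  rewrite !mulr_sumr -big_split/=; apply: eq_bigr => s _.
  by rewrite big_cons mon_cat; ring.
by rewrite addr_ge0// mulr_ge0 ?chm_ge0 ?shm_ge0.
Qed.

Hypothesis c0 : forall i, 0 <= c i.

(* Ginibre's duplication: substituting the product of s and t for the second
   copy, mon A s - mon A t factors as mon A s * (1 - mon A t). *)
Lemma gks2 A B :
  (\sum_s mon A s * expR (hamiltonian c s)) * (\sum_s mon B s * expR (hamiltonian c s))
  <= (\sum_s mon A s * mon B s * expR (hamiltonian c s)) * (\sum_s expR (hamiltonian c s)).
Proof.
set w := fun s => expR (hamiltonian c s).
have E : \sum_s \sum_t (mon A s - mon A t) * (mon B s - mon B t) * (w s * w t)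
   = 2 * ((\sum_s mon A s * mon B s * w s) * (\sum_s w s)
   - (\sum_s mon A s * w s) * (\sum_s mon B s * w s)).
  transitivity (\sum_s \sum_t ((mon A s * mon B s * w s) * w t
      - (mon A s * w s) * (mon B t * w t) + (w s * (mon A t * mon B t * w t)
      - (mon B s * w s) * (mon A t * w t)))).
    by apply: eq_bigr => s _; apply: eq_bigr => t _; ring.
  under eq_bigr do rewrite big_split !sumrB/= -!mulr_sumr.
  rewrite big_split !sumrB/= -!mulr_suml; ring.
rewrite -subr_ge0 -(pmulr_rge0 _ (ltr0n _ 2)) -E.
under eq_bigr => s _ do rewrite (reindex_inj (inv_inj (@twistK s)))/=.
rewrite exchange_big/=; apply: sumr_ge0 => t _.
have -> : \sum_s (mon A s - mon A (twist s t)) * (mon B s - mon B (twist s t)) *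
    (w s * w (twist s t))
  = (1 - mon A t) * (1 - mon B t) *
    \sum_s mon (A ++ B) s * expR (hamiltonian (fun i => c i * (1 + mon (l i) t)) s).
  rewrite mulr_sumr; apply: eq_bigr => s _; rewrite !mon_twist mon_cat /w -expRD.
  have -> : hamiltonian c s + hamiltonian c (twist s t)
      = hamiltonian (fun i => c i * (1 + mon (l i) t)) s.
    by rewrite /hamiltonian -big_split; apply: eq_bigr => i _ /=; rewrite mon_twist; ring.
  ring.
apply: mulr_ge0.
  by case: (mon_sign A t) => ->; case: (mon_sign B t) => ->; lra.
by apply: gks1 => i; rewrite mulr_ge0//; case: (mon_sign (l i) t) => ->; lra.
Qed.

(** Added couplings tilt the measure by a nonnegative combination of monomials, each of which is
    positively correlated with [mon A] by [gks2]. *)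
Lemma gks_mono A (d : I -> R) : (forall i, 0 <= d i) ->
  (\sum_s mon A s * expR (hamiltonian c s)) / (\sum_s expR (hamiltonian c s)) <=
  (\sum_s mon A s * expR (hamiltonian (fun i => c i + d i) s))
   / (\sum_s expR (hamiltonian (fun i => c i + d i) s)).
Proof.
move=> d0; set w := fun s => expR (hamiltonian c s).
have pos e : 0 < \sum_s expR (hamiltonian e s).
  rewrite (bigD1 [ffun=> true])//= ltr_pwDl ?expR_gt0//.
  by apply: sumr_ge0 => s _; exact: expR_ge0.
rewrite ler_pdivlMr// mulrAC ler_pdivrMr//.
have E s : expR (hamiltonian (fun i => c i + d i) s) = w s *
    \prod_i (chm (d i) + shm (d i) * mon (l i) s).
  rewrite -expR_hamiltonian -expRD; congr expR; rewrite /hamiltonian -big_split.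
  by apply: eq_bigr => i _; rewrite mulrDl.
under [X in _ * X <= _]eq_bigr do rewrite E.
under [X in _ <= X * _]eq_bigr do rewrite E.
have : (\sum_s mon A s * w s) * (\sum_s mon [::] s * (w s *
    \prod_i (chm (d i) + shm (d i) * mon (l i) s))) <=
  (\sum_s mon A s * mon [::] s * (w s * \prod_i (chm (d i) + shm (d i) * mon (l i) s)))
  * (\sum_s w s).
  (* The empty monomial is generalized to B, which collects the factors chosen in the expansion. *)
  elim: (index_enum I) [::] => [|i r IH] B.
    under [X in _ * X <= _]eq_bigr do rewrite big_nil mulr1.
    under [X in _ <= X * _]eq_bigr do rewrite big_nil mulr1.
    exact: gks2.
  have -> : \sum_s mon B s * (w s * \prod_(j <- i :: r) (chm (d j) + shm (d j) * mon (l j) s))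
    = chm (d i) * (\sum_s mon B s *
        (w s * \prod_(j <- r) (chm (d j) + shm (d j) * mon (l j) s)))
    + shm (d i) * (\sum_s mon (l i ++ B) s *
        (w s * \prod_(j <- r) (chm (d j) + shm (d j) * mon (l j) s))).
    rewrite !mulr_sumr -big_split/=; apply: eq_bigr => s _.
    by rewrite big_cons mon_cat; ring.
  have -> : \sum_s mon A s * mon B s *
       (w s * \prod_(j <- i :: r) (chm (d j) + shm (d j) * mon (l j) s))
    = chm (d i) * (\sum_s mon A s * mon B s *
        (w s * \prod_(j <- r) (chm (d j) + shm (d j) * mon (l j) s)))
    + shm (d i) * (\sum_s mon A s * mon (l i ++ B) s *
        (w s * \prod_(j <- r) (chm (d j) + shm (d j) * mon (l j) s))).
    rewrite !mulr_sumr -big_split/=; apply: eq_bigr => s _.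
    by rewrite big_cons mon_cat; ring.
  rewrite mulrDr mulrDl lerD//.
    by rewrite mulrCA -mulrA ler_wpM2l ?chm_ge0.
  by rewrite mulrCA -[leRHS]mulrA ler_wpM2l ?shm_ge0.
have e1 (F : spins V -> R) : \sum_s mon [::] s * F s = \sum_s F s.
  by apply: eq_bigr => s _; rewrite mon_nil mul1r.
have e2 (F : spins V -> R) : \sum_s mon A s * mon [::] s * F s = \sum_s mon A s * F s.
  by apply: eq_bigr => s _; rewrite mon_nil mulr1.
by rewrite e1 e2.
Qed.

End Griffiths.

(** * Zero field correlations and the linear bound on the magnetization *)

Section Correlations.
Variables (R : realType) (V : finType).
Implicit Types (J : V -> V -> R) (h : V -> R).

Definition corr J u v : R := Ex J (fun=> 0) (fun s => spin R (s u) * spin R (s v)).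

Lemma energy0_hamiltonian J (s : spins V) : energy J (fun=> 0) s =
  hamiltonian (fun p : V * V => [:: p.1; p.2]) (fun p => 2^-1 * J p.1 p.2) s.
Proof.
rewrite /energy [X in _ + X]big1 ?addr0; last by move=> u _; rewrite mul0r.
rewrite pair_big mulr_sumr; apply: eq_bigr => p _ /=.
by rewrite mon2 -mulrA.
Qed.

Lemma corrE J u v : corr J u v =
  (\sum_s mon R [:: u; v] s *
    expR (hamiltonian (fun p : V * V => [:: p.1; p.2]) (fun p => 2^-1 * J p.1 p.2) s))
  / \sum_s expR (hamiltonian (fun p : V * V => [:: p.1; p.2]) (fun p => 2^-1 * J p.1 p.2) s).
Proof.
rewrite /corr /Ex /Zsum /weight; congr (_ / _); apply: eq_bigr => s _.
  by rewrite energy0_hamiltonian mon2 mulrC.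
by rewrite energy0_hamiltonian.
Qed.

Lemma corr_ge0 J u v : (forall u v, 0 <= J u v) -> 0 <= corr J u v.
Proof.
move=> J0; rewrite corrE divr_ge0//.
  by apply: gks1 => p; rewrite mulr_ge0// invr_ge0.
by apply: sumr_ge0 => s _; exact: expR_ge0.
Qed.

Lemma ler_corr J J' u v : (forall u v, 0 <= J u v) -> (forall u v, J u v <= J' u v) ->
  corr J u v <= corr J' u v.
Proof.
move=> J0 JJ'; rewrite !corrE.
rewrite (_ : (fun p : V * V => 2^-1 * J' p.1 p.2)
  = fun p : V * V => 2^-1 * J p.1 p.2 + 2^-1 * (J' p.1 p.2 - J p.1 p.2)); last first.
  by apply/funext => p; rewrite -mulrDr subrKC.
by apply: gks_mono => p; rewrite mulr_ge0 ?invr_ge0// subr_ge0.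
Qed.

Lemma mag_ge0 J h u : (forall u v, J u v = J v u) -> (forall u v, 0 <= J u v) ->
  (forall u, 0 <= h u) -> 0 <= mag J h u.
Proof.
move=> sJ J0 h0; rewrite -(mag0 J u); apply: ler_Ex_field => //.
by move=> s t st; exact: ler_spin.
Qed.

Lemma expR_quadratic (x : R) : x <= 2^-1 -> expR x <= 1 + x + 2 * x ^+ 2.
Proof.
move=> x2; have : 1 - x <= expR (- x) := expR_ge1Dx (- x).
rewrite expRN => H; rewrite -[leLHS]invrK.
have y0 : 0 < (expR x)^-1 by rewrite invr_gt0 expR_gt0.
rewrite -[leLHS]mul1r ler_pdivrMr//.
have p0 : 0 <= 1 + x + 2 * x ^+ 2 by have := sqr_ge0 (x + 4^-1); nra.
apply: (@le_trans _ _ ((1 + x + 2 * x ^+ 2) * (1 - x))); last exact: ler_wpM2l.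
have -> : (1 + x + 2 * x ^+ 2) * (1 - x) = 1 + x ^+ 2 * (1 - 2 * x) by ring.
by rewrite lerDl mulr_ge0 ?sqr_ge0//; lra.
Qed.

Lemma mag_quadratic J h u : (forall u v, J u v = J v u) -> (forall u v, 0 <= J u v) ->
  (forall u, 0 <= h u) -> \sum_v h v <= 2^-1 ->
  mag J h u <= \sum_v h v * corr J u v + 2 * (\sum_v h v) ^+ 2.
Proof.
move=> sJ J0 h0; set M := \sum_v h v => M2.
pose X (s : spins V) := \sum_v h v * spin R (s v).
have XM s : - M <= X s <= M.
  rewrite -ler_norml; apply: le_trans (ler_norm_sum _ _ _) _.
  by apply: ler_sum => v _; rewrite normrM ger0_norm// ler_piMr//; case: (s v);
    rewrite /= ?normrN normr1.
have X0 : Ex J (fun=> 0) X = 0.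
  by rewrite Ex_sum big1// => v _; rewrite ExZ -/(mag _ _ _) mag0 mulr0.
have magE : mag J h u = Ex J (fun=> 0) (fun s => expR (X s) * spin R (s u))
    / Ex J (fun=> 0) (fun s => expR (X s)).
  rewrite /mag (Ex_field J (fun=> 0) h).
  have XE (s : spins V) : \sum_v (h v - 0) * spin R (s v) = X s.
    by apply: eq_bigr => v _; rewrite subr0.
  by congr (_ / _); congr Ex; apply/funext => s; rewrite XE.
have den : 1 <= Ex J (fun=> 0) (fun s => expR (X s)).
  have : Ex J (fun=> 0) (fun s => 1 + X s) <= Ex J (fun=> 0) (fun s => expR (X s)).
    by apply: ler_Ex => s; exact: expR_ge1Dx.
  by rewrite ExD Ex_cst X0 addr0.
have num : Ex J (fun=> 0) (fun s => expR (X s) * spin R (s u)) <=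
    \sum_v h v * corr J u v + 2 * M ^+ 2.
  have -> : \sum_v h v * corr J u v = Ex J (fun=> 0) (fun s => (1 + X s) * spin R (s u)).
    transitivity (Ex J (fun=> 0) (fun s => spin R (s u)
        + \sum_v h v * (spin R (s u) * spin R (s v)))).
      rewrite ExD -/(mag _ _ _) mag0 add0r Ex_sum.
      by apply: eq_bigr => v _; rewrite ExZ.
    congr Ex; apply/funext => s; rewrite mulrDl mul1r /X mulr_suml; congr (_ + _).
    by apply: eq_bigr => v _; ring.
  rewrite -(Ex_cst J (fun=> 0) (2 * M ^+ 2)) -ExD; apply: ler_Ex => s.
  have /andP[X1 X2] := XM s.
  have e1 : 1 + X s <= expR (X s) := expR_ge1Dx (X s).
  have e2 : expR (X s) <= 1 + X s + 2 * X s ^+ 2 by apply: expR_quadratic; lra.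
  have e3 : X s ^+ 2 <= M ^+ 2.
    by rewrite -[leLHS]real_normK ?num_real// lerXn2r ?nnegrE// ?(le_trans _ M2)// ?ler_norml
       ?X1 ?X2//; lra.
  by case: (s u) => /=; lra.
have := mag_ge0 u sJ J0 h0; rewrite magE => mg.
apply: le_trans num; rewrite ler_pdivrMr; last lra.
rewrite ler_peMr//; move: mg; rewrite pmulr_lge0// invr_gt0; lra.
Qed.

(** The boundary influence inequality with external field h: the total fields are then 2 h and 0. *)
Lemma mag_double J h u : (forall u v, J u v = J v u) -> (forall u v, 0 <= J u v) ->
  (forall u, 0 <= h u) -> mag J (fun v => 2 * h v) u <= 2 * mag J h u.
Proof.
move=> sJ J0 h0.
have := boundary_influenceT h u sJ J0 h0.
rewrite (_ : (fun v => h v - h v) = fun=> 0); last by apply/funext => v; rewrite subrr.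
rewrite mag0 subr0 (_ : (fun v => h v + h v) = fun v => 2 * h v); last first.
  by apply/funext => v; ring.
by [].
Qed.

(** After n halvings of the field the quadratic error is 2^n * 2 (M / 2^n)^2, which vanishes as n
    grows. *)
Lemma mag_le_corr J h u : (forall u v, J u v = J v u) -> (forall u v, 0 <= J u v) ->
  (forall u, 0 <= h u) -> mag J h u <= \sum_v h v * corr J u v.
Proof.
move=> sJ J0 h0; set M := \sum_v h v.
have M0 : 0 <= M by apply: sumr_ge0.
have iter n : mag J h u <= 2 ^+ n * mag J (fun v => 2^-1 ^+ n * h v) u.
  elim: n => [|n IH].
    rewrite expr0 mul1r; suff -> : (fun v => 2^-1 ^+ 0 * h v) = h by [].
    by apply/funext => v; rewrite expr0 mul1r.
  apply: le_trans IH _; rewrite exprSr -mulrA ler_wpM2l ?exprn_ge0//.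
  have -> : (fun v => 2^-1 ^+ n * h v) = (fun v => 2 * (2^-1 ^+ n.+1 * h v)).
    by apply/funext => v; rewrite exprS; field.
  by apply: mag_double => // v; rewrite mulr_ge0// exprn_ge0// invr_ge0.
apply/ler_addgt0Pr => e e0.
(* The first term makes the halved field small enough for [mag_quadratic], the second brings the
   error below e. *)
have [n nM] : exists n : nat, 2 * M + 2 * M ^+ 2 / e <= 2 ^+ n.
  exists (Num.bound (2 * M + 2 * M ^+ 2 / e)); apply: ltW.
  apply: lt_trans (archi_boundP _) _.
    by rewrite addr_ge0 ?mulr_ge0 ?sqr_ge0 ?invr_ge0 ?(ltW e0).
  by rewrite -natrX ltr_nat ltn_expl.
have q0 : 0 < 2 ^+ n :> R by rewrite exprn_gt0.
have qM : 2 * M <= 2 ^+ n.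
  by apply: le_trans nM; rewrite lerDl ?mulr_ge0 ?sqr_ge0 ?invr_ge0 ?(ltW e0).
have qe : 2 * M ^+ 2 <= 2 ^+ n * e.
  by rewrite -ler_pdivrMr//; apply: le_trans nM; rewrite lerDr mulr_ge0.
apply: le_trans (iter n) _.
have := @mag_quadratic J (fun v => 2^-1 ^+ n * h v) u sJ J0.
rewrite -mulr_sumr -/M exprVn => H.
have {}H : mag J (fun v => (2 ^+ n)^-1 * h v) u <=
   \sum_v (2 ^+ n)^-1 * h v * corr J u v + 2 * ((2 ^+ n)^-1 * M) ^+ 2.
  apply: H => [v|]; first by rewrite mulr_ge0// invr_ge0 ltW.
  by rewrite mulrC ler_pdivrMr// mulrC -ler_pdivrMr// invrK mulrC.
have := ler_wpM2l (ltW q0) H; move=> {}H; apply: le_trans H _.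
have -> : \sum_v (2 ^+ n)^-1 * h v * corr J u v = (2 ^+ n)^-1 * \sum_v h v * corr J u v.
  by rewrite mulr_sumr; apply: eq_bigr => v _; rewrite -mulrA.
rewrite mulrDr mulVKf ?gt_eqF// lerD2l.
have -> : 2 ^+ n * (2 * ((2 ^+ n)^-1 * M) ^+ 2) = 2 * M ^+ 2 / 2 ^+ n.
  by field; rewrite gt_eqF.
by rewrite ler_pdivrMr// [e * _]mulrC.
Qed.

End Correlations.

(** * Two copies of a model, coupled vertex by vertex *)

Section Doubling.
Variables (R : realType) (V : finType).
Implicit Types (J : V -> V -> R).

Definition left_conf (s : spins (V + V)%type) : spins V := [ffun u => s (inl u)].
Definition right_conf (s : spins (V + V)%type) : spins V := [ffun u => s (inr u)].
Definition join_conf (s t : spins V) : spins (V + V)%type :=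
  [ffun x => match x with inl u => s u | inr u => t u end].

Lemma sum_double (F : spins V -> spins V -> R) :
  \sum_(s : spins (V + V)%type) F (left_conf s) (right_conf s) = \sum_s \sum_t F s t.
Proof.
rewrite pair_big/= (reindex (fun s : spins (V + V)%type => (left_conf s, right_conf s)))//.
exists (fun p => join_conf p.1 p.2) => [s _|[s t] _] /=.
  by apply/ffunP => -[u|u]; rewrite !ffunE.
by congr (_, _); apply/ffunP => u; rewrite !ffunE.
Qed.

Definition double J (lam : V -> R) (x y : (V + V)%type) : R :=
  match x, y with
  | inl u, inl v => J u v
  | inr u, inr v => J u v
  | inl u, inr v => if u == v then lam u else 0
  | inr u, inl v => if u == v then lam u else 0
  end.

Lemma energy_double J lam s : energy (double J lam) (fun=> 0) s =
  energy J (fun=> 0) (left_conf s) + energy J (fun=> 0) (right_conf s)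
  + \sum_u lam u * (spin R (left_conf s u) * spin R (right_conf s u)).
Proof.
have diag u (F : V -> R) : \sum_v (if u == v then lam u else 0) * F v = lam u * F u.
  rewrite (bigD1 u)//= eqxx big1 ?addr0// => v.
  by rewrite eq_sym => /negPf ->; rewrite mul0r.
pose x u := spin R (s (inl u)); pose y u := spin R (s (inr u)).
have xE u : spin R (left_conf s u) = x u by rewrite ffunE.
have yE u : spin R (right_conf s u) = y u by rewrite ffunE.
have e0 (U : finType) (F : U -> R) : \sum_u 0 * F u = 0.
  by rewrite big1// => u _; rewrite mul0r.
rewrite /energy !e0 !addr0 big_sumType/=.
have -> : \sum_u \sum_j double J lam (inl u) j * (spin R (s (inl u)) * spin R (s j))
  = \sum_u \sum_v J u v * (x u * x v) + \sum_u lam u * (x u * y u).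
  rewrite -big_split; apply: eq_bigr => u _; rewrite big_sumType/=; congr (_ + _).
  exact: (diag u (fun v => x u * y v)).
have -> : \sum_u \sum_j double J lam (inr u) j * (spin R (s (inr u)) * spin R (s j))
  = \sum_u lam u * (x u * y u) + \sum_u \sum_v J u v * (y u * y v).
  rewrite -big_split; apply: eq_bigr => u _; rewrite big_sumType/=; congr (_ + _).
  by rewrite (diag u (fun v => y u * x v)) [y u * _]mulrC.
under [\sum_u \sum_v J u v * (spin R (left_conf s u) * _)]eq_bigr do
  under eq_bigr do rewrite !xE.
under [\sum_u \sum_v J u v * (spin R (right_conf s u) * _)]eq_bigr do
  under eq_bigr do rewrite !yE.
under [\sum_u lam u * (spin R (left_conf s u) * _)]eq_bigr do rewrite xE yE.
by field.
Qed.

Lemma sum_double_corr J lam (f : spins V -> spins V -> R) :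
  \sum_s \sum_t expR (energy J (fun=> 0) s + energy J (fun=> 0) t
                  + \sum_u lam u * (spin R (s u) * spin R (t u))) * f s t =
  Zsum (double J lam) (fun=> 0) *
    Ex (double J lam) (fun=> 0) (fun s => f (left_conf s) (right_conf s)).
Proof.
rewrite ExE -sum_double; apply: eq_bigr => s _.
by rewrite /weight energy_double.
Qed.

Lemma corr_double0 J u v : corr (double J (fun=> 0)) (inl u) (inl v) = corr J u v.
Proof.
rewrite /corr; apply: (mulfI (Zsum_neq0 (double J (fun=> 0)) (fun=> 0))).
have -> : Ex (double J (fun=> 0)) (fun=> 0) (fun s => spin R (s (inl u)) * spin R (s (inl v)))
  = Ex (double J (fun=> 0)) (fun=> 0)
      (fun s => spin R (left_conf s u) * spin R (left_conf s v)).
  by congr Ex; apply/funext => s; rewrite !ffunE.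
rewrite -(sum_double_corr J (fun=> 0) (fun s t => spin R (s u) * spin R (s v))).
have -> : Zsum (double J (fun=> 0)) (fun=> 0)
    = Zsum J (fun=> 0) * Zsum J (fun=> 0).
  rewrite -[LHS]mulr1 -(Ex_cst (double J (fun=> 0)) (fun=> 0) 1).
  rewrite -(sum_double_corr J (fun=> 0) (fun _ _ => 1)) /Zsum mulr_suml.
  apply: eq_bigr => s _; rewrite mulr_sumr; apply: eq_bigr => t _.
  rewrite mulr1 big1 ?addr0; first exact: expRD.
  by move=> w _; rewrite mul0r.
rewrite [RHS]mulrAC ExE mulr_suml; apply: eq_bigr => s _.
rewrite /Zsum mulr_sumr; apply: eq_bigr => t _.
rewrite big1 ?addr0; last by move=> w _; rewrite mul0r.
by rewrite expRD /weight mulrAC.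
Qed.

Lemma double_ge0 J lam : (forall u v, 0 <= J u v) -> (forall u, 0 <= lam u) ->
  forall x y, 0 <= double J lam x y.
Proof. by move=> J0 l0 [u|u] [v|v] //=; case: ifP. Qed.

(** Expanding the product leaves, by symmetry, twice the correlation within a copy and twice that
    across the copies. The former only grows with lam, the latter is nonnegative. *)
Lemma corr_double J lam (u v : V) : (forall u v, 0 <= J u v) -> (forall u, 0 <= lam u) ->
  2 * corr J u v * Zsum (double J lam) (fun=> 0) <=
  \sum_s \sum_t expR (energy J (fun=> 0) s + energy J (fun=> 0) t
                  + \sum_u lam u * (spin R (s u) * spin R (t u)))
     * ((spin R (s u) + spin R (t u)) * (spin R (s v) + spin R (t v))).
Proof.
move=> J0 l0; set X := \sum_s _.
pose Y (f : spins V -> spins V -> R) :=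
  \sum_s \sum_t expR (energy J (fun=> 0) s + energy J (fun=> 0) t
                  + \sum_u lam u * (spin R (s u) * spin R (t u))) * f s t.
have YC f : Y f = Y (fun s t => f t s).
  rewrite /Y exchange_big/=; apply: eq_bigr => s _; apply: eq_bigr => t _.
  rewrite [energy J _ t + _]addrC.
  by rewrite (eq_bigr (fun w => lam w * (spin R (s w) * spin R (t w)))) // => w _;
    rewrite [spin R (t w) * _]mulrC.
have YZ f : Y f = Zsum (double J lam) (fun=> 0) *
    Ex (double J lam) (fun=> 0) (fun s => f (left_conf s) (right_conf s)).
  exact: sum_double_corr.
have -> : X = 2 * Y (fun s t => spin R (s u) * spin R (s v))
            + 2 * Y (fun s t => spin R (s u) * spin R (t v)).
  rewrite !mulr_natl !mulr2n {2}(YC (fun s t => spin R (s u) * spin R (s v))).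
  rewrite {2}(YC (fun s t => spin R (s u) * spin R (t v))) /X /Y -!big_split/=.
  by apply: eq_bigr => s _; rewrite -!big_split/=; apply: eq_bigr => t _; ring.
have D0 := double_ge0 J0 l0.
have -> : Y (fun s t => spin R (s u) * spin R (s v))
    = Zsum (double J lam) (fun=> 0) * corr (double J lam) (inl u) (inl v).
  by rewrite YZ /corr; congr (_ * Ex _ _ _); apply/funext => s; rewrite !ffunE.
have -> : Y (fun s t => spin R (s u) * spin R (t v))
    = Zsum (double J lam) (fun=> 0) * corr (double J lam) (inl u) (inr v).
  by rewrite YZ /corr; congr (_ * Ex _ _ _); apply/funext => s; rewrite !ffunE.
have c2 := corr_ge0 (inl u) (inr v) D0.
have c1 : corr J u v <= corr (double J lam) (inl u) (inl v).
  rewrite -corr_double0; apply: ler_corr => [x y|[x|x] [y|y]]//=.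
  - exact: (@double_ge0 J (fun=> 0)).
  - by case: ifP.
  - by case: ifP.
have Z0 := Zsum_gt0 (double J lam) (fun=> 0).
set Z := Zsum _ _ in Z0 *; set c3 := corr _ _ (inr v) in c2 *.
set c := corr J u v in c1 *; set c4 := corr _ _ _ in c1 *.
rewrite -subr_ge0.
have -> : 2 * (Z * c4) + 2 * (Z * c3) - 2 * c * Z = 2 * (Z * (c4 - c + c3)) by ring.
by rewrite mulr_ge0// mulr_ge0 ?(ltW Z0)//; lra.
Qed.

End Doubling.

(** * Sharpness *)

Section Sharpness.
Variables (R : realType) (V : finType).
Variables (J : V -> V -> R) (n : V -> R) (b c : R) (o : V).
Hypotheses (sJ : forall u v, J u v = J v u) (J0 : forall u v, 0 <= J u v).
Hypotheses (n0 : forall u, 0 <= n u) (b0 : 0 <= b).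
Implicit Types (S : {set V}) (s t : spins V) (a : V -> R).

(** The field at u when everything outside S is plus; n is the coupling to the plus boundary. *)
Definition nS S u : R := n u + \sum_(v | v \notin S) J u v.

Definition pin S s : bool := [forall u, (u \notin S) ==> s u].

Definition E s : R := energy J n s.

(** Its mean over two independent copies is the covariance of the spin at o with the energy, minus c
    (1 - m). *)
Definition disagreement s t : R :=
  2^-1 * (spin R (s o) - spin R (t o)) * (E s - E t)
  - c * (1 - 2^-1 * (spin R (s o) + spin R (t o))).

(* [wgt] is the weight of a pair of configurations after an exploration
   from the boundary along open bonds between vertices at which both copies are
   plus: the complement of S is explored, and a u is the total coupling of the
   bonds from it to u that were found to be closed. *)
Definition wgt S a s t : R := (pin S s && pin S t)%:R *
  expR (b * (E s + E t) - \sum_(u in S) b * a u * ((1 + spin R (s u)) * (1 + spin R (t u)))).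

Definition Phi S a : R := \sum_s \sum_t wgt S a s t * disagreement s t.

Definition ones : spins V := [ffun=> true].

Lemma mix_pin S s : pin S s -> mix S ones s = s.
Proof.
move=> /forallP ps; apply/ffunP => u; rewrite ffunE; case: ifPn => // uS.
by rewrite ffunE; have := ps u; rewrite uS /= => ->.
Qed.

Definition npin S : R := \sum_s (pin S s)%:R.

Lemma npin_gt0 S : 0 < npin S.
Proof.
rewrite /npin (bigD1 ones)//= ltr_pwDl ?sumr_ge0//.
by rewrite (_ : pin S ones) ?ltr01//; apply/forallP => u; rewrite ffunE implybT.
Qed.

(** Trades the pinned sum for a sum over all configurations, whose spins outside S are dummies, so
    that flips of the whole configuration become available. *)
Lemma sum_pin S (F : spins V -> R) :
  #|{: spins V}|%:R * (\sum_s (pin S s)%:R * F s) = npin S * \sum_s F (mix S ones s).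
Proof.
transitivity (\sum_(t : spins V) \sum_s (pin S s)%:R * F s).
  by rewrite sumr_const -[RHS]mulr_natl; congr (_%:R * _); exact: eq_card.
rewrite (sum_mix S) exchange_big /npin mulr_suml; apply: eq_bigr => s _ /=.
rewrite mulr_sumr; apply: eq_bigr => t _.
have -> : pin S (mix S s t) = pin S s.
  by apply: eq_forallb => u; case: (boolP (u \in S)) => // uS; rewrite mix_out.
case: (boolP (pin S s)) => ps; rewrite ?mul0r// !mul1r; congr F.
by apply/ffunP => u; rewrite !ffunE; case: ifPn => // uS; move/forallP: ps => /(_ u);
  rewrite uS => /= ->.
Qed.

(** The right-hand side is phi(S) at inverse temperature b. *)
Hypothesis cS : forall S, o \in S ->
  c <= \sum_(u in S) nS S u * corr (fun u v => b * inner J S u v) o u.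

Lemma energy_pin S s : pin S s ->
  E s = energy (inner J S) (fun=> 0) s + \sum_(u in S) nS S u * spin R (s u)
        + outer_energy J n S ones.
Proof.
move=> ps; rewrite /E -{1}(mix_pin ps) energy_mix// /energy; congr (_ + _).
rewrite -addrA; congr (_ + _); rewrite [X in X + _]big1 ?add0r; last first.
  by move=> u _; rewrite mul0r.
rewrite [RHS]big_mkcond; apply: eq_bigr => u _; rewrite /bfield.
case: ifP => _; rewrite ?mul0r// /nS; congr ((_ + _) * _).
by apply: eq_bigr => v _; rewrite ffunE mulr1.
Qed.

Lemma energyZ (x : R) S s :
  energy (fun u v => x * inner J S u v) (fun=> 0) s = x * energy (inner J S) (fun=> 0) s.
Proof.
have e0 : \sum_u 0 * spin R (s u) = 0 by rewrite big1// => u _; rewrite mul0r.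
rewrite /energy e0 !addr0 mulrCA; congr (_ * _); rewrite mulr_sumr.
by apply: eq_bigr => u _; rewrite mulr_sumr; apply: eq_bigr => v _; rewrite -mulrA.
Qed.

Lemma energy_flip0 (K : V -> V -> R) s : energy K (fun=> 0) (flip s) = energy K (fun=> 0) s.
Proof.
rewrite /energy; congr (_ * _ + _); last by rewrite !big1// => u _; rewrite mul0r.
by apply: eq_bigr => u _; apply: eq_bigr => v _; rewrite !ffunE !spinN mulrNN.
Qed.

(* The fully explored case.  Exchanging and flipping the two copies leaves the
   weight invariant and kills the terms that are even in the spins of S; then
   flipping the second copy makes the doubled system ferromagnetic. *)
Lemma Phi_closed S : o \in S -> 0 <= Phi S (nS S).
Proof.
move=> oS; pose Ei s := energy (inner J S) (fun=> 0) s.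
pose N u := if u \in S then nS S u else 0.
have N0 u : 0 <= N u.
  by rewrite /N; case: ifP => // _; rewrite addr_ge0// sumr_ge0.
pose G s t := expR (b * (Ei s + Ei t) - \sum_u b * N u * (spin R (s u) * spin R (t u))).
pose K := expR (b * (2 * outer_energy J n S ones) - \sum_u b * N u).
have K0 : 0 < K by exact: expR_gt0.
pose L s := \sum_u N u * spin R (s u).
have LE s : \sum_(u in S) nS S u * spin R (s u) = L s.
  by rewrite big_mkcond; apply: eq_bigr => u _; rewrite /N; case: ifP; rewrite ?mul0r.
pose I s t := 2^-1 * (spin R (s o) - spin R (t o)) * (Ei s - Ei t + (L s - L t))
    - c * (1 - 2^-1 * (spin R (s o) + spin R (t o))).
have PhiE : Phi S (nS S) = \sum_s (pin S s)%:R * \sum_t (pin S t)%:R * (K * G s t * I s t).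
  apply: eq_bigr => s _; rewrite mulr_sumr; apply: eq_bigr => t _.
  rewrite /wgt; case: (boolP (pin S s)) => ps; last by rewrite /= !mul0r.
  case: (boolP (pin S t)) => pt; last by rewrite /= !(mul0r, mulr0).
  rewrite /disagreement !mul1r (energy_pin ps) (energy_pin pt) !LE.
  rewrite -/(Ei s) -/(Ei t) /K /G -expRD.
  (* The linear terms of (1 + s u)(1 + t u) cancel the field exerted by the plus spins outside S. *)
  have -> : b * (Ei s + L s + outer_energy J n S ones + (Ei t + L t + outer_energy J n S ones))
       - \sum_(u in S) b * nS S u * ((1 + spin R (s u)) * (1 + spin R (t u)))
    = b * (2 * outer_energy J n S ones) - \sum_u b * N u
      + (b * (Ei s + Ei t) - \sum_u b * N u * (spin R (s u) * spin R (t u))).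
    have -> : \sum_(u in S) b * nS S u * ((1 + spin R (s u)) * (1 + spin R (t u)))
        = \sum_u b * N u + b * L s + b * L t
          + \sum_u b * N u * (spin R (s u) * spin R (t u)).
      rewrite /L !mulr_sumr -!big_split big_mkcond; apply: eq_bigr => u _ /=.
      by rewrite /N; case: ifP => _; ring.
    ring.
  by rewrite /I; congr (_ * (_ * _ - _)); ring.
have mo s : mix S ones s o = s o by rewrite mix_in.
have mE s : Ei (mix S ones s) = Ei s.
  rewrite /Ei /energy; congr (_ * _ + _); last by rewrite !big1// => u _; rewrite mul0r.
  apply: eq_bigr => u _; apply: eq_bigr => v _; rewrite /inner.
  by case: ifPn => [/andP[uS vS]|_]; rewrite ?mul0r// !mix_in.
have mN s t : \sum_u b * N u * (spin R (mix S ones s u) * spin R (mix S ones t u))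
    = \sum_u b * N u * (spin R (s u) * spin R (t u)).
  apply: eq_bigr => u _; rewrite /N; case: ifPn => uS; last by rewrite mulr0 !mul0r.
  by rewrite !mix_in.
have mL s : L (mix S ones s) = L s.
  apply: eq_bigr => u _; rewrite /N; case: ifPn => uS; last by rewrite !mul0r.
  by rewrite !mix_in.
have {PhiE} : #|{: spins V}|%:R * (#|{: spins V}|%:R * Phi S (nS S)) =
    npin S * npin S * K * \sum_s \sum_t G s t * I s t.
  rewrite PhiE sum_pin mulrCA mulr_sumr.
  under eq_bigr => s _ do rewrite sum_pin.
  rewrite -mulr_sumr mulrA -[RHS]mulrA; congr (_ * _); rewrite mulr_sumr.
  apply: eq_bigr => s _; rewrite mulr_sumr; apply: eq_bigr => t _.
  by rewrite /G /I !mE !mN !mL !mo mulrA.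
set X := \sum_s \sum_t _ => PhiX.
suff X0 : 0 <= X.
  have cpos : 0 < #|{: spins V}|%:R :> R.
    by rewrite ltr0n; apply/card_gt0P; exists ones.
  rewrite -(pmulr_rge0 _ cpos) -(pmulr_rge0 _ cpos) PhiX.
  by rewrite !mulr_ge0// ?(ltW K0)// ltW// npin_gt0.
(* Under the exchange with flip I1 is even and I2 odd; in particular the mean spin at o vanishes and
   leaves the full constant c. *)
pose I1 s t := 2^-1 * (spin R (s o) - spin R (t o)) * (L s - L t) - c.
pose I2 s t := 2^-1 * (spin R (s o) - spin R (t o)) * (Ei s - Ei t)
   + c * (2^-1 * (spin R (s o) + spin R (t o))).
have fo s : spin R (flip s o) = - spin R (s o) by rewrite ffunE spinN.
have fL s : L (flip s) = - L s.
  by rewrite /L -sumrN; apply: eq_bigr => u _; rewrite ffunE spinN mulrN.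
have X2 : \sum_s \sum_t G s t * I2 s t = 0.
  suff : \sum_s \sum_t G s t * I2 s t = - \sum_s \sum_t G s t * I2 s t by lra.
  rewrite [LHS]exchange_big/= [LHS](reindex_inj (inv_inj (@flipK V)))/= -sumrN.
  apply: eq_bigr => s _; rewrite [LHS](reindex_inj (inv_inj (@flipK V)))/= -sumrN.
  apply: eq_bigr => t _.
  have -> : G (flip t) (flip s) = G s t.
    rewrite /G /Ei !energy_flip0 [energy _ _ t + _]addrC.
    rewrite (eq_bigr (fun u => b * N u * (spin R (s u) * spin R (t u))))// => u _.
    by rewrite !ffunE !spinN mulrNN [spin R (t u) * _]mulrC.
  by rewrite /I2 /Ei !energy_flip0 !fo; ring.
have -> : X = \sum_s \sum_t G s t * I1 s t.
  suff -> : X = \sum_s \sum_t G s t * I1 s t + \sum_s \sum_t G s t * I2 s t.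
    by rewrite X2 addr0.
  rewrite -big_split; apply: eq_bigr => s _ /=.
  rewrite -big_split; apply: eq_bigr => t _ /=.
  by rewrite /I /I1 /I2; ring.
have -> : \sum_s \sum_t G s t * I1 s t = \sum_s \sum_t
    expR (energy (fun u v => b * inner J S u v) (fun=> 0) s
        + energy (fun u v => b * inner J S u v) (fun=> 0) t
        + \sum_u b * N u * (spin R (s u) * spin R (t u))) *
    (\sum_u 2^-1 * N u * ((spin R (s o) + spin R (t o)) * (spin R (s u) + spin R (t u))) - c).
  apply: eq_bigr => s _; rewrite [LHS](reindex_inj (inv_inj (@flipK V)))/=.
  apply: eq_bigr => t _; rewrite !energyZ -/(Ei s) -/(Ei t) /I1 fo fL.
  have -> : G s (flip t) = expR (b * Ei s + b * Ei t
      + \sum_u b * N u * (spin R (s u) * spin R (t u))).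
    rewrite /G {2}/Ei energy_flip0 -/(Ei t) mulrDr.
    have -> : \sum_u b * N u * (spin R (s u) * spin R (flip t u))
        = - \sum_u b * N u * (spin R (s u) * spin R (t u)).
      by rewrite -sumrN; apply: eq_bigr => u _; rewrite ffunE spinN !mulrN.
    by rewrite opprK.
  congr (_ * (_ - _)); rewrite !opprK -big_split/= mulr_sumr.
  by apply: eq_bigr => u _; rewrite /=; ring.
pose Jb u v := b * inner J S u v.
have Jb0 u v : 0 <= Jb u v by rewrite mulr_ge0// inner_ge0.
pose lam u := b * N u.
have l0 u : 0 <= lam u by rewrite mulr_ge0.
pose W s t := expR (energy Jb (fun=> 0) s + energy Jb (fun=> 0) t
        + \sum_u lam u * (spin R (s u) * spin R (t u))).
pose Z := Zsum (double Jb lam) (fun=> 0).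
have Z0 : 0 < Z := Zsum_gt0 _ _.
have ZW : \sum_s \sum_t W s t = Z.
  rewrite -[RHS]mulr1 -(Ex_cst (double Jb lam) (fun=> 0) 1).
  rewrite -(sum_double_corr Jb lam (fun _ _ => 1)).
  by apply: eq_bigr => s _; apply: eq_bigr => t _; rewrite mulr1.
have -> : \sum_s \sum_t W s t *
    (\sum_u 2^-1 * N u * ((spin R (s o) + spin R (t o)) * (spin R (s u) + spin R (t u))) - c)
  = \sum_u 2^-1 * N u * (\sum_s \sum_t W s t *
      ((spin R (s o) + spin R (t o)) * (spin R (s u) + spin R (t u)))) - c * Z.
  rewrite -ZW mulr_sumr -sumrN.
  transitivity (\sum_s (\sum_t \sum_u W s t * (2^-1 * N u *
      ((spin R (s o) + spin R (t o)) * (spin R (s u) + spin R (t u)))) - c * \sum_t W s t)).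
    apply: eq_bigr => s _; rewrite mulr_sumr -sumrB; apply: eq_bigr => t _.
    by rewrite mulrBr mulr_sumr [W s t * c]mulrC.
  rewrite big_split/=; congr (_ + _).
  under eq_bigr do rewrite exchange_big/=.
  rewrite exchange_big/=; apply: eq_bigr => u _; rewrite mulr_sumr.
  apply: eq_bigr => s _; rewrite mulr_sumr; apply: eq_bigr => t _.
  exact: mulrCA.
(* The 2 of [corr_double] cancels the factor 2^-1, and phi(S) times Z is left. *)
have H := cS oS.
rewrite subr_ge0; apply: le_trans (ler_wpM2r (ltW Z0) H) _.
rewrite mulr_suml big_mkcond; apply: ler_sum => u _ /=.
rewrite /N; case: ifP => uS; last by rewrite mulr0 mul0r.
have nSu : 0 <= 2^-1 * nS S u.
  by have := N0 u; rewrite /N uS => H'; rewrite mulr_ge0// invr_ge0.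
apply: le_trans (ler_wpM2l nSu (corr_double o u Jb0 l0)).
by rewrite -/Z /Jb; lra.
Qed.

Lemma pinD1 S u s : pin (S :\ u)%SET s = pin S s && s u.
Proof.
apply/forallP/andP => [ps|[/forallP ps su] v].
  split; last by have := ps u; rewrite !inE eqxx.
  apply/forallP => v; have := ps v; rewrite !inE negb_and negbK.
  by case: (boolP (v \in S)) => //= vS; rewrite orbT.
rewrite !inE negb_and negbK; case: eqVneq => [->|_] /=; first by rewrite su.
exact: ps.
Qed.

(** Keeps the bound on a valid when u joins the explored part. *)
Lemma nSD1 S u v : nS S v <= nS (S :\ u)%SET v.
Proof.
rewrite lerD2l [leLHS]big_mkcond [leRHS]big_mkcond; apply: ler_sum => w _ /=.
by rewrite !inE negb_and; case: (w \in S); case: (w == u) => /=.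
Qed.

(* Revealing the bonds between an unexplored vertex u and the explored part:
   either they are all closed, or u joins the explored part. *)
Lemma wgt_reveal S a a' u s t : u \in S -> (forall v, v != u -> a' v = a v) ->
  wgt S a s t = wgt S a' s t
   + (expR (- (4 * b * a u)) - expR (- (4 * b * a' u))) * wgt (S :\ u)%SET a s t.
Proof.
move=> uS aa'; rewrite /wgt !(big_setD1 u uS)/= !pinD1.
have -> : \sum_(v in (S :\ u)%SET) b * a' v * ((1 + spin R (s v)) * (1 + spin R (t v)))
    = \sum_(v in (S :\ u)%SET) b * a v * ((1 + spin R (s v)) * (1 + spin R (t v))).
  by apply: eq_bigr => v; rewrite !inE => /andP[vu _]; rewrite aa'.
set X := b * (E s + E t); set Y := \sum_(v in _) _.
case: (boolP (pin S s)) => ps; last by rewrite !mul0r mulr0 addr0.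
case: (boolP (pin S t)) => pt; last by rewrite /= andbF !mul0r mulr0 addr0.
case su : (s u) => /=; last first.
  by rewrite !subrr !(mul0r, mulr0, add0r, addr0, mul1r).
case tu : (t u) => /=; last first.
  by rewrite !subrr !(mul0r, mulr0, add0r, addr0, mul1r).
have e x : X - (b * x * ((1 + 1) * (1 + 1)) + Y) = - (4 * b * x) + (X - Y) by ring.
by rewrite !e !expRD; ring.
Qed.

(** Induction along the exploration, on S and then on the vertices with unrevealed bonds to the
    explored part. At the end either o is still in S, which is [Phi_closed], or o is plus in both
    copies and [disagreement] vanishes. *)
Lemma Phi_ge0 S a : (forall u, u \in S -> a u <= nS S u) -> 0 <= Phi S a.
Proof.
move: {2}#|S| (leqnn #|S|) => k; elim: k => [|k IHk] in S a * => Sk an.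
  have oS : o \notin S.
    by move: Sk; rewrite leqn0 cards_eq0 => /eqP ->; rewrite inE.
  apply: sumr_ge0 => s _; apply: sumr_ge0 => t _; rewrite /wgt.
  case: (boolP (pin S s)) => [/forallP/(_ o)|]; last by rewrite !mul0r.
  rewrite oS /= => so; case: (boolP (pin S t)) => [/forallP/(_ o)|]; last by rewrite !mul0r.
  by rewrite oS /= => to; rewrite /disagreement so to /= subrr mulr0 mul0r
      mulVf ?subrr ?mulr0 ?subrr ?mulr0.
pose B a := [set u in S | a u != nS S u]%SET.
move: {2}#|B a| (leqnn #|B a|) => m; elim: m => [|m IHm] in a an * => Bm.
  have aE u : u \in S -> a u = nS S u.
    move=> uS; move: Bm; rewrite leqn0 cards_eq0 => /eqP/setP/(_ u).
    by rewrite !inE uS => /negbFE/eqP.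
  have [oS|oS] := boolP (o \in S).
    suff -> : Phi S a = Phi S (nS S) by exact: Phi_closed.
    apply: eq_bigr => s _; apply: eq_bigr => t _; rewrite /wgt.
    rewrite (eq_bigr (fun u => b * nS S u * ((1 + spin R (s u)) * (1 + spin R (t u)))))//.
    by move=> u uS; rewrite aE.
  apply: sumr_ge0 => s _; apply: sumr_ge0 => t _; rewrite /wgt.
  case: (boolP (pin S s)) => [/forallP/(_ o)|]; last by rewrite !mul0r.
  rewrite oS /= => so; case: (boolP (pin S t)) => [/forallP/(_ o)|]; last by rewrite !mul0r.
  by rewrite oS /= => to; rewrite /disagreement so to /= subrr mulr0 mul0r
      mulVf ?subrr ?mulr0 ?subrr ?mulr0.
have [u|Ba] := pickP (mem (B a)); last first.
  by apply: IHm => //; rewrite eq_card0.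
rewrite !inE => /andP[uS au].
pose a' v := if v == u then nS S u else a v.
have -> : Phi S a = Phi S a'
    + (expR (- (4 * b * a u)) - expR (- (4 * b * a' u))) * Phi (S :\ u)%SET a.
  rewrite /Phi mulr_sumr -big_split; apply: eq_bigr => s _ /=.
  rewrite mulr_sumr -big_split; apply: eq_bigr => t _ /=.
  rewrite (@wgt_reveal S a a' u)//; first by ring.
  by move=> v /negPf vu; rewrite /a' vu.
have aa' : a u <= a' u by rewrite /a' eqxx an.
apply: addr_ge0; last apply: mulr_ge0.
- apply: IHm => [v vS|]; first by rewrite /a'; case: eqVneq => [->|_] //; exact: an.
  rewrite -ltnS; apply: leq_trans Bm; rewrite [X in (_ < X)%N](cardsD1 u) !inE uS au.
  rewrite ltnS; apply/subset_leq_card/fintype.subsetP => v; rewrite !inE /a'.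
  by case: (eqVneq v u) => [->|]; rewrite ?eqxx ?andbF.
- by rewrite subr_ge0 ler_expR lerN2 ler_wpM2l// mulr_ge0.
- apply: IHk; first by move: Sk; rewrite (cardsD1 u) uS.
  by move=> v; rewrite !inE => /andP[_ vS]; apply: le_trans (nSD1 S u v); exact: an.
Qed.

Definition bJ u v : R := b * J u v.
Definition bn u : R := b * n u.

Lemma energy_scale (x : R) s : energy (fun u v => x * J u v) (fun u => x * n u) s = x * E s.
Proof.
rewrite /E /energy mulrDr mulrCA; congr (_ * _ + _); rewrite mulr_sumr.
  by apply: eq_bigr => u _; rewrite mulr_sumr; apply: eq_bigr => v _; rewrite -mulrA.
by apply: eq_bigr => v _; rewrite -mulrA.
Qed.

(* The covariance is the derivative of the magnetization with respect to b. *)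
Lemma cov_energy_lb : c * (1 - mag bJ bn o) <=
  Ex bJ bn (fun s => spin R (s o) * E s) - mag bJ bn o * Ex bJ bn E.
Proof.
(* With nothing explored the pair weight is the product of two Gibbs weights. *)
have := @Phi_ge0 [set: V]%SET (fun=> 0).
have nS0 u : u \in [set: V]%SET -> 0 <= nS [set: V]%SET u.
  by rewrite addr_ge0// sumr_ge0.
move=> /(_ nS0).
have wE s t : wgt [set: V]%SET (fun=> 0) s t = weight bJ bn s * weight bJ bn t.
  rewrite /wgt big1 => [|u _]; last by rewrite mulr0 mul0r.
  have pT s' : pin [set: V]%SET s' by apply/forallP => u; rewrite inE.
  by rewrite !pT mul1r subr0 mulrDr expRD /weight !energy_scale.
pose Z := Zsum bJ bn.
have Z0 : 0 < Z := Zsum_gt0 _ _.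
pose m := \sum_s weight bJ bn s * spin R (s o).
pose e := \sum_s weight bJ bn s * E s.
pose me := \sum_s weight bJ bn s * (spin R (s o) * E s).
have -> : Phi [set: V]%SET (fun=> 0) = me * Z - m * e - c * (Z * Z - m * Z).
  transitivity (\sum_s \sum_t (2^-1 * ((weight bJ bn s * (spin R (s o) * E s)) * weight bJ bn t
     - (weight bJ bn s * spin R (s o)) * (weight bJ bn t * E t)
     - (weight bJ bn s * E s) * (weight bJ bn t * spin R (t o))
     + weight bJ bn s * (weight bJ bn t * (spin R (t o) * E t)))
     - c * (weight bJ bn s * weight bJ bn t)
     + c * 2^-1 * ((weight bJ bn s * spin R (s o)) * weight bJ bn t)
     + c * 2^-1 * (weight bJ bn s * (weight bJ bn t * spin R (t o))))).
    apply: eq_bigr => s _; apply: eq_bigr => t _.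
    by rewrite wE /disagreement; ring.
  have sum2 (F G : spins V -> R) : \sum_s \sum_t F s * G t = (\sum_s F s) * (\sum_t G t).
    by rewrite mulr_suml; apply: eq_bigr => s _; rewrite mulr_sumr.
  have lin (x : R) (F : spins V -> spins V -> R) :
      \sum_s \sum_t x * F s t = x * \sum_s \sum_t F s t.
    by rewrite mulr_sumr; apply: eq_bigr => s _; rewrite mulr_sumr.
  have add (F G : spins V -> spins V -> R) :
      \sum_s \sum_t (F s t + G s t) = \sum_s \sum_t F s t + \sum_s \sum_t G s t.
    by rewrite -big_split; apply: eq_bigr => s _; rewrite big_split.
  have opp (F : spins V -> spins V -> R) :
      \sum_s \sum_t - F s t = - \sum_s \sum_t F s t.
    by rewrite -sumrN; apply: eq_bigr => s _; rewrite sumrN.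
  rewrite !(add, opp, lin, sum2) -/Z -/m -/e -/me.
  by rewrite -/(Zsum bJ bn) -/Z; field.
rewrite /mag /Ex -/Z -/m -/e -/me => H.
have -> : me / Z - m / Z * (e / Z) = (me * Z - m * e) / (Z * Z).
  by field; exact: lt0r_neq0.
rewrite ler_pdivlMr ?mulr_gt0//.
have -> : c * (1 - m / Z) * (Z * Z) = c * (Z * Z - m * Z).
  by field; exact: lt0r_neq0.
by rewrite -subr_ge0.
Qed.

End Sharpness.

(** * Integration of the differential inequality *)

Section Growth.
Variables (R : realType) (V : finType).
Variables (J : V -> V -> R) (n : V -> R) (o : V).
Hypotheses (sJ : forall u v, J u v = J v u) (J0 : forall u v, 0 <= J u v).
Hypotheses (n0 : forall u, 0 <= n u).

Definition magb (b : R) : R := mag (bJ J b) (bn n b) o.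

Lemma is_derive_expRZ (e f b : R) :
  is_derive b 1 (fun x => expR (x * e) * f) (expR (b * e) * (e * f)).
Proof.
have h : is_derive b 1 (fun x : R => x * e) e.
  by apply: is_derive_eq; rewrite !scaler0 ?add0r ?addr0 /GRing.scale /= mulr1.
have h2 := @is_derive1_comp R expR (fun x : R => x * e) b _ _ (is_derive_expR _) h.
rewrite (_ : (fun x => _) = f \*: (expR \o (fun x : R => x * e))).
  by apply: is_derive_eq; rewrite /GRing.scale /=; ring.
by apply/funext => x /=; rewrite /GRing.scale /= mulrC.
Qed.

Lemma is_derive_partition (f : spins V -> R) (b : R) :
  is_derive b 1 (fun x => \sum_s expR (x * energy J n s) * f s)
    (\sum_s expR (b * energy J n s) * (energy J n s * f s)).
Proof.
elim: (index_enum _) => [|s r IH].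
  rewrite big_nil (_ : (fun _ => _) = cst 0); first exact: is_derive_cst.
  by apply/funext => x; rewrite big_nil.
rewrite big_cons (_ : (fun _ => _) = (fun x => expR (x * energy J n s) * f s) +
  (fun x => \sum_(s <- r) expR (x * energy J n s) * f s)).
  exact: is_deriveD (is_derive_expRZ _ _ _) IH.
by apply/funext => x; rewrite big_cons.
Qed.

Let N b := \sum_s expR (b * energy J n s) * spin R (s o).
Let D b := \sum_s expR (b * energy J n s) * 1.

Let DZ b : D b = Zsum (bJ J b) (bn n b).
Proof. by apply: eq_bigr => s _; rewrite mulr1 /weight energy_scale. Qed.

Lemma magbE b : magb b = N b / D b.
Proof.
rewrite DZ /magb /mag /Ex; congr (_ / _).
by apply: eq_bigr => s _; rewrite /weight energy_scale.
Qed.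

Lemma is_derive_magb (b : R) : is_derive b 1 magb
  (Ex (bJ J b) (bn n b) (fun s => spin R (s o) * E J n s)
   - magb b * Ex (bJ J b) (bn n b) (E J n)).
Proof.
have D0 : D b != 0 by rewrite DZ Zsum_neq0.
have dN : is_derive b 1 N _ := is_derive_partition _ b.
have dD : is_derive b 1 D _ := is_derive_partition _ b.
have dV := is_deriveV D0 dD.
rewrite (_ : magb = N * (fun x => (D x)^-1)); last first.
  by apply/funext => x; rewrite magbE.
apply: is_derive_eq; rewrite /GRing.scale /= -[X in _ = _ - X * _]/(N b / D b).
have -> : Ex (bJ J b) (bn n b) (fun s => spin R (s o) * E J n s) =
    (\sum_s expR (b * energy J n s) * (energy J n s * spin R (s o))) / D b.
  rewrite DZ /Ex; congr (_ / _); apply: eq_bigr => s _.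
  by rewrite /weight energy_scale [spin R _ * _]mulrC.
have -> : Ex (bJ J b) (bn n b) (E J n) =
    (\sum_s expR (b * energy J n s) * (energy J n s * 1)) / D b.
  rewrite DZ /Ex; congr (_ / _); apply: eq_bigr => s _.
  by rewrite /weight energy_scale mulr1.
by field.
Qed.

(* The mean-field lower bound: m' >= c (1 - m) integrates to this. *)
Lemma magb_growth (c b1 b2 : R) : 0 <= b1 -> b1 <= b2 ->
  (forall b (S : {set V}), b1 <= b <= b2 -> o \in S ->
     c <= \sum_(u in S) nS J n S u * corr (fun u v => b * inner J S u v) o u) ->
  1 - magb b2 <= expR (- (c * (b2 - b1))).
Proof.
move=> b10 b12 hyp.
(* With this integrating factor the differential inequality says that f is nonincreasing. *)
pose f (x : R) : R := (1 - magb x) * expR (x * c).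
have df (x : R) : is_derive x 1 f (expR (x * c) * (c * (1 - magb x)
  - (Ex (bJ J x) (bn n x) (fun s => spin R (s o) * E J n s)
   - magb x * Ex (bJ J x) (bn n x) (E J n)))).
  have d1 := is_derive_magb x.
  have d2 := is_derive_expRZ c 1 x.
  rewrite (_ : f = (cst 1 - magb) * (fun x => expR (x * c) * 1)); last first.
    by apply/funext => y; rewrite /f /= -[RHS]/((1 - magb y) * (expR (y * c) * 1)) mulr1.
  apply: is_derive_eq.
  by rewrite /GRing.scale /= -[(cst 1 - magb) x]/(1 - magb x); ring.
have le : f b2 <= f b1.
  apply: (@ler0_derive1_nincr R f b1 b2) => //.
  - move=> x xb; rewrite derive1E derive_val.
    move: xb; rewrite in_itv => /andP[x1 x2].
    rewrite pmulr_rle0 ?expR_gt0// subr_le0; apply: cov_energy_lb => //.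
      exact: le_trans b10 (ltW x1).
    by move=> S oS; apply: hyp => //; rewrite !ltW.
  - apply: continuous_subspaceT => x.
    apply: differentiable_continuous; apply/derivable1_diffP.
    by apply: ex_derive.
have m1 : 0 <= magb b1.
  apply: mag_ge0 => [u v|u v|u]; rewrite /bJ /bn ?mulr_ge0//.
  by rewrite sJ.
have e0 := expR_gt0 (b2 * c).
rewrite -(ler_pM2r e0); apply: le_trans le _; rewrite -expRD.
have -> : - (c * (b2 - b1)) + b2 * c = b1 * c by ring.
by rewrite /f ler_piMl ?expR_ge0//; lra.
Qed.

End Growth.

(** * Embedding a model into a larger vertex set *)

Section Transfer.
Variables (R : realType) (V1 V2 : finType) (i : V1 -> V2).
Hypothesis inj_i : injective i.

Definition pullback (s : spins V2) : spins V1 := [ffun u => s (i u)].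

Definition extend (s1 : spins V1) (s2 : spins V2) : spins V2 :=
  [ffun y => if [pick u | i u == y] is Some u then s1 u else s2 y].

Lemma extend_in s1 s2 u : extend s1 s2 (i u) = s1 u.
Proof.
rewrite ffunE; case: pickP => [v /eqP /inj_i ->//|/(_ u)].
by rewrite eqxx.
Qed.

Lemma extend_out s1 s2 y : (forall u, i u != y) -> extend s1 s2 y = s2 y.
Proof.
move=> iy; rewrite ffunE; case: pickP => // u uy.
by have := iy u; rewrite uy.
Qed.

(* Exchanging s1 with the restriction of s2 is an involution on pairs. *)
Lemma sum_pullback (F : spins V1 -> R) :
  #|{: spins V1}|%:R * (\sum_s F (pullback s)) = #|{: spins V2}|%:R * \sum_s F s.
Proof.
transitivity (\sum_(s1 : spins V1) \sum_(s2 : spins V2) F (pullback s2)).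
  by rewrite sumr_const -[RHS]mulr_natl; congr (_%:R * _); exact: eq_card.
transitivity (\sum_(s1 : spins V1) \sum_(s2 : spins V2) F s1); last first.
  rewrite exchange_big sumr_const -[LHS]mulr_natl; congr (_%:R * _); exact: eq_card.
have pe s1 s2 : pullback (extend s1 s2) = s1.
  by apply/ffunP => u; rewrite ffunE extend_in.
have ep s1 s2 : extend (pullback s2) (extend s1 s2) = s2.
  apply/ffunP => y; rewrite ffunE; case: pickP => [v /eqP <-|iu]; first by rewrite ffunE.
  by rewrite extend_out// => u; rewrite iu.
rewrite !pair_big/= (reindex (fun p : spins V1 * spins V2 =>
  (pullback p.2, extend p.1 p.2)))/=.
  by apply: eq_bigr => -[s1 s2] _ /=; rewrite pe.
exists (fun p : spins V1 * spins V2 => (pullback p.2, extend p.1 p.2)) => -[s1 s2] _ /=;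
by rewrite pe ep.
Qed.

Lemma Ex_transfer J1 h1 J2 h2 (f : spins V1 -> R) :
  (forall s, energy J2 h2 s = energy J1 h1 (pullback s)) ->
  Ex J2 h2 (fun s => f (pullback s)) = Ex J1 h1 f.
Proof.
move=> eE; have c1 : #|{: spins V1}|%:R != 0 :> R.
  by rewrite pnatr_eq0 -lt0n; apply/card_gt0P; exists [ffun=> true].
have c2 : #|{: spins V2}|%:R != 0 :> R.
  by rewrite pnatr_eq0 -lt0n; apply/card_gt0P; exists [ffun=> true].
have S (F : spins V1 -> R) : \sum_s F (pullback s)
    = #|{: spins V2}|%:R / #|{: spins V1}|%:R * \sum_s F s.
  by apply: (mulfI c1); rewrite sum_pullback mulrA mulrCA mulfV// mulr1.
rewrite /Ex /Zsum /weight.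
under eq_bigr do rewrite eE.
under [in X in _ / X]eq_bigr do rewrite eE.
rewrite (S (fun s => expR (energy J1 h1 s) * f s)) (S (fun s => expR (energy J1 h1 s))).
by rewrite -mulf_div divff ?mul1r// mulf_neq0 ?invr_neq0.
Qed.

Lemma energy_pullback J1 h1 J2 h2 (s : spins V2) :
  (forall u v, J2 (i u) (i v) = J1 u v) ->
  (forall x y, (forall u, i u != x) \/ (forall u, i u != y) -> J2 x y = 0) ->
  (forall u, h2 (i u) = h1 u) -> (forall x, (forall u, i u != x) -> h2 x = 0) ->
  energy J2 h2 s = energy J1 h1 (pullback s) :> R.
Proof.
move=> JE J0 hE h0.
have sumE (F : V2 -> R) : (forall x, (forall u, i u != x) -> F x = 0) ->
    \sum_x F x = \sum_u F (i u).
  move=> F0; rewrite (bigID (fun x => [exists u, i u == x]))/= [X in _ + X]big1 ?addr0; last first.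
    by move=> x /existsPn xi; exact: F0.
  rewrite (eq_bigl (mem (i @: [set: V1])%SET)); last first.
    move=> x; apply/existsP/imsetP => [[u /eqP <-]|[u _ ->]]; first by exists u.
    by exists u.
  rewrite big_imset/=; last by move=> u v _ _; exact: inj_i.
  by apply: eq_bigl => u; rewrite inE.
rewrite /energy sumE; last first.
  by move=> x xi; rewrite big1// => y _; rewrite J0 ?mul0r//; left.
rewrite [X in _ + X]sumE; last by move=> x xi; rewrite h0// mul0r.
congr (_ * _ + _); last by apply: eq_bigr => u _; rewrite hE ffunE.
apply: eq_bigr => u _; rewrite sumE; last by move=> y yi; rewrite J0 ?mul0r//; right.
by apply: eq_bigr => v _; rewrite JE !ffunE.
Qed.

End Transfer.

(** * Gibbs measures on the lattice *)

Section LatticeGibbs.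
Variables (R : realType) (d : nat) (beta : R).
Hypothesis beta0 : 0 <= beta.
Implicit Types (L Q D : {fset Zd d}) (w : Zd d -> bool) (k : Zd d -> R).
Implicit Types (f : (Zd d -> bool) -> R) (x y v : Zd d).

Definition Nb x : {fset Zd d} := [fset y in nbrs x]%fset.

Lemma in_Nb x y : (y \in Nb x) = adj x y.
Proof. by rewrite in_fset /= mem_nbrs. Qed.

Lemma adjC x y : adj x y = adj y x.
Proof. by apply/existsP/existsP => -[i]; rewrite orbC => h; exists i. Qed.

Lemma exbdP L v : reflect (v \notin L /\ exists2 u, u \in L & adj u v) (v \in exbd L).
Proof.
rewrite in_exbd; apply: (iffP andP) => -[vL].
  by move=> /existsP[u uv]; split => //; exists (val u) => //; exact: valP.
by move=> [u uL uv]; split => //; apply/existsP; exists [` uL]%fset.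
Qed.

Lemma sum_fsets (A B : {fset Zd d}) (P Q : pred (Zd d)) (g : Zd d -> R) :
  (forall v, (v \in A) && P v = (v \in B) && Q v) ->
  \sum_(v : A | P (val v)) g (val v) = \sum_(v <- B | Q v) g v.
Proof.
move=> PQ; rewrite -(big_seq_fsetE _ _ P g) -big_filter -[RHS]big_filter.
apply/perm_big/uniq_perm; rewrite ?filter_uniq ?fset_uniq// => v.
by rewrite !mem_filter andbC PQ andbC.
Qed.

Definition coupling L (u v : L) : R := if adj (val u) (val v) then beta else 0.

Definition ext_field L w k (u : L) : R :=
  beta * (\sum_(v : exbd L | adj (val u) (val v)) spin R (w (val v))) + k (val u).

Lemma ext_fieldE L w k (u : L) :
  ext_field w k u = beta * (\sum_(v <- Nb (val u) | v \notin L) spin R (w v)) + k (val u).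
Proof.
rewrite /ext_field; congr (_ * _ + _).
apply: (@sum_fsets _ _ (fun v => adj (val u) v)) => v; rewrite in_Nb.
apply/andP/andP => [[/exbdP[vL _] ->//]|[uv vL]].
by split => //; apply/exbdP; split => //; exists (val u) => //; exact: valP.
Qed.

Definition glue L w (s : spins L) x : bool := oapp (fun u : L => s u) (w x) (insub x).

Lemma glue_in L w (s : spins L) (u : L) : glue w s (val u) = s u.
Proof. by rewrite /glue valK. Qed.

Lemma glue_out L w (s : spins L) x : x \notin L -> glue w s x = w x.
Proof. by move=> xL; rewrite /glue insubN. Qed.

(** Functions of whole lattice configurations, with w filling the outside of L, make nested volumes
    comparable without restriction maps; k stands for H times the random field. *)
Definition GE L w k f : R :=
  Ex (@coupling L) (ext_field w k) (fun s => f (glue w s)).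

Lemma coupling_sym L (u v : L) : coupling u v = coupling v u.
Proof. by rewrite /coupling adjC. Qed.

Lemma coupling_ge0 L (u v : L) : 0 <= coupling u v.
Proof. by rewrite /coupling; case: ifP. Qed.

(** The DLR equation: [Ex_markov] inside L, transported along the inclusion of Q. *)
Lemma GE_markov L Q w k f : (Q `<=` L)%fset ->
  GE L w k f = GE L w k (fun xi => GE Q xi k f).
Proof.
move=> QL; rewrite /GE.
pose i (u : Q) : L := fincl QL u.
have inj_i : injective i by move=> u v /(congr1 val) /= /val_inj.
pose S := [set u : L | val u \in Q]%SET.
have iS (x : L) : (forall u, i u != x) -> x \notin S.
  move=> xi; rewrite inE; apply/negP => xQ.
  by have /negP[] := xi [` xQ]%fset; apply/eqP/val_inj.
have iSi (u : Q) : i u \in S by rewrite inE; exact: (valP u).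
rewrite (Ex_markov _ S _ (@coupling_sym L)); congr Ex; apply/funext => t.
rewrite -(Ex_transfer inj_i (J1 := @coupling Q) (h1 := ext_field (glue w t) k)
  (J2 := inner (@coupling L) S) (h2 := bfield (@coupling L) (ext_field w k) S t)).
  congr Ex; apply/funext => s; congr f; apply/funext => x.
  have [xQ|xQ] := boolP (x \in Q).
    rewrite (_ : x = val [` xQ]%fset)// glue_in ffunE.
    by rewrite -[val [` xQ]%fset]/(val (i [` xQ]%fset)) glue_in mix_in.
  rewrite [RHS]glue_out//; have [xL|xL] := boolP (x \in L); last by rewrite !glue_out.
  by rewrite (_ : x = val [` xL]%fset)// !glue_in mix_out// inE.
move=> s; apply: energy_pullback => //.
- by move=> u v; rewrite /inner !iSi.
- by move=> x y [/iS|/iS] /negPf xS; rewrite /inner xS ?andbF.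
(* The neighbors of u outside Q split into those in L, seen by [bfield], and those outside L, seen
   by [ext_field]. *)
- move=> u; rewrite /bfield iSi !ext_fieldE /= addrAC; congr (_ + _).
  have -> : \sum_(v | v \notin S) coupling (i u) v * spin R (t v) =
     beta * \sum_(v <- Nb (val u) | (v \in L) && (v \notin Q)) spin R (glue w t v).
    rewrite mulr_sumr; transitivity (\sum_(v : L | (val v \notin Q) && adj (val u) (val v))
        beta * spin R (glue w t (val v))).
      rewrite big_mkcondr; apply: eq_big => [v|v _]; first by rewrite inE.
      by rewrite /coupling glue_in; case: ifP; rewrite ?mul0r.
    apply: (@sum_fsets _ _ (fun v => (v \notin Q) && adj (val u) v) _
      (fun v => beta * spin R (glue w t v))) => v.
    by rewrite in_Nb; case: (v \in L); case: (v \in Q); rewrite ?andbF ?andbT.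
  rewrite -mulrDr; congr (_ * _).
  rewrite [RHS](bigID (mem L))/= [RHS]addrC; congr (_ + _).
    apply: eq_big => v; last by move=> vL; rewrite glue_out.
    case: (boolP (v \in L)) => vL; rewrite ?andbF ?andbT//.
    by apply/esym; apply: contra vL; exact: fsubsetP.
  by apply: eq_bigl => v; rewrite andbC.
- by move=> x /iS/negPf xS; rewrite /bfield xS.
Qed.

Definition cincr f := forall xi xi' : Zd d -> bool, (forall x, xi x ==> xi' x) -> f xi <= f xi'.

Lemma le_glue L w w' (s s' : spins L) : (forall x, w x ==> w' x) -> le_conf s s' ->
  forall x, glue w s x ==> glue w' s' x.
Proof.
move=> ww' ss' x; have [xL|xL] := boolP (x \in L); last by rewrite !glue_out.
by rewrite (_ : x = val [` xL]%fset)// !glue_in.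
Qed.

Lemma ler_GE L w w' k k' f : cincr f -> (forall x, w x ==> w' x) ->
  (forall x, k x <= k' x) -> GE L w k f <= GE L w' k' f.
Proof.
move=> fi ww' kk'; rewrite /GE.
apply: (@le_trans _ _ (Ex (@coupling L) (ext_field w k) (fun s => f (glue w' s)))).
  by apply: ler_Ex => s; apply: fi; apply: le_glue => // u; exact: implybb.
apply: ler_Ex_field => [||s t st|u].
- exact: coupling_sym.
- exact: coupling_ge0.
- by apply: fi; apply: le_glue => // x; exact: implybb.
- rewrite lerD// ler_wpM2l//; apply: ler_sum => v _; exact: ler_spin.
Qed.

Lemma GE_cst L w k (a : R) : GE L w k (fun=> a) = a.
Proof. exact: Ex_cst. Qed.

Lemma GED L w k f g : GE L w k (fun xi => f xi + g xi) = GE L w k f + GE L w k g.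
Proof. exact: ExD. Qed.

Lemma GEZ L w k (a : R) f : GE L w k (fun xi => a * f xi) = a * GE L w k f.
Proof. exact: ExZ. Qed.

Lemma GEB L w k f g : GE L w k (fun xi => f xi - g xi) = GE L w k f - GE L w k g.
Proof. exact: ExB. Qed.

Lemma GE_sum (I : Type) (r : seq I) (P : pred I) L w k (F : I -> (Zd d -> bool) -> R) :
  GE L w k (fun xi => \sum_(i <- r | P i) F i xi) = \sum_(i <- r | P i) GE L w k (F i).
Proof. exact: Ex_sum. Qed.

Lemma ler_GE_fun L w k f g : (forall xi, f xi <= g xi) -> GE L w k f <= GE L w k g.
Proof. by move=> fg; apply: ler_Ex => s. Qed.

Definition mg L w k v : R := GE L w k (fun xi => spin R (xi v)).

Definition plus : Zd d -> bool := fun=> true.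
Definition minus : Zd d -> bool := fun=> false.

(** At v outside L it equals 1, so boundary points of S that leave L require no separate treatment
    in the contraction. *)
Definition dd L k v : R := (mg L plus k v - mg L minus k v) / 2.

Lemma cincr_spin v : cincr (fun xi => spin R (xi v)).
Proof. by move=> xi xi' h; exact: ler_spin. Qed.

Lemma mg_minus L w k v : mg L minus k v <= mg L w k v.
Proof. by apply: ler_GE => //; exact: cincr_spin. Qed.

Lemma mg_plus L w k v : mg L w k v <= mg L plus k v.
Proof. by apply: ler_GE => [|x|//]; [exact: cincr_spin|rewrite implybT]. Qed.

Lemma mg_bound L w k v : -1 <= mg L w k v <= 1.
Proof.
apply/andP; split.
  by rewrite -[leLHS](GE_cst L w k); apply: ler_GE_fun => xi; case: (xi v) => /=; lra.
by rewrite -[leRHS](GE_cst L w k); apply: ler_GE_fun => xi; case: (xi v) => /=; lra.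
Qed.

Lemma dd_le1 L k v : dd L k v <= 1.
Proof.
have /andP[_ p1] := mg_bound L plus k v; have /andP[m1 _] := mg_bound L minus k v.
by rewrite /dd; lra.
Qed.

Lemma mg_local L w w' k v : v \in L -> (forall x, x \in exbd L -> w x = w' x) ->
  mg L w k v = mg L w' k v.
Proof.
move=> vL ww'; rewrite /mg /GE.
suff -> : ext_field w k = ext_field w' k :> (L -> R).
  by congr Ex; apply/funext => s; rewrite (_ : v = val [` vL]%fset)// !glue_in.
apply/funext => u; rewrite /ext_field; congr (_ * _ + _).
by apply: eq_bigr => x _; rewrite ww'//; exact: valP.
Qed.

Definition free_corr L x y : R :=
  Ex (@coupling L) (fun=> 0) (fun s => spin R (glue plus s x) * spin R (glue plus s y)).

(** The linear bound [mag_le_corr] for the field that the boundary spin at x exerts on its neighbors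
    in L. *)
Definition wt L v x : R := beta * \sum_(u <- L | adj u x) free_corr L v u.

Definition upd w x b : Zd d -> bool := fun y => if y == x then b else w y.

(* Changing one boundary spin: the remaining boundary spins and the external
   field only diminish its influence. *)
Lemma mg_flip S w k v x : v \in S -> x \in exbd S ->
  mg S (upd w x true) k v - mg S (upd w x false) k v <= 2 * wt S v x.
Proof.
move=> vS /exbdP[xS _].
pose h (u : S) : R := if adj (val u) x then beta else 0.
pose g (u : S) : R := beta * (\sum_(y <- Nb (val u) | (y \notin S) && (y != x)) spin R (w y))
   + k (val u).
have fE b u : ext_field (upd w x b) k u = g u + spin R b * h u.
  rewrite ext_fieldE /g addrAC; congr (_ + _).
  rewrite (bigID (fun y => y == x))/= addrC mulrDr; congr (_ + _).
    congr (_ * _); apply: eq_bigr => y /andP[_ /negPf yx]; by rewrite /upd yx.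
  have -> : \sum_(y <- Nb (val u) | (y \notin S) && (y == x)) spin R (upd w x b y)
     = (adj (val u) x)%:R * spin R b.
    rewrite (eq_bigl (pred1 x)) => [|y /=]; last first.
      by case: eqVneq => [->|]; rewrite ?andbF// xS.
    case: (boolP (adj (val u) x)) => ux; rewrite ?mul1r ?mul0r.
      by rewrite -big_filter filter_pred1_uniq ?in_Nb ?fset_uniq// big_seq1 /upd eqxx.
    rewrite big_seq_cond big_pred0// => y /=; rewrite in_Nb.
    by case: eqVneq => [->|]; rewrite ?andbF ?andbT// (negPf ux).
  by rewrite /h; case: ifP => _; rewrite ?mul1r ?mul0r ?mulr0// mulrC.
pose v' : S := [` vS]%fset.
have mE b : mg S (upd w x b) k v = mag (@coupling S) (fun u => g u + spin R b * h u) v'.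
  rewrite /mg /GE /mag (_ : ext_field _ _ = fun u => g u + spin R b * h u); last first.
    by apply/funext => u; rewrite fE.
  by congr Ex; apply/funext => s; rewrite -[v]/(val v') glue_in.
have h0 u : 0 <= h u by rewrite /h; case: ifP.
rewrite !mE.
have -> : (fun u => g u + spin R true * h u) = fun u => g u + h u.
  by apply/funext => u; rewrite mul1r.
have -> : (fun u => g u + spin R false * h u) = fun u => g u - h u.
  by apply/funext => u; rewrite mulN1r.
apply: (@le_trans _ _ (2 * mag (@coupling S) h v')).
  exact: boundary_influenceT (@coupling_sym S) (@coupling_ge0 S) h0.
rewrite ler_pM2l//.
apply: le_trans (mag_le_corr v' (@coupling_sym S) (@coupling_ge0 S) h0) _.
rewrite /wt mulr_sumr (big_seq_fsetE _ _ (fun u => adj u x)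
  (fun u => beta * free_corr S v u)) /= [leRHS]big_mkcond/=.
apply: ler_sum => u _; rewrite /h; case: ifP => _; last by rewrite mul0r.
rewrite le_eqVlt; apply/orP; left; apply/eqP; rewrite /corr /free_corr; congr (_ * Ex _ _ _).
by apply/funext => s; rewrite -[v]/(val v') !glue_in.
Qed.

Lemma wt_ge0 S v x : v \in S -> 0 <= wt S v x.
Proof.
move=> vS; rewrite mulr_ge0//; rewrite big_seq_cond sumr_ge0// => u /andP[uS _].
have := corr_ge0 [` vS]%fset [` uS]%fset (@coupling_ge0 S).
rewrite /corr /free_corr; congr (_ <= Ex _ _ _); apply/funext => s.
by rewrite -(glue_in plus s [` vS]%fset) -(glue_in plus s [` uS]%fset).
Qed.

Lemma mg_lipschitz S w w' k v : v \in S -> (forall x, w x ==> w' x) ->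
  mg S w' k v - mg S w k v <=
  \sum_(x <- exbd S) wt S v x * (spin R (w' x) - spin R (w x)).
Proof.
move=> vS ww'.
(* Interpolates between w and w', one boundary vertex at a time. *)
pose z (r : seq (Zd d)) y := if y \in r then w' y else w y.
rewrite (@mg_local S w' (z (exbd S))) => [|//|x xS]; last by rewrite /z xS.
suff H (r : seq (Zd d)) : {subset r <= exbd S} -> uniq r ->
    mg S (z r) k v - mg S w k v <= \sum_(x <- r) wt S v x * (spin R (w' x) - spin R (w x)).
  by apply: H => //; exact: fset_uniq.
elim: r => [|x r IH] rS.
  move=> _; rewrite big_nil subr_le0 le_eqVlt; apply/orP; left; apply/eqP.
  by congr mg; apply/funext.
rewrite cons_uniq => /andP[xr ur]; rewrite big_cons.
have {}IH := IH (fun y yr => rS y (mem_behead (s := x :: r) yr)) ur.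
have zE b : w' x = b -> z (x :: r) = upd (z r) x b.
  move=> bE; apply/funext => y; rewrite /z /upd inE.
  by case: eqVneq => [->|].
have zr : z r x = w x by rewrite /z (negPf xr).
have step : mg S (z (x :: r)) k v - mg S (z r) k v <= wt S v x * (spin R (w' x) - spin R (w x)).
  rewrite (zE _ erefl); have := ww' x.
  have same b : w x = b -> upd (z r) x b = z r.
    by move=> wb; apply/funext => y; rewrite /upd; case: eqVneq => // ->; rewrite zr wb.
  case wx : (w x); case w'x : (w' x) => //= _.
  - by rewrite same// !subrr mulr0.
  - rewrite -{2}(same _ wx); apply: le_trans (mg_flip (z r) k vS _) _.
      by apply: rS; rewrite inE eqxx.
    by rewrite opprK mulrC lexx || (rewrite [leRHS]mulrC).
  - by rewrite same// !subrr mulr0.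
by lra.
Qed.

(** The Lipschitz bound makes the weighted boundary spins minus [mg S] increasing in the boundary
    configuration; comparing its means in L under plus and minus, and using the DLR equation, gives
    the claim. *)
Lemma dd_contract S L k v : (S `<=` L)%fset -> v \in S ->
  dd L k v <= \sum_(x <- exbd S) wt S v x * dd L k x.
Proof.
move=> SL vS.
pose f (xi : Zd d -> bool) := \sum_(x <- exbd S) wt S v x * spin R (xi x) - mg S xi k v.
have fi : cincr f.
  move=> xi xi' h; have := mg_lipschitz k vS h.
  under eq_bigr do rewrite mulrBr.
  by rewrite sumrB /f; lra.
have : GE L minus k f <= GE L plus k f by apply: ler_GE => // x; rewrite implybT.
have fE w : GE L w k f = \sum_(x <- exbd S) wt S v x * mg L w k x - mg L w k v.
  rewrite /f GEB GE_sum /mg (GE_markov w k (fun xi => spin R (xi v)) SL); congr (_ - _).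
  by apply: eq_bigr => x _; rewrite GEZ.
rewrite !fE => H.
have -> : \sum_(x <- exbd S) wt S v x * dd L k x =
    2^-1 * (\sum_(x <- exbd S) wt S v x * mg L plus k x -
            \sum_(x <- exbd S) wt S v x * mg L minus k x).
  by rewrite -sumrB mulr_sumr; apply: eq_bigr => x _; rewrite /dd; field.
by rewrite /dd; lra.
Qed.

Definition local_on (X : {fset Zd d}) f := forall xi xi' : Zd d -> bool,
  (forall x, x \in X -> xi x = xi' x) -> f xi = f xi'.

(* The indicator of a local event becomes monotone after adding the number of
   plus spins in its support. *)
Lemma GE_local (X : {fset Zd d}) f L w w' k :
  local_on X f -> (forall xi, 0 <= f xi <= 1) ->
  `|GE L w k f - GE L w' k f| <= 2 * \sum_(x <- X) dd L k x.
Proof.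
move=> fX f01.
pose N (xi : Zd d -> bool) : R := \sum_(x <- X) 2^-1 * (1 + spin R (xi x)).
have NE w0 : GE L w0 k N = \sum_(x <- X) 2^-1 * (1 + mg L w0 k x).
  by rewrite GE_sum; apply: eq_bigr => x _; rewrite GEZ GED GE_cst.
have Ni xi xi' : (forall x, xi x ==> xi' x) ->
    N xi <= N xi' /\ (f xi = f xi' \/ N xi + 1 <= N xi').
  move=> h; have [/hasP[x xX xx']|/hasPn same] := boolP (has (fun x => xi x != xi' x) X).
    suff : N xi + 1 <= N xi' by split; [lra|right].
    rewrite /N !(big_rem x xX)/=; have := h x.
    move: xx'; case: (xi x); case: (xi' x) => //= _ _.
    suff : \sum_(y <- rem x X) 2^-1 * (1 + spin R (xi y))
        <= \sum_(y <- rem x X) 2^-1 * (1 + spin R (xi' y)) by lra.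
    by apply: ler_sum => y _; rewrite ler_pM2l// lerD2l ler_spin.
  have E x : x \in X -> xi x = xi' x by move=> /same; rewrite negbK => /eqP.
  split; last by left; exact: fX.
  by apply: ler_sum => y _; rewrite ler_pM2l// lerD2l ler_spin.
have i1 : cincr (fun xi => N xi + f xi).
  move=> xi xi' h; have [NN [->|N1]] := Ni _ _ h; first by rewrite lerD2r.
  by have := f01 xi; have := f01 xi'; lra.
have i2 : cincr (fun xi => N xi - f xi).
  move=> xi xi' h; have [NN [->|N1]] := Ni _ _ h; first by rewrite lerD2r.
  by have := f01 xi; have := f01 xi'; lra.
have key w0 : `|GE L w0 k f - GE L plus k f| <= \sum_(x <- X) dd L k x.
  have := ler_GE L i1 (w := w0) (w' := plus) (k := k) (k' := k).
  move=> /(_ (fun x => implybT _) (fun x => lexx _)); rewrite !GED => h1.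
  have := ler_GE L i2 (w := w0) (w' := plus) (k := k) (k' := k).
  move=> /(_ (fun x => implybT _) (fun x => lexx _)); rewrite !GEB => h2.
  have h3 : GE L plus k N - GE L w0 k N <= \sum_(x <- X) dd L k x.
    rewrite !NE -sumrB; apply: ler_sum => x _; rewrite /dd.
    by have := mg_minus L w0 k x; lra.
  by rewrite ler_norml; lra.
have := key w; have := key w'; rewrite !ler_norml; lra.
Qed.

End LatticeGibbs.

(** * Exponential decay of the boundary influence *)

Section Decay.
Variables (R : realType) (d : nat).
Implicit Types (L S : {fset Zd d}) (x y z v : Zd d).

Definition dist1 x y : nat := (\sum_(i < d) `|(x 0 i - y 0 i)%R|)%N.

Lemma dist1xx x : dist1 x x = 0%N.
Proof. by rewrite /dist1 big1// => i _; rewrite subrr. Qed.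

Lemma dist1C x y : dist1 x y = dist1 y x.
Proof. by apply: eq_bigr => i _; rewrite -abszN opprB. Qed.

Lemma dist1_triangle x y z : (dist1 x z <= dist1 x y + dist1 y z)%N.
Proof.
rewrite /dist1 -big_split; apply: leq_sum => i _ /=.
by have := leqD_dist (x 0 i) (y 0 i) (z 0 i).
Qed.

Lemma dist1D v x y : dist1 (v + x) (v + y) = dist1 x y.
Proof. by apply: eq_bigr => i _; congr absz; rewrite !mxE; ring. Qed.

Lemma dist1_unitv x (i : 'I_d) : dist1 x (x + unitv i) = 1%N.
Proof.
rewrite /dist1 (bigD1 i)//= big1 => [|j ji]; rewrite !mxE !eqxx ?opprD ?addNKr ?addrA
  ?subrr ?add0r//.
by rewrite (negPf ji).
Qed.

Lemma adj_dist1 x y : adj x y -> dist1 x y = 1%N.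
Proof. by move=> /existsP[i /orP[] /eqP ->]; rewrite ?[dist1 (_ + _) _]dist1C dist1_unitv. Qed.

Lemma adjD v x y : adj (v + x) (v + y) = adj x y.
Proof. by apply: eq_existsb => i; rewrite -!addrA !(inj_eq (addrI v)). Qed.

Lemma dist1_eq0 x y : dist1 x y = 0%N -> x = y.
Proof.
move=> /eqP; rewrite sum_nat_eq0 => /forallP h; apply/rowP => i.
by have := h i; rewrite /= absz_eq0 subr_eq0 => /eqP.
Qed.

Lemma dist1_step x y : x != y -> exists2 y', adj y' y & (dist1 x y').+1 = dist1 x y.
Proof.
move=> xy; have [i xyi] : exists i, x 0 i != y 0 i.
  apply/existsP; apply: contraNT xy; rewrite negb_exists => /forallP h.
  by apply/eqP/rowP => i; have := h i; rewrite negbK => /eqP.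
have step y' : (forall j, j != i -> y' 0 j = y 0 j) ->
    (absz (x 0 i - y' 0 i)%R).+1 = absz (x 0 i - y 0 i)%R -> (dist1 x y').+1 = dist1 x y.
  move=> off on; rewrite /dist1 (bigD1 i)//= [RHS](bigD1 i)//= -on addSn; congr ((_ + _).+1)%N.
  by apply: eq_bigr => j ji; rewrite off.
have [lt|ge] := ltrP (x 0 i) (y 0 i).
  exists (y - unitv i).
    by apply/existsP; exists i; rewrite subrK eqxx.
  apply: step => [j /negPf ji|]; first by rewrite !mxE ji subr0.
  rewrite !mxE !eqxx /=; move: (x 0 i) (y 0 i) lt => a b; lia.
exists (y + unitv i).
  by apply/existsP; exists i; rewrite eqxx orbT.
apply: step => [j /negPf ji|]; first by rewrite !mxE ji addr0.
rewrite !mxE !eqxx /=; move: (x 0 i) (y 0 i) ge xyi => a b; lia.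
Qed.

Variable beta : R.
Hypothesis beta0 : 0 <= beta.

Definition nout S x : R := \sum_(y <- Nb x | y \notin S) 1.

Definition shift v S : {fset Zd d} := [fset (v + x)%R | x in S]%fset.

Lemma in_shift v S x : (x \in shift v S) = (x - v \in S).
Proof.
apply/imfsetP/idP => [[y yS ->]|xS]; first by rewrite addrC addKr.
by exists (x - v) => //; rewrite addrC subrK.
Qed.

Lemma big_shift v S (F : Zd d -> R) (P : pred (Zd d)) :
  \sum_(x <- shift v S | P x) F x = \sum_(x <- S | P (v + x)) F (v + x).
Proof.
rewrite -(big_map (fun x => v + x) P F); apply/perm_big/uniq_perm.
- exact: fset_uniq.
- by rewrite map_inj_uniq ?fset_uniq//; exact: addrI.
move=> x; rewrite in_shift; apply/idP/mapP => [xS|[y yS ->]].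
  by exists (x - v) => //; rewrite addrC subrK.
by rewrite addrC addKr.
Qed.

Lemma Nb_shift v x : Nb (v + x) = shift v (Nb x).
Proof.
apply/fsetP => y; rewrite in_shift !in_Nb -(adjD v x).
by rewrite [v + (y - v)]addrC subrK.
Qed.

Lemma nout_shift v S x : nout (shift v S) (v + x) = nout S x.
Proof.
rewrite /nout Nb_shift big_shift; apply: eq_bigl => y.
by rewrite in_shift addrC addKr.
Qed.

Lemma free_corr_transfer (V : finType) (J : V -> V -> R) S (i : S -> V) (u v : S) :
  injective i -> (forall a b, J (i a) (i b) = coupling beta a b) ->
  (forall p q, (forall a, i a != p) \/ (forall a, i a != q) -> J p q = 0) ->
  corr J (i u) (i v) = free_corr beta S (val u) (val v).
Proof.
move=> inj JE J0; rewrite /corr /free_corr.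
rewrite -(Ex_transfer inj (J2 := J) (h2 := fun=> 0)).
  by congr Ex; apply/funext => s; rewrite !glue_in !ffunE.
by move=> s; apply: energy_pullback.
Qed.

Lemma free_corr_shift v S x y : x \in S -> y \in S ->
  free_corr beta (shift v S) (v + x) (v + y) = free_corr beta S x y.
Proof.
move=> xS yS.
have shP u : u \in S -> v + u \in shift v S by rewrite in_shift addrC addKr.
pose i (u : S) : shift v S := [` shP _ (valP u)]%fset.
have inj : injective i by move=> a b /(congr1 val) /= /addrI /val_inj.
rewrite -[RHS](@free_corr_transfer _ (@coupling _ _ beta (shift v S)) S i
  [` xS]%fset [` yS]%fset)//.
- rewrite /free_corr /corr; congr Ex; apply/funext => s.
  by rewrite -(glue_in (@plus d) s (i [` xS]%fset)) -(glue_in (@plus d) s (i [` yS]%fset)).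
- by move=> a b; rewrite /coupling adjD.
- move=> a b; have surj (c : shift v S) : exists u, i u = c.
    have := valP c; rewrite in_shift => cS; exists [` cS]%fset; apply/val_inj => /=.
    by rewrite addrC subrK.
  by move=> [] h; [have [u uE] := surj a|have [u uE] := surj b]; have := h u; rewrite uE eqxx.
Qed.

Definition phi S x : R := \sum_(u <- S) nout S u * free_corr beta S x u.

Lemma phi_shift v S : 0 \in S -> phi (shift v S) v = phi S 0.
Proof.
move=> S0; rewrite /phi big_shift big_seq [RHS]big_seq; apply: eq_bigr => u uS.
by rewrite nout_shift -{2}[v]addr0 free_corr_shift.
Qed.

Lemma sum_wt S x : \sum_(y <- exbd S) wt beta S x y = beta * phi S x.
Proof.
rewrite /wt -mulr_sumr; congr (_ * _).
under eq_bigr do rewrite big_mkcond.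
rewrite exchange_big /phi big_seq [RHS]big_seq; apply: eq_bigr => u uS /=.
rewrite -big_mkcond /nout mulr_suml.
under [RHS]eq_bigr do rewrite mul1r.
rewrite (big_seq_fsetE _ (exbd S) (fun y => adj u y) (fun=> free_corr beta S x u)).
apply: (@sum_fsets _ _ _ _ (fun y => adj u y)) => y; rewrite in_Nb.
apply/andP/andP => [[/exbdP[yS _] ->//]|[uy yS]].
by split => //; apply/exbdP; split => //; exists u.
Qed.

Lemma dd_decay S : 0 \in S -> beta * phi S 0 <= 2^-1 ->
  exists r : nat, forall L k v j,
    (forall y, (dist1 v y <= j * r.+1)%N -> y \in L) -> dd beta L k v <= 2^-1 ^+ j.
Proof.
move=> S0 crit; pose r := (\sum_(x <- S) dist1 0 x)%N; exists r => L k v j.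
have rS x : x \in S -> (dist1 0 x <= r)%N.
  by move=> xS; rewrite /r (big_rem x xS)/= leq_addr.
elim: j v => [|j IH] v vL; first by rewrite expr0 dd_le1.
have vS : v \in shift v S by rewrite in_shift subrr.
have dS x : x \in shift v S -> (dist1 v x <= r)%N.
  by rewrite in_shift => /rS; rewrite -(dist1D v) addr0 [v + (x - v)]addrC subrK.
have SL : (shift v S `<=` L)%fset.
  apply/fsubsetP => x /dS xr; apply: vL; apply: leq_trans xr _.
  by rewrite mulSn; apply: leq_trans (leq_addr _ _); exact: leqnSn.
apply: le_trans (dd_contract beta0 k SL vS) _.
apply: (@le_trans _ _ (\sum_(x <- exbd (shift v S)) wt beta (shift v S) v x * 2^-1 ^+ j)).
  rewrite big_seq [leRHS]big_seq; apply: ler_sum => x /exbdP[_ [u /dS uS ux]].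
  rewrite ler_wpM2l ?wt_ge0//; apply: IH => y xy; apply: vL.
  apply: leq_trans (dist1_triangle v x y) _; rewrite mulSn; apply: leq_add => //.
  apply: leq_trans (dist1_triangle v u x) _.
  by rewrite (adj_dist1 ux) addn1.
rewrite -mulr_suml sum_wt phi_shift// exprS ler_wpM2r//.
Qed.

End Decay.

(** * From the Gibbs measures of the statement to the finite size criterion *)

Section Criterion.
Variables (R : realType) (d : nat).
Implicit Types (L S D : {fset Zd d}) (beta : R) (w : Zd d -> bool) (k : Zd d -> R).

Lemma log_weightE L (eta : spins (exbd L)) beta H (h : L -> R) s :
  log_weight eta beta H h s = energy (coupling beta (L := L))
    (fun u => beta * (\sum_(v : exbd L | adj (val u) (val v)) spin R (eta v)) + H * h u) s.
Proof.
rewrite /log_weight /energy -addrA; congr (_ + _).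
  rewrite mulrCA; congr (_ * _); rewrite mulr_sumr; apply: eq_bigr => u _.
  rewrite mulr_sumr big_mkcond; apply: eq_bigr => v _; rewrite /coupling.
  by case: ifP; rewrite ?mul0r.
rewrite !mulr_sumr -big_split; apply: eq_bigr => u _ /=.
rewrite mulrDl; congr (_ + _); last exact: mulrA.
by rewrite -mulrA mulr_suml; congr (_ * _); apply: eq_bigr => v _; rewrite mulrC.
Qed.

Lemma gibbs_sum L (eta : spins (exbd L)) beta H (h : L -> R) w k (F : spins L -> R) :
  (forall v : exbd L, w (val v) = eta v) -> (forall u : L, k (val u) = H * h u) ->
  \sum_s gibbs eta beta H h s * F s =
  Ex (coupling beta (L := L)) (ext_field beta w k) F.
Proof.
move=> wE kE; rewrite /Ex mulr_suml; apply: eq_bigr => s _; rewrite /gibbs.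
have WE t : expR (log_weight eta beta H h t) =
    weight (coupling beta (L := L)) (ext_field beta w k) t.
  rewrite log_weightE /weight.
  rewrite (_ : (fun u => _) = ext_field beta w k)//; apply/funext => u.
  by rewrite /ext_field kE; congr (_ * _ + _); apply: eq_bigr => v _; rewrite wE.
rewrite WE (eq_bigr _ (fun t _ => WE t)) mulrAC.
by [].
Qed.

Lemma gibbs_lawE L D (eta : spins (exbd L)) beta H (h : L -> R) w k (A : {set spins D}) :
  (D `<=` L)%fset ->
  (forall v : exbd L, w (val v) = eta v) -> (forall u : L, k (val u) = H * h u) ->
  gibbs_law eta beta H h A =
  GE beta L w k (fun xi => ([ffun v : D => xi (val v)] \in A)%:R).
Proof.
move=> DL wE kE; rewrite /GE -(gibbs_sum beta _ wE kE) /gibbs_law big_mkcond.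
apply: eq_bigr => s _.
have -> : [ffun v : D => glue w s (val v)] = restr D s.
  apply/ffunP => v; rewrite !ffunE /spin_at /glue.
  have vL : val v \in L := fsubsetP DL _ (valP v).
  by rewrite (insubT (fun x => x \in L) vL).
by case: ifP => _; rewrite ?mulr1 ?mulr0.
Qed.

Definition zero_field : Zd d -> R := fun=> 0.

Lemma plus_magnetizationE beta L : 0 \in L ->
  plus_magnetization beta L = mg beta L (@plus d) zero_field 0.
Proof.
move=> L0; rewrite /plus_magnetization /mg /GE.
rewrite -(@gibbs_sum L (plus_bc L) beta 0 (fun=> 0) (@plus d) zero_field).
- by apply: eq_bigr => s _; rewrite mulrC.
- by move=> v; rewrite ffunE.
- by move=> u; rewrite mul0r.
Qed.

Lemma plus_magnetization_mono beta L L' : 0 <= beta -> 0 \in L -> (L `<=` L')%fset ->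
  plus_magnetization beta L' <= plus_magnetization beta L.
Proof.
move=> b0 L0 LL'; have L'0 := fsubsetP LL' _ L0.
rewrite !plus_magnetizationE// {1}/mg (GE_markov _ _ _ _ LL').
rewrite -[leRHS](GE_cst beta L' (@plus d) zero_field).
by apply: ler_GE_fun => xi; exact: mg_plus.
Qed.

(** The plus magnetization decreases in L once 0 is in L, so the net converges to its infimum. *)
Lemma spontaneous_lb beta (e : R) : 0 <= beta ->
  (forall L, 0 \in L -> e <= plus_magnetization beta L) ->
  e <= spontaneous_magnetization d beta.
Proof.
move=> b0 lb; pose X := [set plus_magnetization beta L | L in [set L : {fset Zd d} | 0 \in L]].
have X0 : X !=set0.
  exists (plus_magnetization beta [fset (0 : Zd d)]%fset).
  by exists [fset (0 : Zd d)]%fset; rewrite //= inE.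
have Xlb : lbound X e by move=> _ [L /= L0 <-]; exact: lb.
have Xinf : has_inf X by split => //; exists e.
have PF : ProperFilter (@totally (Zd d)) := totally_filter.
suff cv : (fun L : {fset Zd d} => plus_magnetization beta L) @ totally --> inf X.
  by rewrite /spontaneous_magnetization (cvg_lim _ cv)//; exact: lb_le_inf.
apply/cvgrPdist_le => eps eps0.
have [_ [L0 /= L00 <-] lt] := inf_adherent eps0 Xinf.
exists L0 => // L /= LL0.
have L0' : 0 \in L := fsubsetP LL0 _ L00.
have h1 : inf X <= plus_magnetization beta L.
  by apply: ge_inf; [case: Xinf|exists L].
rewrite distrC ger0_norm ?subr_ge0// lerBlDl.
exact: le_trans (plus_magnetization_mono b0 L00 LL0) (ltW lt).
Qed.

Lemma phi_mono beta b S : 0 <= beta -> beta <= b -> 0 \in S -> phi beta S 0 <= phi b S 0.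
Proof.
move=> b0 bb S0; rewrite /phi big_seq [leRHS]big_seq; apply: ler_sum => u uS.
rewrite ler_wpM2l//; first by rewrite sumr_ge0.
have E c : free_corr c S 0 u = corr (coupling c (L := S)) [` S0]%fset [` uS]%fset.
  rewrite /corr /free_corr; congr Ex; apply/funext => s.
  by rewrite -(glue_in (@plus d) s [` S0]%fset) -(glue_in (@plus d) s [` uS]%fset).
rewrite !E; apply: ler_corr => v v'; first exact: coupling_ge0.
by rewrite /coupling; case: ifP.
Qed.

(* Otherwise all the phi would be bounded below on a whole interval above beta,
   and magb_growth would give spontaneous magnetization below beta_c. *)
Theorem finite_size_criterion beta : 0 <= beta -> (beta%:E < beta_c R d)%E ->
  exists2 S : {fset Zd d}, 0 \in S & beta * phi beta S 0 <= 2^-1.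
Proof.
move=> b0 bc.
have [b' bb' b'c] : exists2 b', beta < b' & (b'%:E < beta_c R d)%E.
  case: (beta_c R d) bc => [b1|_|//]; last by exists (beta + 1); rewrite ?ltry ?ltrDl.
  by rewrite lte_fin => lt; exists ((beta + b1) / 2); rewrite ?lte_fin; lra.
have b'0 : 0 <= b' by lra.
(* Small enough that phi < c forces beta phi <= 1/2, and still positive. *)
pose c : R := (2 * (b' + 1))^-1.
have c0 : 0 < c by rewrite invr_gt0; lra.
have [[b [S [bb S0 lt]]]|none] :=
    pselect (exists b S, [/\ beta <= b <= b', 0 \in S & phi b S 0 < c]).
  exists S => //; have /andP[b1 b2] := bb.
  have := phi_mono b0 b1 S0 => le.
  apply: (@le_trans _ _ (beta * c)); first by rewrite ler_wpM2l// ltW// (le_lt_trans le).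
  rewrite /c invfM mulrCA ler_piMr// ler_pdivrMr; lra.
have {none}all_ge b S : beta <= b <= b' -> 0 \in S -> c <= phi b S 0.
  by move=> bb S0; rewrite leNgt; apply/negP => lt; apply: none; exists b, S.
pose e := 1 - expR (- (c * (b' - beta))).
have e0 : 0 < e by rewrite subr_gt0 -expR0 ltr_expR oppr_lt0 mulr_gt0// subr_gt0.
suff le : e <= spontaneous_magnetization d b'.
  have : (beta_c R d <= b'%:E)%E.
    by apply: ereal_inf_lbound; exists b' => //; split => //; exact: lt_le_trans le.
  by rewrite leNgt b'c.
apply: spontaneous_lb => // L L0.
pose o : L := [` L0]%fset.
(* Couplings of unit strength, so that the parameter of [magb] is the inverse temperature. *)
pose J (u v : L) : R := (adj (val u) (val v))%:R.
pose n (u : L) : R := \sum_(v : exbd L | adj (val u) (val v)) 1.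
have sJ u v : J u v = J v u by rewrite /J adjC.
have J0 u v : 0 <= J u v by rewrite ler0n.
have n0 u : 0 <= n u by rewrite sumr_ge0.
have mE : plus_magnetization b' L = magb J n o b'.
  rewrite plus_magnetizationE// /mg /GE /magb /mag.
  have -> : bJ J b' = coupling b' (L := L).
    by apply/funext => u; apply/funext => v; rewrite /bJ /J /coupling;
      case: ifP; rewrite ?mulr1 ?mulr0.
  have -> : bn n b' = ext_field b' (@plus d) zero_field.
    by apply/funext => u; rewrite /bn /n /ext_field addr0.
  by congr Ex; apply/funext => s; rewrite -(glue_in (@plus d) s o).
rewrite mE /e lerBlDr -lerBlDl; apply: magb_growth => // [|b T bb oT]; first exact: ltW.
pose S := [fset val u | u in T]%fset.
have ST (u : L) : (val u \in S) = (u \in T).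
  apply/imfsetP/idP => [[v vT /val_inj ->]//|uT]; by exists u.
have SL : (S `<=` L)%fset by apply/fsubsetP => _ /imfsetP[u _ ->]; exact: valP.
have S0 : 0 \in S by rewrite -[0]/(val o) ST.
apply: le_trans (all_ge b S bb S0) _.
rewrite le_eqVlt; apply/orP; left; apply/eqP; rewrite /phi.
transitivity (\sum_(u <- L | u \in S) nout R S u * free_corr b S 0 u).
  rewrite -[RHS]big_filter; apply/perm_big/uniq_perm; rewrite ?filter_uniq ?fset_uniq// => u.
  by rewrite mem_filter; case: (boolP (u \in S)) => //= /(fsubsetP SL) ->.
rewrite (big_seq_fsetE _ L (fun u => u \in S)).
apply: eq_big => [u|u]; first by rewrite ST.
move=> uS; congr (_ * _).
  (* Neighbors outside S are either outside L, counted by n, or in L but not in T. *)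
  rewrite /nS /nout (bigID (mem L))/= addrC; congr (_ + _).
    rewrite /n; apply/esym.
    apply: (@sum_fsets _ _ _ _ (fun v => adj (val u) v) _ (fun=> 1)) => v; rewrite in_Nb.
    apply/andP/andP => [[/exbdP[vL _] uv]|[uv /andP[vS vL]]].
      by split => //; rewrite vL andbT; apply: contra vL; exact: fsubsetP.
    by split => //; apply/exbdP; split => //; exists (val u) => //; exact: valP.
  transitivity (\sum_(v : L | (val v \notin S) && adj (val u) (val v)) (1 : R)).
    apply/esym; apply: (@sum_fsets _ _ _ _ (fun v => (v \notin S) && adj (val u) v) _
      (fun=> 1)) => v; rewrite in_Nb.
    by case: (v \in L); case: (v \in S); rewrite ?andbF ?andbT.
  rewrite big_mkcondr; apply: eq_big => [v|v _]; first by rewrite ST.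
  by rewrite /J; case: ifP.
pose i (x : S) : L := fincl SL x.
have u' : val u \in S by [].
rewrite -[0]/(val [` S0]%fset) -[val u]/(val [` u']%fset).
rewrite -(free_corr_transfer (J := fun u v => b * inner J T u v) (i := i)).
- by congr corr; apply/val_inj.
- by move=> x y /(congr1 val) /= /val_inj.
- move=> x y; have iT z : i z \in T by rewrite -ST; exact: (valP z).
  by rewrite /inner !iT /J /coupling /=; case: ifP; rewrite ?mulr1 ?mulr0.
move=> p q; have iT z : (forall a, i a != z) -> z \notin T.
  move=> iz; rewrite -ST; apply/negP => zS.
  by have /negP[] := iz [` zS]%fset; apply/eqP/val_inj.
by move=> [/iT|/iT] /negPf zT; rewrite /inner zT ?andbF mulr0.
Qed.

End Criterion.

(** * Geometry of the boundary *)

Section Geometry.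
Variables (R : realType) (d : nat).
Implicit Types (L : {fset Zd d}) (p x y z : Zd d) (i j : 'I_d) (a b : int).

Definition setc p i a : Zd d := \row_j (if j == i then a else p 0 j).

Lemma setcE p i a j : setc p i a 0 j = if j == i then a else p 0 j.
Proof. by rewrite mxE. Qed.

Lemma setc_id p i : setc p i (p 0 i) = p.
Proof. by apply/rowP => j; rewrite setcE; case: eqP => // ->. Qed.

Lemma adj_setc p i a : adj (setc p i a) (setc p i (a + 1)).
Proof.
apply/existsP; exists i; apply/orP; left; apply/eqP/rowP => j.
by rewrite !mxE eqxx /=; case: eqP => _; rewrite ?addr0.
Qed.

(** Walking back from the far end towards p, the last vertex before L is entered is a boundary
    point. *)
Lemma segment_exit L p i a : p \in L -> setc p i a \notin L ->
  exists b, [/\ setc p i b \in exbd L, b != p 0 i &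
    (p 0 i <= b <= a) || (a <= b <= p 0 i)].
Proof.
move=> pL; move: {2}(absz (a - p 0 i)%R) (leqnn (absz (a - p 0 i)%R)) => n.
elim: n a => [|n IH] a an aL.
  have ap : a = p 0 i by move: (p 0 i) an => c an; lia.
  by move: aL; rewrite ap setc_id pL.
have [lt|gt|ap] := ltgtP (p 0 i) a.
- have [a'L|a'L] := boolP (setc p i (a - 1) \in L).
    exists a; split; [|lia|lia].
    apply/exbdP; split => //; exists (setc p i (a - 1)) => //.
    by rewrite -{2}(subrK 1 a) adj_setc.
  have [|b [b1 b2 b3]] := IH _ _ a'L; first by move: (p 0 i) an lt => c an lt; lia.
  by exists b; split => //; move: (p 0 i) lt b3 => c lt b3; lia.
- have [a'L|a'L] := boolP (setc p i (a + 1) \in L).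
    exists a; split; [|lia|lia].
    by apply/exbdP; split => //; exists (setc p i (a + 1)) => //; rewrite adjC adj_setc.
  have [|b [b1 b2 b3]] := IH _ _ a'L; first by move: (p 0 i) an gt => c an gt; lia.
  by exists b; split => //; move: (p 0 i) gt b3 => c gt b3; lia.
by move: aL; rewrite -ap setc_id pL.
Qed.

Lemma exists_outside L (i : 'I_d) : exists y, y \notin L.
Proof.
apply: contrapT => /forallNP all_in.
pose s := [seq setc 0 i (Posz t) | t <- iota 0 (#|` L|).+1].
have us : uniq s.
  rewrite map_inj_uniq ?iota_uniq// => t t' /rowP/(_ i).
  by rewrite !setcE eqxx => -[].
have : {subset s <= L}.
  by move=> y _; apply/negPn/negP; exact: all_in.
by move=> /(uniq_leq_size us); rewrite size_map size_iota ltnn.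
Qed.

(** A nearest vertex outside L: its neighbor one step closer to x lies in L by minimality. *)
Lemma nearest_exbd L x (i : 'I_d) : x \in L ->
  exists2 y, y \in exbd L & forall z, (dist1 x z < dist1 x y)%N -> z \in L.
Proof.
move=> xL; pose P n := `[< exists y, y \notin L /\ dist1 x y = n >].
have exP : exists n, P n.
  by have [y yL] := exists_outside L i; exists (dist1 x y); apply/asboolP; exists y.
have [y [yL yn]] : exists y, y \notin L /\ dist1 x y = ex_minn exP.
  by case: ex_minnP => n /asboolP.
have near z : (dist1 x z < dist1 x y)%N -> z \in L.
  rewrite yn; case: ex_minnP => n _ nmin; apply: contraTT => zL.
  by rewrite -leqNgt; apply: nmin; apply/asboolP; exists z.
exists y => //; have xy : x != y by apply: contraNneq yL => <-.
have [y' y'y dE] := dist1_step xy.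
by apply/exbdP; split => //; exists y' => //; apply: near; rewrite -dE.
Qed.

Lemma eucl_le_dist1 x y : eucl_dist R x y <= (dist1 x y)%:R.
Proof.
rewrite /eucl_dist /dist1 natr_sum.
have S0 : 0 <= \sum_(i < d) (absz (x 0 i - y 0 i)%R)%:R :> R by rewrite sumr_ge0.
rewrite -[leRHS]ger0_norm// -sqrtr_sqr ler_wsqrtr// expr2 mulr_suml.
apply: ler_sum => i _; rewrite -[_ ^+ 2]ger0_norm ?sqr_ge0// normrX -intr_norm.
rewrite -natr_absz expr2 ler_wpM2l//.
by rewrite (bigD1 i)//= lerDl sumr_ge0.
Qed.

Lemma coord_le_eucl x y i : (absz (x 0 i - y 0 i)%R)%:R <= eucl_dist R x y.
Proof.
rewrite /eucl_dist natr_absz intr_norm -sqrtr_sqr ler_wsqrtr//.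
by rewrite (bigD1 i)//= lerDl sumr_ge0// => j _; exact: sqr_ge0.
Qed.

Lemma eucl_ge0 x y : 0 <= eucl_dist R x y.
Proof. exact: sqrtr_ge0. Qed.

Lemma eucl_xx x : eucl_dist R x x = 0.
Proof. by rewrite /eucl_dist big1 ?sqrtr0// => i _; rewrite subrr expr0n. Qed.

End Geometry.

(** * Two exits from a finite set in the plane *)

Section Plane.
Implicit Types (L D : {fset Zd 2}) (u x y : Zd 2).

Lemma Zd2P (i j : 'I_2) x y : i != j -> x 0 i = y 0 i -> x 0 j = y 0 j -> x = y.
Proof.
move=> ij xi xj; apply/rowP => k.
suff : (k == i) || (k == j) by case/orP => /eqP ->.
by move: i j k ij {xi xj} => [[|[|//]] ?] [[|[|//]] ?] [[|[|//]] ?].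
Qed.

(** The two axis-parallel paths to y coincide here, so the second one is shifted by 1 in direction
    j, whence the 1 in the maximum. It leaves D because y, not being in [exbd D], has no neighbor in
    D. *)
Lemma two_exits_aligned D u y (i j : 'I_2) : i != j -> u \in D -> y \notin D ->
  y \notin exbd D -> u 0 j = y 0 j ->
  exists x1 x2, [/\ x1 \in exbd D, x2 \in exbd D, x1 != x2 &
   forall k, (absz (x1 0 k - y 0 k)%R <= maxn 1 (absz (u 0 i - y 0 i)%R))%N /\
             (absz (x2 0 k - y 0 k)%R <= maxn 1 (absz (u 0 i - y 0 i)%R))%N].
Proof.
move=> ij uD yD yb uy; have ji : (j == i) = false by rewrite eq_sym (negPf ij).
have yE : y = setc u i (y 0 i).
  by apply: (Zd2P ij); rewrite setcE ?eqxx ?ji.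
have [b [bX bu bb]] : exists b, [/\ setc u i b \in exbd D, b != u 0 i &
    (u 0 i <= b <= y 0 i) || (y 0 i <= b <= u 0 i)].
  by apply: segment_exit => //; rewrite -yE.
pose t := setc y j (y 0 j + 1).
have tD : t \notin D.
  apply: contra yb => tD; apply/exbdP; split => //; exists t => //.
  by rewrite adjC -{1}(setc_id y j) adj_setc.
pose c := setc u j (u 0 j + 1).
have k2 (k : 'I_2) : k = i \/ k = j.
  by move: i j k ij {ji uy yE bX bu bb t tD c} => [[|[|//]] ?] [[|[|//]] ?] [[|[|//]] ?] //= _;
    (by left; apply/val_inj) || (by right; apply/val_inj).
have [cD|cD] := boolP (c \in D); last first.
  exists (setc u i b), c; split => //.
  - apply/exbdP; split => //; exists u => //.
    by rewrite -{1}(setc_id u j) adj_setc.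
  - apply/negP => /eqP/rowP/(_ i); rewrite !setcE eqxx (negPf ij) => bu'.
    by rewrite bu' eqxx in bu.
  - move=> k; case: (k2 k) => ->; rewrite !setcE ?eqxx ?ji ?(negPf ij) ?uy;
    move: (u 0 i) (y 0 i) (y 0 j) bb bu => U Y W *; lia.
have [b' [b'X b'u b'b]] : exists b', [/\ setc c i b' \in exbd D, b' != c 0 i &
    (c 0 i <= b' <= y 0 i) || (y 0 i <= b' <= c 0 i)].
  apply: segment_exit => //; rewrite (_ : setc c i (y 0 i) = t)//.
  by apply: (Zd2P ij); rewrite !setcE ?eqxx ?ji ?(negPf ij) ?uy// eqxx.
exists (setc u i b), (setc c i b'); split => //.
  apply/negP => /eqP/rowP/(_ j); rewrite !setcE ji eqxx.
  by move: (u 0 j) => U; lia.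
move: b'b b'u; rewrite setcE (negPf ij) => b'b b'u.
move=> k; case: (k2 k) => ->; rewrite !setcE ?eqxx ?ji ?(negPf ij) ?eqxx ?uy;
move: (u 0 i) (y 0 i) (y 0 j) bb bu b'b b'u => U Y W *; lia.
Qed.

(* Two lattice paths from u to y with no common vertex other than the
   endpoints leave D at two different points. *)
Lemma two_exits D u y : u \in D -> y \notin D -> y \notin exbd D ->
  exists x1 x2, [/\ x1 \in exbd D, x2 \in exbd D, x1 != x2 &
   forall k, (absz (x1 0 k - y 0 k)%R <= maxn 1 (dist1 u y))%N /\
             (absz (x2 0 k - y 0 k)%R <= maxn 1 (dist1 u y))%N].
Proof.
move=> uD yD yb; pose i : 'I_2 := ord0; pose j : 'I_2 := ord_max.
have ij : i != j by [].
have ji : j != i by [].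
have dE : dist1 u y = (absz (u 0 i - y 0 i)%R + absz (u 0 j - y 0 j)%R)%N.
  rewrite /dist1 big_ord_recl big_ord1; congr (_ + absz (u 0 _ - y 0 _)%R)%N;
  exact/val_inj.
have [uyj|uyj] := eqVneq (u 0 j) (y 0 j).
  have [x1 [x2 [h1 h2 h3 h4]]] := two_exits_aligned ij uD yD yb uyj.
  exists x1, x2; split => // k; have [a1 a2] := h4 k.
  by move: (absz (x1 _ _ - _)%R) (absz (x2 _ _ - _)%R) a1 a2 => *; rewrite dE; lia.
have [uyi|uyi] := eqVneq (u 0 i) (y 0 i).
  have [x1 [x2 [h1 h2 h3 h4]]] := two_exits_aligned ji uD yD yb uyi.
  exists x1, x2; split => // k; have [a1 a2] := h4 k.
  by move: (absz (x1 _ _ - _)%R) (absz (x2 _ _ - _)%R) a1 a2 => *; rewrite dE; lia.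
have k2 (k : 'I_2) : k = i \/ k = j.
  by move: k => [[|[|//]] ?]; [left|right]; apply/val_inj.
pose c := setc u i (y 0 i); pose c' := setc u j (y 0 j).
have jF : (j == i) = false by [].
have iF : (i == j) = false by [].
(* Exit on the path through the corner c. The disjunction records the leg on which it lies, which is
   what separates x1 from x2. *)
have [x1 [x1b x1c x1d]] : exists x1, [/\ x1 \in exbd D,
    (x1 0 j = u 0 j /\ x1 0 i != u 0 i) \/ (x1 0 i = y 0 i /\ x1 0 j != u 0 j) &
    forall k, (absz (x1 0 k - y 0 k)%R <= absz (u 0 k - y 0 k)%R)%N].
  have [cD|cD] := boolP (c \in D).
    have [|b [bX bu bb]] := @segment_exit _ D c j (y 0 j) cD.
      rewrite (_ : setc c j _ = y)//; apply: (Zd2P ij); rewrite !setcE ?iF ?eqxx//.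
    move: bu bb; rewrite setcE jF => bu bb.
    exists (setc c j b); split => //.
      by right; rewrite !setcE iF !eqxx.
    move=> k; case: (k2 k) => ->; rewrite !setcE ?iF ?jF ?eqxx;
    move: (u 0 i) (y 0 i) (u 0 j) (y 0 j) bb bu => U Y W X *; lia.
  have [b [bX bu bb]] := segment_exit uD cD.
  exists (setc u i b); split => //.
    by left; rewrite !setcE jF !eqxx.
  move=> k; case: (k2 k) => ->; rewrite !setcE ?iF ?jF ?eqxx;
  move: (u 0 i) (y 0 i) (u 0 j) (y 0 j) bb bu => U Y W X *; lia.
have [x2 [x2b x2c x2d]] : exists x2, [/\ x2 \in exbd D,
    (x2 0 i = u 0 i /\ x2 0 j != u 0 j) \/ (x2 0 j = y 0 j /\ x2 0 i != u 0 i) &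
    forall k, (absz (x2 0 k - y 0 k)%R <= absz (u 0 k - y 0 k)%R)%N].
  have [cD|cD] := boolP (c' \in D).
    have [|b [bX bu bb]] := @segment_exit _ D c' i (y 0 i) cD.
      rewrite (_ : setc c' i _ = y)//; apply: (Zd2P ij); rewrite !setcE ?jF ?eqxx//.
    move: bu bb; rewrite setcE iF => bu bb.
    exists (setc c' i b); split => //.
      by right; rewrite !setcE jF !eqxx.
    move=> k; case: (k2 k) => ->; rewrite !setcE ?iF ?jF ?eqxx;
    move: (u 0 i) (y 0 i) (u 0 j) (y 0 j) bb bu => U Y W X *; lia.
  have [b [bX bu bb]] := segment_exit uD cD.
  exists (setc u j b); split => //.
    by left; rewrite !setcE iF !eqxx.
  move=> k; case: (k2 k) => ->; rewrite !setcE ?iF ?jF ?eqxx;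
  move: (u 0 i) (y 0 i) (u 0 j) (y 0 j) bb bu => U Y W X *; lia.
exists x1, x2; split => //.
  apply/negP => /eqP x12; rewrite -x12 in x2c.
  case: x1c x2c => -[e1 n1] [[e2 n2]|[e2 n2]].
  - by rewrite e2 eqxx in n1.
  - by rewrite -e1 e2 eqxx in uyj.
  - by rewrite -e2 e1 eqxx in uyi.
  - by rewrite -(Zd2P ij e1 e2) x1b in yb.
move=> k; have := x1d k; have := x2d k; rewrite !leq_max dE; case: (k2 k) => ->;
move: (absz (u 0 i - y 0 i)%R) (absz (u 0 j - y 0 j)%R) => A B *; split; lia.
Qed.

End Plane.

(** * Weak mixing *)

Section WeakMixing.
Variables (R : realType) (beta : R) (r : nat).
Hypothesis beta0 : 0 <= beta.
Hypothesis decay : forall (L : {fset Zd 2}) (k : Zd 2 -> R) v j,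
  (forall y, (dist1 v y <= j * r.+1)%N -> y \in L) -> dd beta L k v <= 2^-1 ^+ j.
Implicit Types (L D : {fset Zd 2}) (x y : Zd 2) (k : Zd 2 -> R).

Definition rate : R := ln 2 / r.+1%:R.

Lemma rate_gt0 : 0 < rate.
Proof. by rewrite divr_gt0// ln_gt0// ltr1n. Qed.

(** Rounding the quotient down costs at most one halving, hence the factor 2. *)
Lemma half_expn (n : nat) : 2^-1 ^+ (n %/ r.+1) <= 2 * expR (- (rate * n.+1%:R)) :> R.
Proof.
have two : 2 = expR (ln 2) :> R by rewrite lnK// posrE.
rewrite {1 2}two -expRN -expRM_natl -expRD ler_expR mulrN -subr_ge0.
have -> : ln 2 - rate * n.+1%:R - - ((n %/ r.+1)%:R * ln 2)
  = rate * ((n %/ r.+1).+1 * r.+1)%:R - rate * n.+1%:R :> R.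
  by rewrite /rate natrM -[(n %/ r.+1).+1%:R]natr1; field; rewrite addrC natr1 pnatr_eq0.
rewrite -mulrBr mulr_ge0 ?(ltW rate_gt0)// subr_ge0 ler_nat.
exact: ltn_ceil.
Qed.

Lemma dd_ball L k x n : (forall y, (dist1 x y <= n)%N -> y \in L) ->
  dd beta L k x <= 2 * expR (- (rate * n.+1%:R)).
Proof.
move=> xL; apply: le_trans (half_expn n); apply: decay => y xy.
by apply: xL; apply: leq_trans xy _; exact: leq_trunc_div.
Qed.

(** The nearest boundary point suffices: the ball with radius one less than its distance lies in L,
    and [dd_ball] restores that one. *)
Lemma dd_exp L k x : x \in L ->
  dd beta L k x <= \sum_(y <- exbd L) 2 * expR (- (rate * eucl_dist R x y)).
Proof.
move=> xL; have [y yX near] := nearest_exbd ord0 xL.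
rewrite (big_rem y yX)/= -[leLHS]addr0 lerD//; last first.
  by apply: sumr_ge0 => z _; rewrite mulr_ge0// expR_ge0.
have xy : (0 < dist1 x y)%N.
  rewrite lt0n; apply: contraTneq yX => /dist1_eq0 <-.
  by apply/negP => /exbdP[]; rewrite xL.
have := @dd_ball L k x (dist1 x y).-1; rewrite prednK// => H.
apply: le_trans (H _) _ => [z zx|]; first by apply: near; rewrite -(prednK xy) ltnS.
rewrite ler_pM2l// ler_expR lerN2 ler_pM2l ?rate_gt0//.
exact: eucl_le_dist1.
Qed.

Lemma GE_exbd_local D k (f : (Zd 2 -> bool) -> R) : local_on D f ->
  local_on (exbd D) (fun xi => GE beta D xi k f).
Proof.
move=> fD xi xi' same; rewrite /GE.
suff -> : ext_field beta xi k = ext_field beta xi' k :> (D -> R).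
  congr Ex; apply/funext => s; apply: fD => x xD.
  by rewrite (_ : x = val [` xD]%fset)// !glue_in.
apply/funext => u; rewrite /ext_field; congr (_ * _ + _).
by apply: eq_bigr => v _; rewrite same//; exact: valP.
Qed.

Lemma GE_01 L w k (f : (Zd 2 -> bool) -> R) : (forall xi, 0 <= f xi <= 1) ->
  0 <= GE beta L w k f <= 1.
Proof.
move=> f01; apply/andP; split.
  by rewrite -(GE_cst beta L w k 0); apply: ler_GE_fun => xi; have /andP[] := f01 xi.
by rewrite -[leRHS](GE_cst beta L w k); apply: ler_GE_fun => xi; have /andP[] := f01 xi.
Qed.

(** Conditionally on the outside of D, f is replaced by a function of the spins on [exbd D]; the sum
    thus runs over the boundary of D rather than over D. *)
Lemma GE_influence L D w w' k (f : (Zd 2 -> bool) -> R) : (D `<=` L)%fset ->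
  local_on D f -> (forall xi, 0 <= f xi <= 1) ->
  `|GE beta L w k f - GE beta L w' k f| <= 2 * \sum_(x <- exbd D) dd beta L k x.
Proof.
move=> DL fD f01; rewrite (GE_markov _ w k f DL) (GE_markov _ w' k f DL).
apply: GE_local => //; first exact: GE_exbd_local.
by move=> xi; exact: GE_01.
Qed.

Definition pair_sum (C : R) D L : R :=
  \sum_(x <- exbd D) \sum_(y <- exbd L) expR (- (C * eucl_dist R x y)).

Lemma pair_sum_ge_one C D L x y : x \in exbd D -> y \in exbd L ->
  expR (- (C * eucl_dist R x y)) <= pair_sum C D L.
Proof.
move=> xD yL; rewrite /pair_sum (big_rem x xD)/= (big_rem y yL)/= -addrA lerDl.
by rewrite addr_ge0// ?sumr_ge0// => z *; rewrite ?sumr_ge0 ?expR_ge0// => *; exact: expR_ge0.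
Qed.

Lemma pair_sum_ge_two C D L x x' y : x \in exbd D -> x' \in exbd D -> x != x' ->
  y \in exbd L ->
  expR (- (C * eucl_dist R x y)) + expR (- (C * eucl_dist R x' y)) <= pair_sum C D L.
Proof.
move=> xD x'D xx' yL; rewrite /pair_sum (big_rem x xD)/=.
have x'r : x' \in rem x (exbd D) by rewrite mem_rem_uniq ?fset_uniq// inE eq_sym xx'.
rewrite (big_rem x' x'r)/=.
have Fge z : expR (- (C * eucl_dist R z y)) <=
    \sum_(y' <- exbd L) expR (- (C * eucl_dist R z y')).
  by rewrite (big_rem y yL)/= lerDl sumr_ge0// => z' _; exact: expR_ge0.
rewrite addrA; apply: (le_trans (lerD (Fge x) (Fge x'))).
by rewrite lerDl sumr_ge0// => z _; rewrite sumr_ge0// => z' _; exact: expR_ge0.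
Qed.

(* If two boundary points are close, then at least two pairs are, so the bound
   exceeds 1; otherwise a constant prefactor can be absorbed in the rate. *)
Lemma pair_sum_close (m : nat) C D L x y : (D `<=` L)%fset -> 0 < C ->
  C * (2 * m.+2%:R) <= ln 2 -> x \in exbd D -> y \in exbd L ->
  (dist1 x y <= m)%N -> 1 <= pair_sum C D L.
Proof.
move=> DL C0 Cm xD yL xym.
have yD : y \notin D by case/exbdP: yL => + _; apply: contra; exact: (fsubsetP DL).
have [yb|yb] := boolP (y \in exbd D).
  by have := pair_sum_ge_one C yb yL; rewrite eucl_xx mulr0 oppr0 expR0.
have /exbdP[_ [u uD ux]] := xD.
have [x1 [x2 [h1 h2 h12 hd]]] := two_exits uD yD yb.
have uy : (maxn 1 (dist1 u y) <= m.+2)%N.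
  rewrite geq_max /=; apply: leq_trans (dist1_triangle u x y) _.
  by rewrite (adj_dist1 ux) add1n ltnS; apply: leq_trans xym _.
(* Two coordinates of size at most m + 2 give distance at most 2 (m + 2), so each exit contributes
   at least 1/2. *)
have far (z : Zd 2) : (forall i, (absz (z 0 i - y 0 i)%R <= maxn 1 (dist1 u y))%N) ->
    2^-1 <= expR (- (C * eucl_dist R z y)).
  move=> zi; have -> : 2^-1 = expR (- ln 2) :> R by rewrite expRN lnK// posrE.
  rewrite ler_expR lerN2; apply: le_trans Cm; rewrite ler_pM2l//.
  apply: le_trans (eucl_le_dist1 _ _ _) _; rewrite -natrM ler_nat.
  rewrite /dist1 !big_ord_recl big_ord0 addn0 mul2n -addnn.
  by apply: leq_add; apply: leq_trans (zi _) uy.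
have := pair_sum_ge_two C h1 h2 h12 yL.
have := far x1 (fun i => (hd i).1); have := far x2 (fun i => (hd i).2); lra.
Qed.

Lemma TV_le (S : finType) (P Q : {set S} -> R) (B : R) : 0 <= B ->
  (forall A, `|P A - Q A| <= B) -> TV P Q <= B.
Proof.
move=> B0 PQ; rewrite /TV; elim/big_ind: _ => // x y xB yB.
by rewrite ge_max xB.
Qed.

(** All smaller rates are included because the covariance bound has to share the rate. *)
Theorem weak_mixing : exists2 a : R, 0 < a & forall C, 0 < C -> C <= a ->
  forall (H : R) (L D : {fset Zd 2}) (h : spins L) (eta eta' : spins (exbd L)),
  (D `<=` L)%fset ->
  TV (gibbs_law (D := D) eta beta H (spin R \o h))
     (gibbs_law (D := D) eta' beta H (spin R \o h)) <= pair_sum C D L.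
Proof.
have q0 := rate_gt0.
have ln20 : 0 < ln 2 :> R by rewrite ln_gt0// ltr1n.
(* Beyond distance m, half of the rate pays for the prefactor 4, a factor 2 from [GE_influence] and
   another from [dd_exp]. *)
have [m mq] : exists m : nat, 4 * ln 2 / rate <= m%:R.
  exists (Num.bound (4 * ln 2 / rate)); apply/ltW/archi_boundP.
  by rewrite divr_ge0 ?(ltW q0)// mulr_ge0// ltW.
have M0 : 0 < 2 * (2 * m).+2%:R :> R by rewrite mulr_gt0.
(* The first entry serves far pairs, the second is the condition of [pair_sum_close] for pairs
   within 2 m. *)
pose a := Num.min (rate / 2) (ln 2 / (2 * (2 * m).+2%:R)).
have a0 : 0 < a by rewrite lt_min !divr_gt0.
exists a => // C C0; rewrite le_min => /andP[Cq Cm] H L D h eta eta' DL.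
have P0 : 0 <= pair_sum C D L.
  by apply: sumr_ge0 => x _; apply: sumr_ge0 => y _; exact: expR_ge0.
apply: TV_le => // A.
pose w (e : spins (exbd L)) x := oapp e true (insub x).
pose k x : R := H * oapp (fun u : L => spin R (h u)) 0 (insub x).
have wE e (v : exbd L) : w e (val v) = e v by rewrite /w valK.
have kE (u : L) : k (val u) = H * (spin R \o h) u by rewrite /k valK.
pose f (xi : Zd 2 -> bool) : R := ([ffun v : D => xi (val v)] \in A)%:R.
have fD : local_on D f.
  move=> xi xi' same; rewrite /f (_ : [ffun v : D => xi (val v)] = [ffun v : D => xi' (val v)])//.
  by apply/ffunP => v; rewrite !ffunE same//; exact: valP.
have f01 xi : 0 <= f xi <= 1 by rewrite /f; case: (_ \in A); rewrite /= ?lexx ?ler01.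
rewrite (gibbs_lawE beta A DL (wE eta) kE) (gibbs_lawE beta A DL (wE eta') kE) -/f.
have le1 : `|GE beta L (w eta) k f - GE beta L (w eta') k f| <= 1.
  have := GE_01 L (w eta) k f01; have := GE_01 L (w eta') k f01.
  by rewrite ler_norml; lra.
have [[x [y [xD yL xy]]]|far] := pselect (exists x y,
    [/\ x \in exbd D, y \in exbd L & (dist1 x y <= 2 * m)%N]).
  apply: le_trans le1 _; apply: (pair_sum_close DL C0 _ xD yL xy).
  by rewrite -ler_pdivlMr.
apply: le_trans (GE_influence _ _ _ DL fD f01) _.
rewrite /pair_sum mulr_sumr big_seq [leRHS]big_seq; apply: ler_sum => x xD.
(* Otherwise x lies on both boundaries, a pair at distance 0. *)
have xL : x \in L.
  apply: contrapT => /negP xL; have /exbdP[_ [u uD ux]] := xD; apply: far; exists x, x.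
  rewrite dist1xx; split => //; apply/exbdP; split => //; exists u => //.
  exact: (fsubsetP DL).
apply: le_trans (ler_wpM2l _ (dd_exp k xL)) _ => //.
rewrite mulr_sumr big_seq [leRHS]big_seq; apply: ler_sum => y yL.
have xy : m%:R <= eucl_dist R x y.
  have : ~~ (dist1 x y <= 2 * m)%N by apply/negP => ?; apply: far; exists x, y.
  rewrite -ltnNge => lt.
  (* An l1 distance above 2 m forces one of the two coordinates, hence the Euclidean distance, to be
     at least m. *)
  have [i hi] : exists i : 'I_2, (m <= absz (x 0 i - y 0 i)%R)%N.
    apply: contrapT => /forallNP none.
    move: lt; rewrite /dist1 !big_ord_recl big_ord0 addn0 ltnNge => /negP[].
    rewrite mul2n -addnn; apply: leq_add; apply: ltnW; rewrite ltnNge; apply/negP; exact: none.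
  by apply: le_trans (coord_le_eucl _ _ _ i); rewrite ler_nat.
have -> : 2 * (2 * expR (- (rate * eucl_dist R x y)))
    = expR (2 * ln 2 - rate * eucl_dist R x y).
  rewrite expRD; rewrite -[2 * ln 2]/(2%:R * ln 2) expRM_natl lnK ?posrE//; ring.
rewrite ler_expR.
have : 4 * ln 2 <= eucl_dist R x y * rate.
  by rewrite -ler_pdivrMr//; exact: le_trans xy.
have := ler_wpM2r (eucl_ge0 R x y) Cq; lra.
Qed.

End WeakMixing.

(** * The infinite volume limit *)

Section ThermodynamicLimit.
Variables (R : realType) (d : nat) (beta : R) (r : nat) (k : Zd d -> R).
Hypothesis beta0 : 0 <= beta.
Hypothesis decay : forall (L : {fset Zd d}) (k : Zd d -> R) v j,
  (forall y, (dist1 v y <= j * r.+1)%N -> y \in L) -> dd beta L k v <= 2^-1 ^+ j.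
Implicit Types (L D : {fset Zd d}) (x y : Zd d) (f : (Zd d -> bool) -> R).

Fixpoint ball1 (n : nat) : {fset Zd d} :=
  if n is n'.+1 then (ball1 n' `|` exbd (ball1 n'))%fset else [fset (0 : Zd d)]%fset.

Lemma mem_ball1 n x : (dist1 0 x <= n)%N -> x \in ball1 n.
Proof.
elim: n x => [|n IH] x; first by rewrite leqn0 => /eqP/dist1_eq0 <-; rewrite inE.
rewrite leq_eqVlt => /orP[/eqP xn|]; last by rewrite ltnS => /IH; rewrite /= inE => ->.
have [|y yx yn] := @dist1_step _ 0 x.
  by apply/eqP => x0; move: xn; rewrite -x0 dist1xx.
have yb : y \in ball1 n by apply: IH; move: yn; rewrite xn => -[->].
rewrite /= inE; have [//|xb] := boolP (x \in ball1 n).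
by apply/exbdP; split => //; exists y.
Qed.

(** By the DLR equation a mean in L averages means in a large ball, and these vary by at most e with
    the boundary condition. *)
Lemma GE_almost_constant D f (e : R) : local_on D f -> (forall xi, 0 <= f xi <= 1) ->
  0 < e -> exists L0, forall L w, (L0 `<=` L)%fset ->
  `|GE beta L w k f - GE beta L0 (@plus d) k f| <= e.
Proof.
move=> fD f01 e0.
pose m := (\sum_(x <- D) dist1 0 x)%N.
have mD x : x \in D -> (dist1 0 x <= m)%N.
  by move=> xD; rewrite /m (big_rem x xD)/= leq_addr.
pose c : R := 2 * (size D)%:R.
have c0 : 0 <= c by rewrite mulr_ge0.
have [j je] : exists j : nat, c * 2^-1 ^+ j <= e.
  exists (Num.bound (c / e)); rewrite exprVn ler_pdivrMr ?exprn_gt0//.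
  rewrite mulrC -ler_pdivrMr//; apply/ltW; apply: lt_trans (archi_boundP _) _.
    by rewrite mulr_ge0// invr_ge0 ltW.
  by rewrite -natrX ltr_nat ltn_expl.
exists (ball1 (m + j * r.+1)) => L w L0L.
have key w' w'' : `|GE beta (ball1 (m + j * r.+1)) w' k f
    - GE beta (ball1 (m + j * r.+1)) w'' k f| <= e.
  have := GE_local beta0 (ball1 (m + j * r.+1)) w' w'' k fD f01 => H.
  apply: (le_trans H).
  apply: le_trans je; rewrite /c -mulrA ler_pM2l//.
  have -> : (size D)%:R * 2^-1 ^+ j = \sum_(x <- D) 2^-1 ^+ j :> R.
    by rewrite big_const_seq count_predT iter_addr_0 mulr_natl.
  rewrite big_seq [leRHS]big_seq; apply: ler_sum => x xD; apply: decay => y xy.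
  apply: mem_ball1; apply: leq_trans (dist1_triangle _ x _) _.
  by rewrite leq_add// mD.
rewrite (GE_markov _ _ _ _ L0L).
set a := GE beta (ball1 _) (@plus d) k f.
have lo : a - e <= GE beta L w k (fun xi => GE beta (ball1 (m + j * r.+1)) xi k f).
  rewrite -[leLHS](GE_cst beta L w k); apply: ler_GE_fun => xi.
  by have := key xi (@plus d); rewrite -/a ler_norml; lra.
have hi : GE beta L w k (fun xi => GE beta (ball1 (m + j * r.+1)) xi k f) <= a + e.
  rewrite -[leRHS](GE_cst beta L w k); apply: ler_GE_fun => xi.
  by have := key xi (@plus d); rewrite -/a ler_norml; lra.
by rewrite ler_norml; lra.
Qed.

Definition lval f : R := lim ((fun L => GE beta L (@plus d) k f) @ totally).

Lemma lval_cvg D f (w : {fset Zd d} -> Zd d -> bool) :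
  local_on D f -> (forall xi, 0 <= f xi <= 1) ->
  (fun L => GE beta L (w L) k f) @ totally --> lval f.
Proof.
move=> fD f01; have PF : ProperFilter (@totally (Zd d)) := totally_filter.
have cv : cvg ((fun L => GE beta L (@plus d) k f) @ totally).
  apply: cauchy_cvg; apply: cauchy_exP => e e0.
  have e20 : 0 < e / 2 by rewrite divr_gt0.
  have [L0 H] := GE_almost_constant fD f01 e20.
  exists (GE beta L0 (@plus d) k f); exists L0 => // L /= L0L.
  rewrite /ball /= distrC; apply: le_lt_trans (H L _ L0L) _; lra.
apply/cvgrPdist_lt => e e0; have e30 : 0 < e / 3 by rewrite divr_gt0.
have [L0 H] := GE_almost_constant fD f01 e30.
have /cvgrPdist_lt/(_ _ e30)[L1 _ H1] := cv.
exists (L0 `|` L1)%fset => // L /= LL.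
have L0L : (L0 `<=` L)%fset := fsubset_trans (fsubsetUl _ _) LL.
have L1L : (L1 `<=` L)%fset := fsubset_trans (fsubsetUr _ _) LL.
have := H L (w L) L0L; have := H L (@plus d) L0L; have := H1 L L1L.
rewrite /= -/(lval f) !ltr_norml !ler_norml; lra.
Qed.

Lemma lval_plus_cvg D f : local_on D f -> (forall xi, 0 <= f xi <= 1) ->
  (fun L => GE beta L (@plus d) k f) @ totally --> lval f.
Proof. exact: (lval_cvg (fun=> @plus d)). Qed.

Lemma lval_unique f (l : R) :
  (fun L => GE beta L (@plus d) k f) @ totally --> l -> lval f = l.
Proof.
by move=> cv; have PF : ProperFilter (@totally (Zd d)) := totally_filter; apply: cvg_lim.
Qed.

(** Codes of no vertex stand for 0: the words then merely repeat the spin there. *)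
Definition site (n : nat) : Zd d := odflt 0 (choice.unpickle n).

Lemma site_pickle x : site (choice.pickle x) = x.
Proof. by rewrite /site choice.pickleK. Qed.

Definition word (xi : Zd d -> bool) (n : nat) : seq bool := mkseq (fun i => xi (site i)) n.

Definition is_word (s : seq bool) (xi : Zd d -> bool) : R := (word xi (size s) == s)%:R.

Definition sites (n : nat) : {fset Zd d} := [fset x in mkseq site n]%fset.

Lemma is_word_local s : local_on (sites (size s)) (is_word s).
Proof.
move=> xi xi' same; rewrite /is_word (_ : word xi (size s) = word xi' (size s))//.
apply/eq_in_map => i ilt; apply: same; rewrite in_fset /=; exact: map_f.
Qed.

Lemma is_word01 s xi : 0 <= is_word s xi <= 1.
Proof. by rewrite /is_word ler0n lern1 leq_b1. Qed.

Definition pw s : R := lval (is_word s).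

Lemma pw_cvg s : (fun L => GE beta L (@plus d) k (is_word s)) @ totally --> pw s.
Proof. exact: lval_plus_cvg (@is_word_local s) (@is_word01 s). Qed.

Lemma pw_ge0 s : 0 <= pw s.
Proof.
have PF : ProperFilter (@totally (Zd d)) := totally_filter.
have cv : cvg ((fun L => GE beta L (@plus d) k (is_word s)) @ totally).
  by apply/cvg_ex; exists (pw s); exact: pw_cvg.
apply: (limr_ge cv); exists fset0 => // L _ /=.
rewrite -(GE_cst beta L (@plus d) k 0); apply: ler_GE_fun => xi.
by have /andP[] := is_word01 s xi.
Qed.

Lemma pw_nil : pw [::] = 1.
Proof.
have PF : ProperFilter (@totally (Zd d)) := totally_filter.
apply: lval_unique; rewrite (_ : (fun L => _) = cst 1); first exact: cvg_cst.
by apply/funext => L; exact: GE_cst.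
Qed.

Lemma is_word_rcons s b xi :
  is_word (rcons s b) xi = (word xi (size s) == s)%:R * (xi (site (size s)) == b)%:R.
Proof.
by rewrite /is_word size_rcons /word mkseqS eqseq_rcons -natrM mulnb.
Qed.

Lemma pw_rcons s : pw s = pw (rcons s false) + pw (rcons s true).
Proof.
have PF : ProperFilter (@totally (Zd d)) := totally_filter.
apply: lval_unique.
rewrite (_ : (fun L => _) = (fun L => GE beta L (@plus d) k (is_word (rcons s false)))
    \+ (fun L => GE beta L (@plus d) k (is_word (rcons s true)))).
  by apply: cvgD; exact: pw_cvg.
apply/funext => L /=; rewrite -GED; congr GE; apply/funext => xi.
by rewrite !is_word_rcons -mulrDr /is_word; case: (xi _); rewrite /= ?addr0 ?add0r mulr1.
Qed.

Lemma lval_sum (T : Type) (rs : seq T) (c : T -> R) (g : T -> (Zd d -> bool) -> R) :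
  (forall t, (fun L => GE beta L (@plus d) k (g t)) @ totally --> lval (g t)) ->
  lval (fun xi => \sum_(t <- rs) c t * g t xi) = \sum_(t <- rs) c t * lval (g t).
Proof.
have PF : ProperFilter (@totally (Zd d)) := totally_filter.
move=> cv; apply: lval_unique.
elim: rs => [|t rs IH].
  rewrite big_nil (_ : (fun L => _) = cst 0); first exact: cvg_cst.
  apply/funext => L; rewrite -[RHS](GE_cst beta L (@plus d) k 0); congr GE.
  by apply/funext => xi; rewrite big_nil.
rewrite big_cons (_ : (fun L => _) = (fun L => c t * GE beta L (@plus d) k (g t)) \+
    (fun L => GE beta L (@plus d) k (fun xi => \sum_(t <- rs) c t * g t xi))).
  by apply: cvgD => //; apply: cvgMr.
apply/funext => L /=; rewrite -GEZ -GED; congr GE.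
by apply/funext => xi; rewrite big_cons.
Qed.

Lemma lval_words (n : nat) (f : (Zd d -> bool) -> R) (c : n.-tuple bool -> R) :
  (forall xi, f xi = \sum_(s : n.-tuple bool) c s * is_word s xi) ->
  lval f = \sum_(s : n.-tuple bool) c s * pw s.
Proof.
move=> fE; rewrite (_ : f = fun xi => \sum_(s : n.-tuple bool) c s * is_word s xi).
  by apply: lval_sum => s; exact: pw_cvg.
exact/funext.
Qed.

(* A uniform variable t in [0, 1] is turned into a configuration: pre t n is
   the word s of length n such that t lies in the interval of length pw s
   starting at left s. *)
Fixpoint left_end (s : seq bool) : R :=
  if s is b :: s' then left_end s' + (if b then pw (rcons (rev s') false) else 0) else 0.

Definition left s := left_end (rev s).

Lemma left_rcons s b :
  left (rcons s b) = left s + (if b then pw (rcons s false) else 0).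
Proof. by rewrite /left rev_rcons /= revK. Qed.

Fixpoint pre (t : R) (n : nat) : seq bool :=
  if n is n'.+1 then
    let s := pre t n' in rcons s (left s + pw (rcons s false) <= t)
  else [::].

Lemma size_pre t n : size (pre t n) = n.
Proof. by elim: n => //= n IH; rewrite size_rcons IH. Qed.

(** By [pw_rcons] the intervals of the two extensions of s split its own at the threshold used by
    [pre]. *)
Lemma preP (t : R) s : 0 <= t < 1 -> (pre t (size s) == s) = (left s <= t < left s + pw s).
Proof.
move=> t01; elim/last_ind: s => [|s b IH].
  by rewrite /= eqxx /left /= add0r pw_nil t01.
rewrite size_rcons /= eqseq_rcons left_rcons; have p0 := pw_ge0 (rcons s false).
have p1 := pw_ge0 (rcons s true).
have [ps|ps] := eqVneq (pre t (size s)) s.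
  rewrite ps; move: IH; rewrite ps eqxx => /esym/andP[l1 l2] /=.
  move: l2; rewrite pw_rcons => l2.
  case: b => /=; first by rewrite eqb_id -addrA l2 andbT.
  by rewrite addr0 l1 eqbF_neg ltNge.
move: IH; rewrite (negPf ps) => /esym IH /=; apply/esym/negP => h.
move: IH; rewrite pw_rcons => /negP[].
by case: b h => /= /andP[h1 h2]; apply/andP; split; lra.
Qed.

Definition digit (t : R) (n : nat) : bool :=
  left (pre t n) + pw (rcons (pre t n) false) <= t.

Lemma pre_digit t n : pre t n = mkseq (digit t) n.
Proof. by elim: n => //= n IH; rewrite mkseqS -IH. Qed.

Definition sample (t : R) : config (Zd d) := fun x => digit t (choice.pickle x).

End ThermodynamicLimit.

(** * The limit measure as an image of the uniform law *)

Section InfiniteVolumeMeasure.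
Variables (R : realType) (d : nat) (beta : R) (r : nat) (k : Zd d -> R).
Hypothesis beta0 : 0 <= beta.
Hypothesis decay : forall (L : {fset Zd d}) (k : Zd d -> R) v j,
  (forall y, (dist1 v y <= j * r.+1)%N -> y \in L) -> dd beta L k v <= 2^-1 ^+ j.

Local Notation pre := (pre beta k).
Local Notation left := (left beta k).
Local Notation pw := (pw beta k).
Local Notation digit := (digit beta k).
Local Notation sample := (sample beta k).

Lemma measurable_threshold (c : R) (b : bool) :
  measurable [set t : measurableTypeR R | (c <= t) = b].
Proof.
case: b.
  rewrite (_ : [set t : R | _] = `[c, +oo[%classic); first exact: measurable_itv.
  by apply/seteqP; split => t /=; rewrite in_itv /= andbT.
rewrite (_ : [set t : R | _] = `]-oo, c[%classic); first exact: measurable_itv.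
apply/seteqP; split => t /=; rewrite in_itv /= ltNge; first by move=> ->.
by move=> /negbTE.
Qed.

Lemma measurable_pre n (s : seq bool) : measurable [set t : measurableTypeR R | pre t n = s].
Proof.
elim: n s => [|n IH] s.
  case: s => [|b s].
    by rewrite (_ : [set t : R | pre t 0 = [::]] = setT)//; apply/seteqP.
  by rewrite (_ : [set t : R | _] = set0)//; apply/seteqP; split.
case/lastP: s => [|s b].
  rewrite (_ : [set t : R | _] = set0)//; apply/seteqP; split => // t /=.
  by move/(congr1 size); rewrite size_rcons.
rewrite (_ : [set t : R | _] = [set t | pre t n = s] `&`
    [set t : R | (left s + pw (rcons s false) <= t) = b]).
  by apply: measurableI; [exact: IH|exact: measurable_threshold].
apply/seteqP; split => t /=; first by move/eqP; rewrite eqseq_rcons => /andP[/eqP <- /eqP].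
by move=> [-> ->].
Qed.

Lemma measurable_words (n : nat) (g : pred (seq bool)) :
  measurable [set t : measurableTypeR R | g (pre t n)].
Proof.
rewrite (_ : [set t : R | _] =
    \big[setU/set0]_(s : n.-tuple bool | g s) [set t | pre t n = s]).
  by apply: bigsetU_measurable => s _; exact: measurable_pre.
apply/seteqP; split => t /=.
  move=> gt; have sz : size (pre t n) == n by rewrite size_pre.
  by rewrite -bigcup_seq_cond; exists (Tuple sz) => //=; rewrite mem_index_enum.
by rewrite -bigcup_seq_cond => -[s /andP[_ gs] /= ->].
Qed.

Lemma measurable_sample : @measurable_fun _ _ (measurableTypeR R) (config (Zd d)) setT sample.
Proof.
apply: (@measurability _ _ _ (config (Zd d)) _ _ (@cylinders (Zd d))) => //.
move=> _ [_ [x [b ->]] <-]; rewrite setTI.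
set n := choice.pickle x.
have := measurable_words n.+1 (fun s => nth true s n == b).
rewrite (_ : [set t : R | _] = sample @^-1` [set w | w x = b])//.
apply/seteqP; split => t /=; rewrite nth_rcons size_pre ltnn eqxx => /eqP //.
Qed.

Definition sample_rv : {mfun measurableTypeR R >-> config (Zd d)} :=
  @mfun_Sub _ _ (measurableTypeR R) (config (Zd d)) sample (mem_set measurable_sample).

Definition limit_measure : probability (config (Zd d)) R :=
  distribution (uniform_prob (@ltr01 R)) sample_rv.

Lemma limit_measureE (A : set (config (Zd d))) :
  limit_measure A = uniform_prob (@ltr01 R) (sample @^-1` A).
Proof. by []. Qed.

Lemma left_bounds s : 0 <= left s /\ left s + pw s <= 1.
Proof.
elim/last_ind: s => [|s b [IH0 IH1]].
  by rewrite /left /= add0r pw_nil.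
rewrite left_rcons; move: IH1; rewrite (pw_rcons k beta0 decay s).
have := pw_ge0 k beta0 decay (rcons s false); have := pw_ge0 k beta0 decay (rcons s true).
by case: b => *; split; lra.
Qed.

Lemma uniform_pre (s : seq bool) :
  uniform_prob (@ltr01 R) [set t | pre t (size s) = s] = (pw s)%:E.
Proof.
have [l0 l1] := left_bounds s; have p0 := pw_ge0 k beta0 decay s.
rewrite /uniform_prob integral_uniform_pdf.
rewrite (eq_integral (cst 1%E)); last first.
  move=> t; rewrite inE /= => -[_]; rewrite in_itv /= => t01.
  by rewrite /uniform_pdf t01 subr0 invr1.
have mI : measurable ([set t : measurableTypeR R | pre t (size s) = s] `&` `[0, 1]).
  by apply: measurableI => //; exact: measurable_pre.
rewrite integral_cst// mul1e.
have m1 : measurable ([set 1] : set (measurableTypeR R)) by exact: measurable_set1.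
(* The endpoint 1, which the half-open intervals miss, is split off as a null set. *)
have -> : [set t : measurableTypeR R | pre t (size s) = s] `&` `[0, 1]%classic
    = `[left s, left s + pw s[%classic
      `|` ([set t | pre t (size s) = s] `&` `[0, 1] `&` [set 1]).
  apply/seteqP; split => t /=; rewrite !in_itv /=.
    move=> [ts /andP[t0]]; rewrite le_eqVlt => /orP[/eqP t1|t1].
      by right; subst t; rewrite t0 eqxx.
    by left; have := preP k beta0 decay s (t := t); rewrite t0 t1 ts eqxx => <-.
  move=> [/andP[h1 h2]|[]//].
  have t01 : 0 <= t < 1 by apply/andP; split; lra.
  split; last by move: t01 => /andP[-> /ltW].
  by apply/eqP; rewrite (preP k beta0 decay s t01) h1 h2.
rewrite measureU0/=; last 3 first.
- exact: measurable_itv.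
- by apply: measurableI.
- apply: subset_measure0 (lebesgue_measure_set1 1) => //.
    by apply: measurableI.
rewrite lebesgue_measure_itv /= lte_fin.
case: ltP => h; first by rewrite -EFinD; congr (_%:E); ring.
congr (_%:E); apply/eqP; lra.
Qed.

Lemma uniform_words (n : nat) (g : pred (seq bool)) :
  uniform_prob (@ltr01 R) [set t | g (pre t n)] =
  (\sum_(s : n.-tuple bool) (g s)%:R * pw s)%:E.
Proof.
pose rs := [seq s <- index_enum (n.-tuple bool : finType) | g (s : n.-tuple bool)].
have urs : uniq rs by rewrite filter_uniq// index_enum_uniq.
have -> : [set t | g (pre t n)] =
    \bigcup_(s in [set` rs]) [set t : measurableTypeR R | pre t n = val s].
  apply/seteqP; split => t /=.
    move=> gt; have sz : size (pre t n) == n by rewrite size_pre.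
    by exists (Tuple sz) => //=; rewrite mem_filter mem_index_enum gt.
  by move=> -[s /=]; rewrite mem_filter => /andP[gs _] ->.
rewrite measure_fin_bigcup; last 3 first.
- exact: finite_seq.
- by move=> s s' _ _ [t [/= ts ts']]; apply: val_inj; exact: etrans (esym ts) ts'.
- by move=> s _; exact: measurable_pre.
rewrite -fsbig_seq//= big_filter -sumEFin big_mkcond /=; apply: eq_bigr => s _.
case: (g s) => /=; last by rewrite mul0r.
by rewrite mul1r -uniform_pre size_tuple.
Qed.

Lemma event_words (D : {fset Zd d}) (A : {set spins D}) : exists n (g : pred (seq bool)),
  forall xi : nat -> bool,
  ([ffun v : D => xi (choice.pickle (val v))] \in A) = g (mkseq xi n).
Proof.
pose n := (\max_(v : D) choice.pickle (val v)).+1.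
exists n, (fun s => [ffun v : D => nth true s (choice.pickle (val v))] \in A) => xi.
congr (_ \in A); apply/ffunP => v; rewrite !ffunE nth_mkseq// ltnS.
exact: (leq_bigmax v).
Qed.

Lemma limit_measure_event (D : {fset Zd d}) (A : {set spins D}) :
  limit_measure [set w | [ffun v : D => w (val v)] \in A] =
  (lval beta k (fun xi => ([ffun v : D => xi (val v)] \in A)%:R))%:E.
Proof.
have [n [g gE]] := event_words A.
rewrite limit_measureE.
have -> : sample @^-1` [set w | [ffun v : D => w (val v)] \in A] = [set t | g (pre t n)].
  by apply/seteqP; split => t /=; rewrite pre_digit -gE.
rewrite uniform_words; congr (_%:E); apply/esym/(lval_words k beta0 decay) => xi.
have -> : [ffun v : D => xi (val v)]
    = [ffun v : D => xi (site d (choice.pickle (val v)))] :> spins D.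
  by apply/ffunP => v; rewrite !ffunE site_pickle.
rewrite (gE (fun i => xi (site d i))).
have sz : size (word xi n) == n by rewrite size_mkseq.
rewrite (bigD1 (Tuple sz))//= big1 => [|s sw].
  by rewrite /is_word size_mkseq eqxx mulr1 addr0.
rewrite /is_word size_tuple [word xi n == _]eq_sym.
by rewrite -[_ == word _ _]/(s == Tuple sz) (negPf sw) mulr0.
Qed.

Lemma limit_measure_infinite_volume H (hh : Zd d -> R) : (forall x, k x = H * hh x) ->
  is_infinite_volume_limit beta H hh limit_measure.
Proof.
move=> kE eta D A; rewrite limit_measure_event /=.
set f := fun xi : Zd d -> bool => ([ffun v : D => xi (val v)] \in A)%:R : R.
have PF : ProperFilter (@totally (Zd d)) := totally_filter.
pose w (L : {fset Zd d}) x := oapp (eta L) true (insub x).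
have cv : (fun L => GE beta L (w L) k f) @ totally --> lval beta k f.
  apply: (lval_cvg beta0 decay (D := D)) => [xi xi' xx'|xi].
    by rewrite /f; congr ((_ \in A)%:R); apply/ffunP => v; rewrite !ffunE xx'// fsvalP.
  by rewrite /f ler0n lern1 leq_b1.
(* The two descriptions of the law agree once L contains D, which holds eventually along the net. *)
apply: cvg_trans cv; apply: near_eq_cvg; exists D => // L /= DL.
rewrite (gibbs_lawE beta A DL (w := w L) (k := k))// => v.
by rewrite /w valK.
Qed.

End InfiniteVolumeMeasure.

(** * Covariances *)

Section Covariance.
Variables (R : realType) (d : nat) (beta : R).
Hypothesis beta0 : 0 <= beta.
Implicit Types (L Q : {fset Zd d}) (x y : Zd d) (k : Zd d -> R) (w : Zd d -> bool).

(** The conditional mean at x is affine in the spin at y, so the covariance is the slope times the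
    variance 1 - m^2 of that spin. *)
Lemma cov_GE L Q k x y : x \in Q -> y \in L -> Q = (L `\ y)%fset -> 
  0 <= GE beta L (@plus d) k (fun xi => spin R (xi x) * spin R (xi y))
       - mg beta L (@plus d) k x * mg beta L (@plus d) k y <= dd beta Q k x.
Proof.
move=> xQ yL QE; set w := @plus d.
have QL : (Q `<=` L)%fset by rewrite QE fsubD1set.
have yQ : y \notin Q by rewrite QE !inE eqxx.
pose G b := mg beta Q (upd w y b) k x.
have GEE s : mg beta Q (glue w s) k x
    = (G true + G false) / 2 + (G true - G false) / 2 * spin R (glue w (s : spins L) y).
  rewrite (@mg_local _ _ beta Q _ (upd w y (glue w s y)) k x xQ); last first.
    move=> z; rewrite in_exbd => /andP[zQ _]; rewrite /upd; case: eqP => [-> //|/eqP zy].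
    by apply: glue_out; apply: contra zQ => zL; rewrite QE !inE zy zL.
  by rewrite -/(G _); case: (glue w s y) => /=; lra.
set m := mg beta L w k y.
have mxE : mg beta L w k x = (G true + G false) / 2 + (G true - G false) / 2 * m.
  rewrite {1}/mg (GE_markov _ _ _ _ QL) -[X in X + _](GE_cst beta L w k) -GEZ -GED.
  rewrite /GE; congr Ex; apply/funext => s; exact: GEE.
have mxyE : GE beta L w k (fun xi => spin R (xi x) * spin R (xi y))
    = (G true + G false) / 2 * m + (G true - G false) / 2.
  rewrite (GE_markov _ _ _ _ QL) -[X in _ + X](GE_cst beta L w k) -GEZ -GED.
  rewrite /GE; congr Ex; apply/funext => s.
  transitivity (mg beta Q (glue w s) k x * spin R (glue w s y)).
    rewrite mulrC -GEZ /GE; congr Ex; apply/funext => t.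
    by rewrite [glue _ t y]glue_out// mulrC.
  by rewrite GEE; case: (glue w s y) => /=; lra.
rewrite mxE mxyE.
have G0 : G false <= G true.
  apply: ler_GE => //; first exact: cincr_spin.
  by move=> z; rewrite /upd; case: eqP => // _; exact: implybb.
have ddG : (G true - G false) / 2 <= dd beta Q k x.
  rewrite /dd ler_pM2r ?invr_gt0//; apply: lerB; [exact: mg_plus|exact: mg_minus].
have /andP[m1 m2] : -1 <= m <= 1 by exact: mg_bound.
set a := (G true + G false) / 2; set b := (G true - G false) / 2.
have b0 : 0 <= b by rewrite divr_ge0// subr_ge0.
have mm : 0 <= 1 - m * m <= 1 by apply/andP; split; nra.
have -> : a * m + b - (a + b * m) * m = b * (1 - m * m) by ring.
case/andP: mm => mm0 mm1; rewrite mulr_ge0//=; apply: le_trans ddG; rewrite -/b.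
by rewrite ler_piMr.
Qed.

End Covariance.

(** * Covariances under the limit measure *)

Section LimitCovariance.
Variables (R : realType) (beta : R) (r : nat) (k : Zd 2 -> R).
Hypothesis beta0 : 0 <= beta.
Hypothesis decay : forall (L : {fset Zd 2}) (k : Zd 2 -> R) v j,
  (forall y, (dist1 v y <= j * r.+1)%N -> y \in L) -> dd beta L k v <= 2^-1 ^+ j.
Implicit Types x y : Zd 2.

Local Notation mu := (limit_measure beta k).

Lemma measurable_spin x b : measurable [set w : config (Zd 2) | w x = b].
Proof. by apply: sub_gen_smallest; exists x, b. Qed.

Lemma expect_spin (P : probability (config (Zd 2)) R) (b : config (Zd 2) -> bool) :
  measurable [set w | b w] ->
  expect P (fun w => spin R (b w)) = 2 * fine (P [set w | b w]) - 1.
Proof.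
move=> mb; rewrite /expect.
rewrite (_ : (fun w => _) = (2 \o* \1_[set w | b w]) \- cst 1); last first.
  apply/funext => w /=; rewrite indicE mem_setE /= unfold_in.
  by case: (b w) => /=; lra.
have L1 : (\1_[set w | b w] : config (Zd 2) -> R) \in Lfun P 1.
  by apply/Lfun1_integrable; exact: integrable_indic.
rewrite expectationB ?Lfun_cst ?Lfun_scale// expectationZl// expectation_indic//.
rewrite expectation_cst fineB ?fineM//= ?fin_numM// fin_num_measure//.
Qed.

Lemma limit_spin (D : {fset Zd 2}) (A : {set spins D}) (b : config (Zd 2) -> bool) :
  measurable [set w | b w] -> (forall w, b w = ([ffun v : D => w (val v)] \in A)) ->
  (fun L => GE beta L (@plus 2) k (fun w => spin R (b w))) @ totally -->
    expect mu (fun w => spin R (b w)).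
Proof.
move=> mb bE; rewrite expect_spin//.
pose f := fun xi : Zd 2 -> bool => (([ffun v : D => xi (val v)] \in A)%:R : R).
have -> : [set w | b w] = [set w | [ffun v : D => w (val v)] \in A].
  by apply/seteqP; split => w /=; rewrite bE.
rewrite (limit_measure_event k beta0 decay) /= -/f.
have PF : ProperFilter (@totally (Zd 2)) := totally_filter.
rewrite (_ : (fun L => _) = (fun L => 2 * GE beta L (@plus 2) k f) \- cst 1); last first.
  apply/funext => L /=; rewrite -GEZ -[X in _ - X](GE_cst beta L (@plus 2) k) -GEB.
  by congr GE; apply/funext => xi; rewrite bE /f; case: (_ \in A) => /=; lra.
apply: cvgB; last exact: cvg_cst.
apply: cvgMr; apply: (lval_plus_cvg beta0 decay (D := D)) => [xi xi' xx'|xi].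
  by rewrite /f; congr ((_ \in A)%:R); apply/ffunP => v; rewrite !ffunE xx'// fsvalP.
by rewrite /f ler0n lern1 leq_b1.
Qed.

Lemma limit_spin1 x :
  (fun L => mg beta L (@plus 2) k x) @ totally --> expect mu (fun w => spin R (w x)).
Proof.
have xD : x \in [fset x]%fset by rewrite inE.
apply: (@limit_spin _ [set s : spins [fset x]%fset | s (FSetSub xD)] (fun w => w x)).
  exact: (measurable_spin x true).
by move=> w; rewrite inE ffunE.
Qed.

Lemma limit_spin2 x y :
  (fun L => GE beta L (@plus 2) k (fun w => spin R (w x) * spin R (w y))) @ totally -->
    expect mu (fun w => spin R (w x) * spin R (w y)).
Proof.
have xD : x \in [fset x; y]%fset by rewrite !inE eqxx.
have yD : y \in [fset x; y]%fset by rewrite !inE eqxx orbT.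
(* The product of two spins is the spin of the event that they agree, which brings it under
   [limit_spin]. *)
have sE : (fun w : config (Zd 2) => spin R (w x) * spin R (w y)) = fun w => spin R (w x == w y).
  by apply/funext => w; case: (w x); case: (w y) => /=; lra.
rewrite sE; apply: (@limit_spin _
  [set s : spins [fset x; y]%fset | s (FSetSub xD) == s (FSetSub yD)]
  (fun w => w x == w y)).
  rewrite (_ : [set w | _] =
      ([set w : config (Zd 2) | w x = true] `&` [set w | w y = true])
      `|` ([set w : config (Zd 2) | w x = false] `&` [set w | w y = false])).
    by apply: measurableU; apply: measurableI; exact: measurable_spin.
  apply/seteqP; split => w /=; first by case: (w x); case: (w y) => //; [left|right].
  by move=> [] [-> ->].
by move=> w; rewrite inE !ffunE.
Qed.

Lemma limit_covariance x y :
  0 <= expect mu (fun w => spin R (w x) * spin R (w y))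
       - expect mu (fun w => spin R (w x)) * expect mu (fun w => spin R (w y))
    <= 2 * expR (- (rate R r * (dist1 x y)%:R)).
Proof.
have PF : ProperFilter (@totally (Zd 2)) := totally_filter.
set c := expect mu _ - _.
have cv : (fun L => GE beta L (@plus 2) k (fun w => spin R (w x) * spin R (w y))
    - mg beta L (@plus 2) k x * mg beta L (@plus 2) k y) @ totally --> c.
  by apply: cvgB; [exact: limit_spin2|apply: cvgM; exact: limit_spin1].
have cvc := cvgP _ cv.
suff [L0 LB] : exists L0, forall L, (L0 `<=` L)%fset ->
    0 <= GE beta L (@plus 2) k (fun w => spin R (w x) * spin R (w y))
      - mg beta L (@plus 2) k x * mg beta L (@plus 2) k y
      <= 2 * expR (- (rate R r * (dist1 x y)%:R)).
  rewrite -(cvg_lim _ cv)//; apply/andP; split.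
    by apply: (limr_ge cvc); exists L0 => // L /LB /andP[].
  by apply: (limr_le cvc); exists L0 => // L /LB /andP[].
have [->|xy] := eqVneq x y.
  exists fset0 => L _; rewrite dist1xx mulr0 oppr0 expR0.
  rewrite (_ : (fun w => _) = fun=> 1); last first.
    by apply/funext => w; case: (w y) => /=; lra.
  have /andP[m1 m2] := mg_bound beta L (@plus 2) k y.
  by rewrite GE_cst; apply/andP; split; nra.
have [n nE] : exists n, dist1 x y = n.+1.
  have [z _ <-] := dist1_step xy; by eexists.
(* The ball of radius n around x just misses y, so it lies in L without y. *)
exists (ball1 2 (dist1 0 x + n) `|` [fset x; y])%fset => L LL.
have BL z : (dist1 x z <= n)%N -> z \in L.
  move=> xz; apply: (fsubsetP LL); rewrite inE mem_ball1//.
  by apply: leq_trans (dist1_triangle 0 x z) _; rewrite leq_add2l.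
have xL : x \in L by apply: BL; rewrite dist1xx.
have yL : y \in L by apply: (fsubsetP LL); rewrite !inE eqxx !orbT.
have xQ : x \in (L `\ y)%fset by rewrite !inE xy.
have /andP[-> h] := cov_GE beta0 k xQ yL (erefl _); apply: le_trans h _ => /=.
rewrite nE; apply: (dd_ball decay) => z xz; rewrite !inE BL// andbT.
by apply/eqP => zy; move: xz; rewrite zy nE ltnn.
Qed.

End LimitCovariance.

Theorem corollary1 (R : realType) (beta : R) :
  0 <= beta -> (beta%:E < beta_c R 2)%E ->
  exists H1 : \bar R,
    [/\ (0 < H1)%E,
        (beta%:E <= beta_P R 2)%E -> H1 = +oo%E,
        (beta_P R 2 < beta%:E)%E -> (H1 < +oo)%E &
        forall H : R, 0 <= H -> (H%:E < H1)%E ->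
        exists C1 C7 : R,
          [/\ 0 < C1, 0 < C7,
              forall (Lambda Delta : {fset Zd 2}) (h : spins Lambda)
                     (eta eta' : spins (exbd Lambda)),
                (Delta `<=` Lambda)%fset ->
                TV (gibbs_law (D := Delta) eta beta H (spin R \o h))
                   (gibbs_law (D := Delta) eta' beta H (spin R \o h))
                <= \sum_(x <- exbd Delta) \sum_(y <- exbd Lambda)
                     expR (- (C1 * eucl_dist R x y)) &
              forall h : Zd 2 -> bool,
              exists mu : probability (config (Zd 2)) R,
                is_infinite_volume_limit beta H (spin R \o h) mu /\
                forall x y : Zd 2,
                  0 <= expect mu (fun w => spin R (w x) * spin R (w y))
                       - expect mu (fun w => spin R (w x))
                         * expect mu (fun w => spin R (w y))
                    <= C7 * expR (- (C1 * eucl_dist R x y / 2))]].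
Proof.
move=> beta0 /(finite_size_criterion beta0)[S S0 half].
have [r decay] := dd_decay beta0 S0 half.
have [a a0 mixing] := weak_mixing beta0 decay.
(* The bounds hold for every H, so 1 is an arbitrary finite positive choice. *)
exists (if (beta%:E <= beta_P R 2)%E then +oo else 1)%E; split.
- by case: ifP.
- by move=> ->.
- by rewrite ltNge => /negbTE ->; exact: ltry.
(* The minimum is a rate for both bounds; 2 is the prefactor of [limit_covariance]. *)
move=> H H0 _; exists (Num.min a (rate R r)), 2; split => //.
- by rewrite lt_min a0 rate_gt0.
- move=> Lambda Delta h eta eta' DL; apply: (mixing (Num.min a (rate R r))) => //.
    by rewrite lt_min a0 rate_gt0.
  by rewrite ge_min lexx.
move=> h; exists (limit_measure beta (fun x => H * spin R (h x))); split.
  exact: (limit_measure_infinite_volume beta0 decay).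
move=> x y.
have /andP[-> cov_le] := limit_covariance (fun x => H * spin R (h x)) beta0 decay x y.
apply: (le_trans cov_le); rewrite ler_pM2l// ler_expR lerN2.
set C := Num.min a _.
have C0 : 0 <= C by rewrite le_min (ltW a0) ltW// rate_gt0.
have Cr : C <= rate R r by rewrite ge_min lexx orbT.
apply: (@le_trans _ _ (C * eucl_dist R x y)).
  by rewrite ler_pdivrMr// ler_peMr ?mulr_ge0 ?eucl_ge0// ler1n.
by apply: ler_pM => //; [exact: eucl_ge0|exact: eucl_le_dist1].
Qed.
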